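(* For $k\in\mathbb{N}_+$ let $w_k\in H^1_{0,r}(B_1)$ be the unique solution of $-\Delta w+w=w^3$ in $B_1$ with $w(0)>0$ and $n(w)=k-1$. Then for any $k,i\in\mathbb{N}_+$ with $k>i$, $$n(w_k-w_i)=n(w_k+w_i)=k-1.$$
   Context: $B_1$ is the open unit ball of $\mathbb{R}^3$ centered at the origin, $H^1_{0,r}(B_1)$ is the subspace of radial functions of $H^1_0(B_1)$, and $\mathbb{N}_+$ is the set of positive integers. Nodal number: for a continuous radial function $u:B_1\to\mathbb{R}$, $n(u)$ is the maximum nonnegative integer $m$ such that there are $0<x_0<x_1<\cdots<x_m<1$ with $u|_{|x|=x_{j-1}}\cdot u|_{|x|=x_j}<0$ for $j=1,\dots,m$. Existence and uniqueness of $w_k$ are known. *)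

(* Defs.v *)
From HB Require Import structures.
From mathcomp Require Import all_boot all_order all_algebra.
From mathcomp Require Import all_classical all_reals all_analysis.

Set Implicit Arguments.
Unset Strict Implicit.
Unset Printing Implicit Defensive.

Import Order.TTheory GRing.Theory Num.Theory.
Import numFieldNormedType.Exports.

Local Open Scope classical_set_scope.
Local Open Scope ring_scope.

(* R^3 is the product type [R * R * R], which carries both the product topology
   and the product sigma-algebra. Its library norm is the sup norm, so the
   Euclidean norm is defined separately. *)
Notation R3 R := (R * R * R)%type.

Notation lebesgue3 R :=
  ((@lebesgue_measure R \x @lebesgue_measure R) \x @lebesgue_measure R)%E.

Section euclidean_space.
Variable R : realType.

Definition enorm (x : R3 R) : R :=
  Num.sqrt (x.1.1 ^+ 2 + x.1.2 ^+ 2 + x.2 ^+ 2).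

Definition B1 : set (R3 R) := [set x | enorm x < 1].

Definition basis (i : 'I_3) : R3 R :=
  ((i == 0%N :> nat)%:R, (i == 1%N :> nat)%:R, (i == 2%N :> nat)%:R).

Definition partial (i : 'I_3) (f : R3 R -> R) : R3 R -> R :=
  fun x => 'D_(basis i) f x.

Definition smooth (f : R3 R -> R) : Prop :=
  forall s : seq 'I_3, let g := foldr partial f s in
    continuous g /\ forall i x, derivable g x (basis i).

Definition test_function (phi : R3 R -> R) : Prop :=
  let supp := closure [set x | phi x != 0] in
  [/\ smooth phi, compact supp & supp `<=` B1].

End euclidean_space.

Section sobolev.
Variable R : realType.
Local Notation mu := (lebesgue3 R).
Local Notation B1 := (@B1 R).

Definition inL2 (f : R3 R -> R) : Prop := f \_ B1 \in Lfun mu 2%:E.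

Definition L2norm (f : R3 R -> R) : \bar R := ('N[mu]_2[EFin \o (f \_ B1)])%E.

Definition weak_partial (i : 'I_3) (f g : R3 R -> R) : Prop :=
  forall phi, test_function phi ->
    \int[mu]_(x in B1) (f x * partial i phi x) =
    - \int[mu]_(x in B1) (g x * phi x).

(* f is in H^1(B_1), with weak gradient g *)
Definition inH1 (f : R3 R -> R) (g : 'I_3 -> R3 R -> R) : Prop :=
  inL2 f /\ forall i, inL2 (g i) /\ weak_partial i f (g i).

(* f is in H^1_0(B_1), the closure of C_c^oo(B_1) in H^1(B_1),
   with weak gradient g *)
Definition inH10 (f : R3 R -> R) (g : 'I_3 -> R3 R -> R) : Prop :=
  inH1 f g /\
  exists phi : nat -> R3 R -> R,
    [/\ forall n, test_function (phi n),
        (fun n => L2norm (phi n \- f)) @ \oo --> 0%E &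
        forall i, (fun n => L2norm (partial i (phi n) \- g i)) @ \oo --> 0%E].

Definition radial (u : R3 R -> R) : Prop :=
  forall x y, B1 x -> B1 y -> enorm x = enorm y -> u x = u y.

(* weak form of - Delta w + w = w^3 in B_1, where g is the weak gradient of w *)
Definition weak_solution (w : R3 R -> R) (g : 'I_3 -> R3 R -> R) : Prop :=
  forall phi, test_function phi ->
    \int[mu]_(x in B1) ((\sum_(i < 3) g i x * partial i phi x) + w x * phi x) =
    \int[mu]_(x in B1) (w x ^+ 3 * phi x).

(* there are 0 < x_0 < ... < x_m < 1 such that u takes values of opposite
   signs on the spheres |x| = x_(j-1) and |x| = x_j, for j = 1, ..., m *)
Definition has_sign_changes (u : R3 R -> R) (m : nat) : Prop :=
  exists x : nat -> R,
    [/\ 0 < x 0%N, forall j, (j < m)%N -> x j < x j.+1, x m < 1 &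
        forall j, (j < m)%N ->
          forall p q, enorm p = x j -> enorm q = x j.+1 -> u p * u q < 0].

(* n(u) = m; the maximum need not exist for an arbitrary u, hence a relation *)
Definition nodal_number_is (u : R3 R -> R) (m : nat) : Prop :=
  has_sign_changes u m /\ forall m', has_sign_changes u m' -> (m' <= m)%N.

(* w stands for the continuous representative of its class in H^1_{0,r}(B_1),
   which is the one to which w(0) and n(w) refer. *)
Definition nodal_solution (k : nat) (w : R3 R -> R) : Prop :=
  [/\ {in B1, continuous w}, radial w,
      exists g, inH10 w g /\ weak_solution w g,
      0 < w 0 &
      nodal_number_is w (k - 1)].

(* Functions are total on R^3, so uniqueness is equality on B_1. *)
Definition unique_nodal_solution (k : nat) (w : R3 R -> R) : Prop :=
  nodal_solution k w /\
  forall v, nodal_solution k v -> forall x, B1 x -> v x = w x.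

End sobolev.

(* Main.v *)
From HB Require Import structures.
Require Import Defs.
From mathcomp Require Import all_boot all_order all_algebra.
From mathcomp Require Import all_classical all_reals all_analysis.
From mathcomp Require Import measurable_realfun.
From mathcomp Require Import ring lra.

Set Implicit Arguments.
Unset Strict Implicit.
Unset Printing Implicit Defensive.

Import Order.TTheory GRing.Theory Num.Theory.
Import numFieldNormedType.Exports.

Local Open Scope classical_set_scope.
Local Open Scope ring_scope.

(** Write a radial solution as w(x) = u(|x|)/|x|.  The equation becomes
    u'' = r f(u/r) with f(y) = y - y^3 and u(0) = 0, so the regular radial
    solutions form a one-parameter family u_g with u_g'(0) = g = w(0), odd in
    g; [traj] and [vel] are u_g and its derivative, and w solves the Dirichlet
    problem when u_g(1) = 0.  The difference F = u_a - u_g of two members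
    satisfies |F''| <= L |F|, so (F, F') never vanishes and has a polar angle
    starting from 0.  This angle can cross a multiple of pi only upwards,
    because it does so where F = 0.  Hence if [theta a g] is its value at
    r = 1, then F has m sign changes exactly when m pi < theta a g
    ([theta_sign_changes]).  The theorem therefore says that
    theta(g_k, g_i) = theta(g_k, - g_i) = k pi, where g_k = w_k(0)
    ([theta_levels]); the minus sign turns w_k - w_i into w_k + w_i because
    the family is odd.

    Uniqueness is used once.  Whenever g > 0 and theta(g, 0) = k pi, the
    profile of u_g is a nodal solution with k - 1 sign changes
    ([height_nodal_solution]), so it coincides with w_k and g = w_k(0).
    Thus g_k is the only positive g with theta(g, 0) = k pi.  Such a g exists
    because theta(g, 0) is continuous, at most 1 for small g, and unbounded
    for large g, where a rescaled profile follows the oscillating Lane-Emden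
    profile u'' = - u^3/r^2.  It follows that theta(g, 0) < k pi for
    0 < g < g_k and theta(g, 0) > k pi for g > g_k, which gives the sign of
    u_g(1) for every g and shows that u_g(1) = 0 only at g = 0 and g = +- g_j.

    Fix k and let d vary: theta(g_k, d) is continuous for d < g_k and equals
    k pi at d = 0.  It meets n pi only where u_d(1) = 0, and there
    u_{g_k}'(1) - u_d'(1) has the sign (-1)^n.  Let s_j = |u_{g_j}'(1)|.  If
    s_k > s_j for every j with g_j in the range of |d|, this difference always
    has the sign (-1)^k, so the angle can never reach (k - 1) pi or (k + 1) pi
    and equals k pi wherever u_d(1) = 0 ([level_persists]).  Taking d in
    [- g_i, g_i] gives the theorem once s_j is known to increase with j
    ([slope_mono]).

    For the monotonicity, suppose that s_1 < ... < s_i but s_(i+1) <= s_i.  The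
    persistence argument on [- g_(i+1), 0], now with g_i as first argument,
    gives theta(g_i, - g_(i+1)) = i pi; at d = - g_i, where s_j = s_i, the two
    derivatives have opposite signs and their difference does not vanish.  But
    theta(g_i, - g_(i+1)) = theta(g_(i+1), - g_i) by symmetry, and
    theta(g_k, d) > (k - 1) pi for - g_k < d <= 0 ([angle_lower_bound]); for
    k = i + 1 and d = - g_i this is a contradiction.

    The remaining work is the statement that a profile with u_g(1) = 0 is a
    nodal solution in the Sobolev sense.  The weak identities come from
    integrating by parts along coordinate lines ([ibp]): the profile is smooth
    away from the origin and almost every line misses the origin.  Membership
    in H^1_0 needs test functions converging to w together with their
    gradients ([height_approx]): as a function of s = |x|^2 the derivative of
    w is cut off smoothly near s = 0 and s = 1 and integrated from s = 1. *)

(** * Derivatives and primitives of real functions *)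

Section derivation_rules.
Variable R : realType.
Implicit Types (f g : R -> R) (x a b c : R).

Lemma derE f x a b : is_derive x 1 f a -> a = b -> is_derive x 1 f b.
Proof. by move=> ? <-. Qed.

Lemma derC c x : is_derive x 1 (fun _ => c) 0.
Proof. exact: is_derive_cst. Qed.

Lemma der_id x : is_derive x 1 (fun y : R => y) 1.
Proof. exact: is_derive_id. Qed.

Lemma derD f g x a b : is_derive x 1 f a -> is_derive x 1 g b ->
  is_derive x 1 (fun y => f y + g y) (a + b).
Proof. by move=> df dg; exact: is_deriveD. Qed.

Lemma derN f x a : is_derive x 1 f a -> is_derive x 1 (fun y => - f y) (- a).
Proof. by move=> df; exact: is_deriveN. Qed.

Lemma derM f g x a b : is_derive x 1 f a -> is_derive x 1 g b ->
  is_derive x 1 (fun y => f y * g y) (a * g x + f x * b).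
Proof.
move=> df dg; apply: (derE (is_deriveM df dg)).
by rewrite /GRing.scale/=; ring.
Qed.

Lemma derX f x a n : is_derive x 1 f a ->
  is_derive x 1 (fun y => f y ^+ n) (n%:R * f x ^+ n.-1 * a).
Proof.
move=> df; elim: n => [|n IH]; first by rewrite !mul0r; exact: derC.
apply: (@derE (fun y => f y ^+ n.+1) x (a * f x ^+ n + f x * (n%:R * f x ^+ n.-1 * a))).
  under eq_fun do rewrite exprS; exact: derM.
case: n {IH} => [|n]; first by rewrite /= expr0 !mul1r !mul0r mulr0 addr0 mulr1.
by rewrite -[n.+2%:R]natr1 /= exprS; ring.
Qed.

Lemma derV f x a : f x != 0 -> is_derive x 1 f a ->
  is_derive x 1 (fun y => (f y)^-1) (- a / f x ^+ 2).
Proof.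
move=> fx df; apply: (derE (is_deriveV fx df)).
by rewrite /GRing.scale /=; ring.
Qed.

Lemma der_comp f g x a b : is_derive (g x) 1 f a -> is_derive x 1 g b ->
  is_derive x 1 (fun y => f (g y)) (a * b).
Proof. by move=> df dg; exact: is_derive1_comp. Qed.

Lemma der_cont f x a : is_derive x 1 f a -> {for x, continuous f}.
Proof. by case=> df _; exact/differentiable_continuous/derivable1_diffP. Qed.

Lemma der_within f df a b :
  (forall x, a <= x <= b -> is_derive x 1 f (df x)) ->
  {within `[a, b], continuous f}.
Proof.
move=> H; apply: derivable_within_continuous => x; rewrite in_itv /= => xab.
by case: (H x xab).
Qed.

Lemma der_mvt f df a b : a <= b ->
  (forall x, a <= x <= b -> is_derive x 1 f (df x)) ->
  exists2 c, a <= c <= b & f b - f a = df c * (b - a).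
Proof.
move=> ab H; have [||c + ->] := @MVT_segment R f df a b ab.
- by move=> x; rewrite in_itv /= => /andP[ax xb]; apply: H; rewrite !ltW.
- exact: der_within H.
- by rewrite in_itv /= => cab; exists c.
Qed.

Lemma der_ge0 f df a b : a <= b ->
  (forall x, a <= x <= b -> is_derive x 1 f (df x)) ->
  (forall x, a <= x <= b -> 0 <= df x) -> f a <= f b.
Proof.
move=> ab H df0; have [c cab E] := der_mvt ab H.
by rewrite -subr_ge0 E mulr_ge0 ?df0 ?subr_ge0.
Qed.

Lemma der_le0 f df a b : a <= b ->
  (forall x, a <= x <= b -> is_derive x 1 f (df x)) ->
  (forall x, a <= x <= b -> df x <= 0) -> f b <= f a.
Proof.
move=> ab H df0; have [c cab E] := der_mvt ab H.
by rewrite -subr_le0 E mulr_le0_ge0 ?df0 ?subr_ge0.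
Qed.

Lemma der0_eq f a b : a <= b ->
  (forall x, a <= x <= b -> is_derive x 1 f 0) -> f a = f b.
Proof.
move=> ab H; apply/eqP; rewrite eq_le.
by rewrite (der_ge0 ab H)// (der_le0 ab H).
Qed.

Lemma near_dist x d : 0 < d -> \forall y \near x, `|x - y| <= d.
Proof. by move=> d0; have /cvgrPdist_le := @cvg_id _ (nbhs x); exact. Qed.

Lemma cont_delta f x (e : R) : {for x, continuous f} -> 0 < e ->
  exists2 d : R, 0 < d & forall y, `|y - x| < d -> `|f y - f x| < e.
Proof.
move=> cf e0; move/cvgrPdist_lt: cf => /(_ _ e0) /nbhs_ballP[d /= d0 H].
by exists d => // y yx; rewrite distrC; apply: H; rewrite /ball /= distrC.
Qed.

Lemma der_near f g x a : (\near x, f x = g x) -> is_derive x 1 f a ->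
  is_derive x 1 g a.
Proof. exact: near_eq_is_derive. Qed.

End derivation_rules.

Ltac opaque := repeat match goal with x := _ |- _ => clearbody x end.
Ltac olra := opaque; lra.
Ltac onra := opaque; nra.

Ltac derive1 := match goal with
  | H : is_derive ?x _ ?f _ |- is_derive ?x _ ?f _ => exact H
  | H : is_derive ?x _ ?f _ |- is_derive ?x _ (fun y => ?f y) _ => exact H
  | |- is_derive _ _ (fun _ => ?c) _ => apply: derC
  | |- is_derive _ _ (fun y => y) _ => apply: der_id
  | |- is_derive _ _ (fun y => @?f y + @?g y) _ => eapply (@derD _ f g)
  | |- is_derive _ _ (fun y => - (@?f y)) _ => eapply (@derN _ f)
  | |- is_derive _ _ (fun y => @?f y * @?g y) _ => eapply (@derM _ f g)
  | |- is_derive _ _ (fun y => (@?f y) ^+ ?n) _ => eapply (@derX _ f _ _ n)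
  | |- is_derive _ _ (fun y => expR (@?f y)) _ =>
      eapply (@der_comp _ expR f); [exact: is_derive_expR|]
  | |- is_derive _ _ (fun y => sin (@?f y)) _ =>
      eapply (@der_comp _ (@sin _) f); [exact: is_derive_sin|]
  | |- is_derive _ _ (fun y => cos (@?f y)) _ =>
      eapply (@der_comp _ (@cos _) f); [exact: is_derive_cos|]
  | H : forall x, is_derive x _ ?f _ |- is_derive _ _ ?f _ => eapply H
  | H : forall x, is_derive x _ ?f _ |- is_derive _ _ (fun y => ?f y) _ => eapply H
  end.
Ltac derive := eapply derE; [repeat (derive1; cbv beta) | cbv beta].

Section primitive.
Variable R : realType.
Local Notation mu := (@lebesgue_measure R).

Lemma cont_integrable (f : R -> R) a b : continuous f ->
  mu.-integrable `[a, b] (EFin \o f).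
Proof.
move=> cf; apply: continuous_compact_integrable; first exact: segment_compact.
exact: continuous_subspaceT.
Qed.

(** The integral from 0 is a primitive to the right of 0 only; near a given [x] it
    differs by a constant from the integral based at a point left of [x] and 0. *)
Lemma primitive_exists (f : R -> R) : continuous f ->
  exists F : R -> R, F 0 = 0 /\ forall x : R, is_derive x 1 F (f x).
Proof.
move=> cf.
pose I (a b : R) := \int[mu]_(t in `[a, b]) f t.
have chasles (a b c : R) : a <= b -> b <= c -> I a c = I a b + I b c.
  move=> ab bc; have ibc : mu.-integrable `]b, c] (EFin \o f).
    apply: integrableS (cont_integrable b c cf) => //.
    by apply: subset_itv; rewrite bnd_simp.
  have := @Rintegral_itvB R f (BLeft a) (BRight c) b (cont_integrable a c cf).
  rewrite !bnd_simp => /(_ ab bc).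
  rewrite (Rintegral_itv_obnd_cbnd ibc) => /eqP.
  by rewrite subr_eq addrC => /eqP.
pose F x := if 0 <= x then I 0 x else - I x 0.
exists F; split; first by rewrite /F lexx /I set_itv1 Rintegral_set1.
have dI (a x : R) : a < x -> is_derive x 1 (fun y => I a y) (f x).
  move=> ax; have xx : x < x + 1 by rewrite ltrDl.
  have [d <-] := @continuous_FTC1_closed R f a x (x + 1) xx
    (cont_integrable a (x + 1) cf) ax (cf x).
  by apply: DeriveDef => //; rewrite derive1E.
(* a base point to the left of both x and 0 *)
move=> x; pose a := Num.min x 0 - 1.
have ax : a < x by rewrite /a ltrBlDr gt_min ltrDl ltr01.
have a0 : a < 0 by rewrite /a ltrBlDr add0r gt_min ltr01 orbT.
apply: (@der_near _ (fun y => I a y - I a 0)); last first.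
  by derive; [exact: dI|rewrite addr0].
near=> y.
have ay : a <= y by apply: ltW; near: y; exact: lt_nbhsr.
rewrite /F; case: ifPn => [y0|]; last rewrite -ltNge => y0.
  by rewrite (chasles a 0 y) ?(ltW a0)// addrAC subrr add0r.
by rewrite (chasles a y 0) ?(ltW y0)// opprD addrA subrr add0r.
Unshelve. all: by end_near. Qed.

End primitive.

(** * A Picard theorem for second-order equations *)

(** Up to a factor 2 this is cosh (2 L r), which has (2 L)^2 times itself as second
    derivative: integrating twice a function bounded by L k times the weight gives
    a function bounded by k / (4 L) times the weight. *)
Definition weight (R : realType) (L r : R) : R :=
  expR (2 * L * r) + expR (- (2 * L * r)).

Section weight.
Variables (R : realType) (L : R).

Lemma weight_ge1 r : 1 <= weight L r.
Proof.
rewrite /weight; have := expR_gt0 (2 * L * r); have := expR_gt0 (- (2 * L * r)).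
have := expR_ge1Dx (2 * L * r); have := expR_ge1Dx (- (2 * L * r)). lra.
Qed.

Lemma weight_cont : continuous (weight L).
Proof.
move=> r; apply: (@der_cont _ _ _ (expR (2 * L * r) * (2 * L) + expR (- (2 * L * r)) * - (2 * L))).
by rewrite /weight; derive; ring.
Qed.

End weight.

Section picard.
Variable R : realType.

Lemma convex_tangent_ge0 (E dE ddE : R -> R) :
  (forall x : R, is_derive x 1 E (dE x)) ->
  (forall x : R, is_derive x 1 dE (ddE x)) ->
  (forall x, 0 <= ddE x) -> E 0 = 0 -> dE 0 = 0 -> forall x, 0 <= E x.
Proof.
move=> hE hdE E2 E0 E1 x.
have mono a b : a <= b -> dE a <= dE b.
  by move=> ab; apply: (@der_ge0 _ dE ddE a b ab) => y _.
case: (leP 0 x) => x0; rewrite -E0.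
  apply: (@der_ge0 _ E dE _ _ x0) => y.
  by move=> /andP[y0 _]; rewrite -E1; exact: mono.
apply: (@der_le0 _ E dE _ _ (ltW x0)) => y.
by move=> /andP[_ y0]; rewrite -E1; exact: mono.
Qed.

Lemma geometric_le0 (K x : R) : (forall n, x <= K / 2 ^+ n) -> x <= 0.
Proof.
move=> H; rewrite leNgt; apply/negP => x0.
have K0 : 0 < K by have := H 0%N; rewrite expr0 divr1; exact: lt_le_trans.
have /archi_boundP : 0 <= K / x by rewrite divr_ge0// ltW.
set n := Num.bound _ => Kn.
have := H n; rewrite leNgt => /negP; apply.
rewrite ltr_pdivrMr ?exprn_gt0// mulrC -ltr_pdivrMr//.
apply: lt_le_trans Kn _.
by rewrite -natrX ler_nat ltnW// ltn_expl.
Qed.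

Lemma dist_halves (a b c k : R) : `|a - c| <= k -> `|b - c| <= k ->
  `|a - b| <= k + k.
Proof. rewrite !ler_norml; lra. Qed.

Lemma dist_thirds (a b c d e : R) : `|a - b| <= e / 3 -> `|c - d| <= e / 3 ->
  `|b - d| <= e / 3 -> `|a - c| <= e.
Proof. rewrite !ler_norml; lra. Qed.

Variables (h : R -> R -> R) (L gamma : R).
Hypothesis h_cont : forall u : R -> R, continuous u ->
  continuous (fun r => h r (u r)).
Hypothesis h0 : forall r, h r 0 = 0.
Hypothesis L1 : 1 <= L.
Hypothesis h_lip : forall r a b, `|h r a - h r b| <= L * `|a - b|.

Local Notation c := (weight L).

(** A multiple of the weight plus or minus [D] is convex with a horizontal tangent
    at 0, hence nonnegative.  The factor 1/2 is what makes the Picard map a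
    contraction on the whole line at once. *)
Lemma weight_compare (D dD ddD : R -> R) k :
  (forall x : R, is_derive x 1 D (dD x)) ->
  (forall x : R, is_derive x 1 dD (ddD x)) ->
  D 0 = 0 -> dD 0 = 0 -> (forall x, `|ddD x| <= L * (k * c x)) ->
  forall x, `|D x| <= k / 2 * c x.
Proof.
have L1' : 1 <= L := L1.
move=> hD hdD D0 D1 b x.
have k0 : 0 <= k.
  have L0 : 0 < L by olra.
  have := le_trans (normr_ge0 _) (b 0); rewrite pmulr_rge0//.
  by rewrite pmulr_lge0//; exact: lt_le_trans (weight_ge1 L _).
have key (s : R) : `|s| = 1 -> 0 <= L * k / (2 * L) ^+ 2 * (c x - 2) + s * D x.
  move=> s1.
  apply: (@convex_tangent_ge0 (fun x => L * k / (2 * L) ^+ 2 * (c x - 2) + s * D x)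
   (fun x => L * k / (2 * L) ^+ 2 * ((2 * L) * (expR (2 * L * x) - expR (- (2 * L * x)))) + s * dD x)
   (fun x => L * (k * c x) + s * ddD x)).
  - by move=> y; rewrite /weight; derive; rewrite /=; ring.
  - by move=> y; rewrite /weight; derive; rewrite /=; field; olra.
  - move=> y; have := b y; have := ler_norm (- (s * ddD y)).
    by rewrite normrN normrM s1 mul1r; olra.
  - by rewrite /weight !mulr0 oppr0 expR0 D0; ring.
  - by rewrite !mulr0 oppr0 expR0 D1; ring.
have lk : L * k / (2 * L) ^+ 2 * (c x - 2) <= k / 2 * c x.
  have -> : L * k / (2 * L) ^+ 2 = k / (4 * L) by field; olra.
  apply: (@le_trans _ _ (k / (4 * L) * c x)).
    by apply: ler_wpM2l; [apply: divr_ge0 => //; lra|olra].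
  apply: ler_wpM2r; first exact: le_trans (weight_ge1 L x).
  by apply: ler_wpM2l => //; rewrite lef_pV2 ?posrE; olra.
have := key 1 (normr1 _); have := key (-1); rewrite normrN normr1 => /(_ erefl).
by rewrite ler_norml; olra.
Qed.

(** A Lipschitz right-hand side gives a global solution: the iterates from 0 are
    Cauchy in the norm weighted by [weight L], since the Picard map halves
    distances.  The nested intervals around the iterates replace completeness of a
    function space. *)
Lemma picard_lindelof : exists u v : R -> R,
  [/\ u 0 = 0, v 0 = gamma, forall r : R, is_derive r 1 u (v r) &
      forall r : R, is_derive r 1 v (h r (u r))].
Proof.
have L1' : 1 <= L := L1.
have step (u : R -> R) : exists w : R -> R, continuous u -> exists v : R -> R,
    [/\ w 0 = 0, v 0 = gamma, forall r : R, is_derive r 1 w (v r) &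
        forall r : R, is_derive r 1 v (h r (u r))].
  have [cu|ncu] := pselect (continuous u); last by exists u.
  have [v [v0 dv]] := primitive_exists (h_cont cu).
  have cv : continuous (fun r => v r + gamma).
    by move=> r; apply: der_cont; derive; exact: addr0.
  have [w [w0 dw]] := primitive_exists cv.
  exists w => _; exists (fun r => v r + gamma); split => //.
    by rewrite v0 add0r.
  by move=> r; derive; exact: addr0.
have [T HT] := choice step.
pose U n := iter n T (fun=> 0).
have cU n : continuous (U n).
  elim: n => [|n IH]; first by move=> ?; exact: cvg_cst.
  by have [v [_ _ dU _]] := HT _ IH; move=> r; exact: der_cont (dU r).
(* K bounds the first Picard step, from 0 to gamma r *)
pose K r := `|gamma| * c r.
have K0 r : 0 <= K r by rewrite mulr_ge0// (le_trans _ (weight_ge1 L r)).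
have contr u1 u2 k : continuous u1 -> continuous u2 ->
    (forall r, `|u1 r - u2 r| <= k * c r) ->
    forall r, `|T u1 r - T u2 r| <= k / 2 * c r.
  move=> c1 c2 H r.
  have [v1 [w10 v10 dw1 dv1]] := HT _ c1; have [v2 [w20 v20 dw2 dv2]] := HT _ c2.
  apply: (@weight_compare (fun r => T u1 r - T u2 r) (fun r => v1 r - v2 r)
    (fun r => h r (u1 r) - h r (u2 r))).
  - by rewrite w10 w20 subrr.
  - by rewrite v10 v20 subrr.
  - by move=> x; apply: le_trans (h_lip _ _ _) _; apply: ler_wpM2l; [olra|].
have D n r : `|U n.+1 r - U n r| <= K r / 2 ^+ n.
  rewrite /K mulrAC; elim: n r => [|n IH] r; last first.
    rewrite exprSr invfM mulrA.
    exact: (contr _ _ _ (cU n.+1) (cU n) IH).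
  have [v [w0 v0 dw dv]] := HT _ (cU 0%N).
  have dv0 (x : R) : is_derive x 1 v 0 by have := dv x; rewrite h0.
  have vE x : v x = gamma by rewrite -v0; exact: is_derive_0_is_cst.
  have dz (x : R) : is_derive x 1 (fun y => U 1%N y - gamma * y) 0.
    by have := dw x => dwx; derive; rewrite vE; ring.
  have /= := is_derive_0_is_cst r 0 dz; rewrite w0 mulr0 subr0 => /eqP.
  rewrite subr_eq0 => /eqP ->; rewrite subr0 expr0 divr1 normrM.
  apply: ler_wpM2l => //.
  have := expR_ge1Dx (2 * L * r); have := expR_ge1Dx (- (2 * L * r)).
  have := expR_gt0 (2 * L * r); have := expR_gt0 (- (2 * L * r)).
  rewrite /weight ler_norml; case: (lerP 0 r) => r0 ? ? ? ?; onra.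
(* the limit, squeezed between U n - 2 K / 2^n and U n + 2 K / 2^n *)
have [u Hu] : exists u : R -> R, forall n r, `|u r - U n r| <= 2 * K r / 2 ^+ n.
  suff H r : exists y, forall n, `|y - U n r| <= 2 * K r / 2 ^+ n.
    by have [u Hu] := choice H; exists u.
  pose a n := U n r - 2 * K r / 2 ^+ n; pose b n := U n r + 2 * K r / 2 ^+ n.
  have half n : 2 * K r / 2 ^+ n.+1 = K r / 2 ^+ n.
    by rewrite exprS; field; rewrite expf_eq0 pnatr_eq0 andbF.
  have dbl n : 2 * K r / 2 ^+ n = K r / 2 ^+ n + K r / 2 ^+ n by ring.
  have aS n : a n <= a n.+1.
    by rewrite /a half dbl; have := D n r; rewrite ler_norml; olra.
  have bS n : b n.+1 <= b n.
    by rewrite /b half dbl; have := D n r; rewrite ler_norml; olra.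
  have am : {homo a : m n / (m <= n)%N >-> m <= n} by exact: homo_leq le_trans aS.
  have bm m n : (m <= n)%N -> b n <= b m.
    move=> /subnK <-; elim: (n - m)%N => [|k IH]; first exact: lexx.
    exact: le_trans (bS _) IH.
  have ab n : a n <= b n.
    have : 0 <= 2 * K r / 2 ^+ n by apply: divr_ge0; [apply: mulr_ge0|apply: exprn_ge0].
    by rewrite /a /b; olra.
  have abm m n : a m <= b n.
    case: (leqP m n) => mn; first exact: le_trans (am _ _ mn) (ab n).
    exact: le_trans (ab m) (bm _ _ (ltnW mn)).
  exists (sup (range a)) => n.
  have sa : has_sup (range a).
    by split; [exists (a 0%N), 0%N|exists (b 0%N) => _ [m _ <-]].
  have h1 : a n <= sup (range a) by apply: ub_le_sup; [case: sa|exists n].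
  have h2 : sup (range a) <= b n.
    by apply: ge_sup; [case: sa|move=> _ [m _ <-]].
  move: (sup _) h1 h2 => y; rewrite /a /b ler_norml => h1 h2; olra.
have cu : continuous u.
  move=> r; apply/cvgrPdist_le => e e0.
  pose M := 2 * (`|gamma| * (c r + 1)).
  have M0 : 0 <= M by rewrite !mulr_ge0// addr_ge0// (le_trans _ (weight_ge1 L r)).
  have [n Mn] : exists n, M / 2 ^+ n < e / 3.
    have [//|H] := pselect (exists n, M / 2 ^+ n < e / 3).
    suff : e / 3 <= 0 by olra.
    apply: (@geometric_le0 M) => n; rewrite leNgt; apply/negP => ?.
    by apply: H; exists n.
  near=> y.
  have cy : c y <= c r + 1.
    have : `|c r - c y| <= 1.
      by near: y; move/cvgrPdist_le: (@weight_cont R L r); apply.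
    by rewrite ler_norml; olra.
  have Uy : `|U n r - U n y| <= e / 3.
    by near: y; move/cvgrPdist_le: (cU n r); apply; exact: divr_gt0.
  have b1 := Hu n r; have b2 := Hu n y.
  have bnd z : c z <= c r + 1 -> 2 * K z / 2 ^+ n <= e / 3.
    move=> cz; apply: ltW; apply: le_lt_trans Mn.
    apply: ler_wpM2r; first by rewrite invr_ge0 exprn_ge0.
    by rewrite /M; apply: ler_wpM2l => //; apply: ler_wpM2l.
  have b3 := bnd r (ltac:(olra)); have b4 := bnd y cy.
  exact: dist_thirds (le_trans b1 b3) (le_trans b2 b4) Uy.
have [v [w0 v0 dw dv]] := HT _ cu.
exists (T u), v.
(* the limit is a fixed point of the Picard map T *)
suff E : T u = u by split => // r; have := dv r; rewrite E.
apply/funext => r; apply/eqP; rewrite -subr_eq0 -normr_le0.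
apply: (@geometric_le0 (2 * K r)) => n.
have b1 : `|T u r - U n.+1 r| <= K r / 2 ^+ n.
  have -> : K r / 2 ^+ n = (2 * `|gamma| / 2 ^+ n) / 2 * c r by rewrite /K; field.
  apply: contr => // x; apply: le_trans (Hu n x) _.
  by rewrite /K !mulrA [X in _ <= X]mulrAC.
have b2 := Hu n.+1 r.
have half : 2 * K r / 2 ^+ n.+1 = K r / 2 ^+ n.
  by rewrite exprS; field; rewrite expf_eq0 pnatr_eq0 andbF.
rewrite half in b2.
have -> : 2 * K r / 2 ^+ n = K r / 2 ^+ n + K r / 2 ^+ n by ring.
exact: dist_halves b1 b2.
Unshelve. all: by end_near. Qed.

End picard.

(** * The nonlinearity and its truncation *)

Section profile.
Variable R : realType.
Implicit Types (e g r s y M : R) (u v : R -> R).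

Definition force e y : R := e * y - y ^+ 3.

(** The radial form of - Delta w + e w = w^3 for w = u / r.  The parameter [e] is 1
    for the equation itself; [e] = 0 is the Lane-Emden limit that governs large
    solutions, and rescaling produces the values in between. *)
Definition profile e g (u v : R -> R) : Prop :=
  [/\ u 0 = 0, v 0 = g, forall r, 0 <= r -> is_derive r 1 u (v r) &
      forall r, 0 <= r -> is_derive r 1 v (r * force e (u r / r))].

Definition clamp M y : R := Num.max (- M) (Num.min M y).

Lemma clamp_bound M y : 0 <= M -> `|clamp M y| <= M.
Proof.
move=> M0; rewrite ler_norml /clamp le_max lexx /= ge_max ge_min lexx /=.
by rewrite andbT; lra.
Qed.

Lemma clamp_id M y : `|y| <= M -> clamp M y = y.
Proof.
by rewrite ler_norml => /andP[a b]; rewrite /clamp (min_idPr b) (max_idPr a).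
Qed.

Lemma clamp_ge M y : 0 <= M -> M <= y -> clamp M y = M.
Proof.
by move=> M0 My; rewrite /clamp (min_idPl My); apply/max_idPr; lra.
Qed.

Lemma clamp_le M y : 0 <= M -> y <= - M -> clamp M y = - M.
Proof.
move=> M0 My; rewrite /clamp; apply/max_idPl.
by rewrite ge_min My orbT.
Qed.

Lemma clamp_lip M a b : 0 <= M -> `|clamp M a - clamp M b| <= `|a - b|.
Proof.
move=> M0; wlog ab : a b / a <= b.
  by move=> H; case: (leP a b) => [/H//|/ltW/H]; rewrite distrC (distrC b).
rewrite !(distrC _ (clamp M b)) (distrC a) (ger0_norm (x := b - a)) ?subr_ge0//.
rewrite ger0_norm; first rewrite /clamp; last first.
  rewrite subr_ge0 /clamp ge_max le_max lexx /= le_max le_min !ge_min lexx /=.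
  by rewrite ab !orbT.
rewrite /clamp /Num.max /Num.min; do 4 case: ifP => /=; lra.
Qed.

Lemma force_lip e M a b : 0 <= e <= 1 -> `|a| <= M -> `|b| <= M ->
  `|force e a - force e b| <= (1 + 3 * M ^+ 2) * `|a - b|.
Proof.
move=> e01 aM bM; have -> : force e a - force e b =
  (e - (a ^+ 2 + a * b + b ^+ 2)) * (a - b) by rewrite /force; ring.
rewrite normrM ler_wpM2r//.
have h (c : R) : `|c| <= M -> c ^+ 2 <= M ^+ 2.
  by move=> cM; rewrite -(real_normK (num_real c)) lerXn2r ?nnegrE// (le_trans _ cM).
have := h a aM; have := h b bM.
have := sqr_ge0 (a - b); have := sqr_ge0 (a + b); rewrite ler_norml; nra.
Qed.

Lemma clamped_lip e M a b : 0 <= e <= 1 -> 0 <= M ->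
  `|force e (clamp M a) - force e (clamp M b)| <= (1 + 3 * M ^+ 2) * `|a - b|.
Proof.
move=> e01 M0; apply: le_trans (force_lip e01 (clamp_bound _ M0) (clamp_bound _ M0)) _.
by rewrite ler_wpM2l ?clamp_lip// addr_ge0// mulr_ge0 ?sqr_ge0.
Qed.

Lemma lip_cont (k : R -> R) L : 0 < L -> (forall a b, `|k a - k b| <= L * `|a - b|) ->
  continuous k.
Proof.
move=> L0 H x; apply/cvgrPdist_le => d d0; near=> y.
apply: le_trans (H _ _) _; rewrite mulrC -ler_pdivlMr//.
by near: y; apply: near_dist; rewrite divr_gt0.
Unshelve. all: by end_near. Qed.

Lemma force_bound e M y : 0 <= e <= 1 -> 0 <= M -> `|y| <= M ->
  `|force e y| <= M + M ^+ 3.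
Proof.
move=> /andP[e0 e1] M0 yM; rewrite /force; apply: le_trans (ler_normB _ _) _.
apply: lerD; first by rewrite normrM (ger0_norm e0); nra.
by rewrite normrX lerXn2r ?nnegrE.
Qed.

(** At 0 the quotient [u r / r] need not have a limit, but the truncated force is
    bounded and the factor [r] makes the product vanish there. *)
Lemma clamped_flow_cont e M u : 0 <= e <= 1 -> 0 <= M -> continuous u ->
  continuous (fun r => r * force e (clamp M (u r / r))).
Proof.
move=> e01 M0 cu r.
have L0 : 0 < 1 + 3 * M ^+ 2 by have := sqr_ge0 M; lra.
have [->|r0] := eqVneq r 0.
  rewrite /continuous_at mul0r.
  have B0 : 0 < 1 + (M + M ^+ 3) by have := exprn_ge0 3 M0; lra.
  apply/cvgrPdist_le => d d0; near=> y.
  rewrite sub0r normrN normrM.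
  apply: (@le_trans _ _ (`|y| * (1 + (M + M ^+ 3)))).
    apply: ler_wpM2l => //; apply: le_trans (force_bound e01 M0 (clamp_bound _ M0)) _.
    by rewrite lerDr.
  rewrite -ler_pdivlMr// -[y]subr0 distrC.
  by near: y; apply: near_dist; rewrite divr_gt0.
apply: cvgM; first exact: cvg_id.
apply: (@cvg_comp _ _ _ (fun z => u z / z) (fun z => force e (clamp M z)) _
  (nbhs (u r / r))); last first.
  exact: (lip_cont L0 (fun a b => clamped_lip a b e01 M0)).
by apply: cvgM; [exact: cu|apply: cvgV => //; exact: cvg_id].
Unshelve. all: by end_near. Qed.

End profile.

(** * Global existence of radial profiles *)

Section existence.
Variable R : realType.
Implicit Types (e g r s y M : R) (u v : R -> R).

(** The potential of the truncated force confines: it is larger at the truncation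
    heights +- M than at [g] and monotone beyond them.  The height [`|g| + 2] makes
    y^4/4 - e y^2/2 larger there than at [g] for every [e] in [0, 1]. *)
Lemma clamped_potential e g : 0 <= e <= 1 -> let M : R := `|g| + 2 in
  exists P : R -> R, (forall y : R, is_derive y 1 P (- force e (clamp M y))) /\
    forall y, P y <= P g -> `|y| <= M.
Proof.
move=> e01 M; have e01' := e01; move: e01' => /andP[e0 e1].
have g0 := normr_ge0 g.
have M2 : 2 <= M by rewrite /M lerDr.
have M0 : 0 <= M by apply: le_trans M2.
have gM : `|g| <= M by rewrite /M lerDl.
have cf : continuous (fun y => - force e (clamp M y)).
  move=> y; apply: cvgN.
  apply: (@lip_cont R (fun y => force e (clamp M y)) (1 + 3 * M ^+ 2) _ _ y).
    by have := sqr_ge0 M; move: (M ^+ 2) => z z0; lra.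
  by move=> a b; exact: clamped_lip.
have [P [P0 dP]] := primitive_exists cf.
exists P; split => //.
have PE y : `|y| <= M -> P y = y ^+ 4 / 4 - e * y ^+ 2 / 2.
  move=> yM; pose Q z := P z - (z ^+ 4 / 4 - e * z ^+ 2 / 2).
  have dQ (z : R) : `|z| <= M -> is_derive z 1 Q 0.
    by move=> zM; rewrite /Q; derive; rewrite clamp_id//= /force; field.
  suff h : Q y = Q 0.
    transitivity (Q y + (y ^+ 4 / 4 - e * y ^+ 2 / 2)); first by rewrite /Q; ring.
    by rewrite h /Q P0; ring.
  case: (lerP 0 y) => y0.
    apply/esym; apply: (@der0_eq _ Q 0 y y0) => z /andP[z0 zy]; apply: dQ.
    by rewrite ger0_norm// (le_trans zy)// -(ger0_norm y0).
  apply: (@der0_eq _ Q y 0 (ltW y0)) => z /andP[zy z0]; apply: dQ.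
  by rewrite ler0_norm//; apply: le_trans yM; rewrite (ltr0_norm y0) lerN2.
have PM : P g < P M.
  rewrite !PE ?(ger0_norm M0)// -subr_gt0.
  have -> : M ^+ 4 / 4 - e * M ^+ 2 / 2 - (g ^+ 4 / 4 - e * g ^+ 2 / 2) =
     (M ^+ 2 - g ^+ 2) / 4 * (M ^+ 2 + g ^+ 2 - 2 * e) by field.
  have h : g ^+ 2 = `|g| ^+ 2 by rewrite real_normK ?num_real.
  have m4 : `|g| ^+ 2 + 4 <= M ^+ 2 by rewrite /M; move: (`|g|) g0 => z z0; nra.
  have g2 := sqr_ge0 (`|g|).
  rewrite h; move: (`|g| ^+ 2) (M ^+ 2) m4 g2 => z w ? ?.
  apply: mulr_gt0; lra.
have PNM : P (- M) = P M by rewrite !PE ?normrN ?(ger0_norm M0)//; ring.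
have fM : 0 <= - force e M.
  rewrite /force; move: M M2 {M0 gM cf dP PE PM PNM} => m m2; nra.
move=> y; apply: contraTT; rewrite -!ltNge => My; apply: lt_le_trans PM _.
case: (lerP 0 y) => y0.
  rewrite ger0_norm// in My.
  apply: (@der_ge0 _ P (fun z => - force e (clamp M z)) _ _ (ltW My)) => z /andP[z0 _].
  by rewrite clamp_ge.
rewrite ltr0_norm// in My; rewrite -PNM.
have My' : y <= - M by rewrite lerNr ltW.
apply: (@der_le0 _ P (fun z => - force e (clamp M z)) _ _ My') => z /andP[_ z0].
rewrite clamp_le//.
have -> : - force e (- M) = - (- force e M) by rewrite /force; ring.
by rewrite oppr_le0.
Qed.

(** Truncating the nonlinearity gives a global solution by Picard; the energy
    y'^2 / 2 + P(y) of y = u / r decreases because of the friction term 2 y'/r, so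
    the truncation is never reached and the solution solves the true equation. *)
Lemma profile_exists e g : 0 <= e <= 1 -> exists u v, profile e g u v /\
  forall r, 0 <= r -> `|u r| <= (`|g| + 2) * r.
Proof.
move=> e01; have [P [dP Pbound]] := clamped_potential g e01.
move: dP Pbound; set M := `|g| + 2 => dP Pbound.
have M2 : 2 <= M by rewrite /M lerDr.
have M0 : 0 <= M by apply: le_trans M2.
pose F y := force e (clamp M y).
pose B := M + M ^+ 3.
have B0 : 0 <= B by rewrite addr_ge0// exprn_ge0.
have FB y : `|F y| <= B by apply: force_bound => //; exact: clamp_bound.
pose L := 1 + 3 * M ^+ 2.
have L1 : 1 <= L by rewrite /L lerDl mulr_ge0// sqr_ge0.
have Flip a b : `|F a - F b| <= L * `|a - b| by exact: clamped_lip.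
have F0 : F 0 = 0.
  by rewrite /F clamp_id ?normr0// /force mulr0 expr0n subrr.
have [|r|r a b|u [v [u0 v0 du dv]]] := @picard_lindelof R (fun r z => r * F (z / r)) L g _ _ L1 _.
- by move=> u cu; exact: clamped_flow_cont.
- by rewrite mul0r F0 mulr0.
- have [->|r0] := eqVneq r 0.
    by rewrite !mul0r subrr normr0 mulr_ge0// (le_trans _ L1).
  rewrite -mulrBr normrM.
  apply: (@le_trans _ _ (`|r| * (L * `|a / r - b / r|))).
    by rewrite ler_wpM2l.
  rewrite -mulrBl normrM normfV.
  have -> : `|r| * (L * (`|a - b| / `|r|)) = L * `|a - b| by field; rewrite normr_eq0.
  exact: lexx.
have dv' (r : R) : is_derive r 1 v (r * F (u r / r)) by exact: dv.
pose p r := r * v r - u r.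
have dp (r : R) : is_derive r 1 p (r ^+ 2 * F (u r / r)).
  by have := du r; have := dv' r => dv1 du1; rewrite /p; derive; ring.
have p0 : p 0 = 0 by rewrite /p mul0r u0 subrr.
have pB s : 0 <= s -> `|p s| <= s * (s ^+ 2 * B).
  move=> s0; have [c /andP[c0 cs]] := @der_mvt _ p _ 0 s s0 (fun x _ => dp x).
  rewrite p0 !subr0 => ->; rewrite normrM (ger0_norm s0) mulrC normrM.
  rewrite (ger0_norm (sqr_ge0 c)); apply: ler_wpM2l => //.
  apply: ler_pM; [exact: sqr_ge0|exact: normr_ge0| |exact: FB].
  by rewrite lerXn2r ?nnegrE// (le_trans c0).
(* the energy of y = u / s, since y' = p / s^2 *)
pose E s := (p s / s ^+ 2) ^+ 2 / 2 + P (u s / s).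
have dE (s : R) : 0 < s -> is_derive s 1 E (- 2 * (p s / s ^+ 2) ^+ 2 / s).
  move=> s0; have s1 : s != 0 by rewrite gt_eqF.
  have s2 : s ^+ 2 != 0 by rewrite expf_neq0.
  have dus := du s; have dps := dp s.
  have dinv : is_derive s 1 (fun x : R => x^-1) (- 1 / s ^+ 2).
    exact: (derV s1 (der_id _)).
  have dinv2 : is_derive s 1 (fun x : R => (x ^+ 2)^-1) (- (2 * s) / (s ^+ 2) ^+ 2).
    have d2 : is_derive s 1 (fun x : R => x ^+ 2) (2 * s) by derive; rewrite /= expr1 mulr1.
    exact: (@derV _ (fun x : R => x ^+ 2) s (2 * s) s2 d2).
  have dy : is_derive s 1 (fun x => u x / x) (p s / s ^+ 2).
    by derive; rewrite /p; field.
  have dPy : is_derive s 1 (fun x => P (u x / x)) (- F (u s / s) * (p s / s ^+ 2)).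
    by apply: (der_comp (f := P)) => //; exact: dP.
  rewrite /E; derive; rewrite /=; field.
  by [].
have Edec s r : 0 < s -> s <= r -> E r <= E s.
  move=> s0 sr; apply: (@der_le0 _ E (fun s => - 2 * (p s / s ^+ 2) ^+ 2 / s) _ _ sr).
    by move=> x /andP[sx _]; apply: dE; exact: lt_le_trans s0 sx.
  move=> x /andP[sx _]; rewrite mulNr mulNr oppr_le0.
  apply: divr_ge0; first by rewrite mulr_ge0// sqr_ge0.
  by apply: ltW; exact: lt_le_trans s0 sx.
(* let the initial time of the energy inequality tend to 0: there y is close to g
   and y' is at most s B *)
have PPg r : 0 < r -> P (u r / r) <= P g.
  move=> r0; apply/ler_addgt0Pr => d d0.
  have cP : {for g, continuous P} := der_cont (dP g).
  have cv : {for 0, continuous v} := der_cont (dv 0).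
  have [d1 d10 Hd1] : exists2 d1 : R, 0 < d1 & forall y, `|y - g| < d1 -> P y <= P g + d / 2.
    have d2 : 0 < d / 2 by rewrite divr_gt0.
    have [d1 d10 H] := cont_delta cP d2; exists d1 => // y /H.
    rewrite ltr_norml; lra.
  have [d3 d30 Hd3] : exists2 d3 : R, 0 < d3 & forall c, `|c| < d3 -> `|v c - g| < d1.
    have [d3 d30 H] := cont_delta cv d10; exists d3 => // c c3.
    by rewrite -v0; apply: H; rewrite subr0.
  have K0 : 0 < 1 + B ^+ 2 by have := sqr_ge0 B; lra.
  near (0 : R)^'+ => s.
  have s0 : 0 < s by near: s; exact: nbhs_right_gt.
  have sr : s <= r by near: s; exact: nbhs_right_ltW.
  have s3 : s < d3 by near: s; exact: nbhs_right_lt.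
  have sd : s < d / (1 + B ^+ 2) by near: s; apply: nbhs_right_lt; rewrite divr_gt0.
  have s1 : s < 1 by near: s; exact: nbhs_right_lt.
  apply: (@le_trans _ _ (E r)); first by rewrite /E lerDr divr_ge0// sqr_ge0.
  apply: le_trans (Edec s r s0 sr) _.
  have [c /andP[c0 cs]] := @der_mvt _ u v 0 s (ltW s0) (fun x _ => du x).
  rewrite u0 !subr0 /E => ->; rewrite mulfK ?gt_eqF//.
  have Pc : P (v c) <= P g + d / 2.
    by apply: Hd1; apply: Hd3; rewrite ger0_norm// (le_lt_trans cs).
  have q : (p s / s ^+ 2) ^+ 2 <= d.
    have h : `|p s / s ^+ 2| <= s * B.
      rewrite normrM normfV (ger0_norm (sqr_ge0 s)) ler_pdivrMr ?exprn_gt0//.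
      by rewrite -mulrA [B * _]mulrC; apply: pB; exact: ltW.
    rewrite -(real_normK (num_real _)).
    apply: (@le_trans _ _ ((s * B) ^+ 2)).
      by rewrite lerXn2r ?nnegrE// mulr_ge0// ltW.
    rewrite ltr_pdivlMr// in sd; apply: ltW; apply: le_lt_trans sd.
    rewrite exprMn; apply: ler_pM; rewrite ?sqr_ge0//; last lra.
    by rewrite expr2 ger_pMr// ltW.
  lra.
have uM r : 0 <= r -> `|u r / r| <= M.
  rewrite le_eqVlt => /predU1P[<-|r0]; last exact/Pbound/PPg.
  by rewrite invr0 mulr0 normr0.
exists u, v; split; last first.
  move=> r; rewrite le_eqVlt => /predU1P[<-|r0]; first by rewrite u0 normr0 mulr0.
  by have := uM r (ltW r0); rewrite normrM normfV (gtr0_norm r0) ler_pdivrMr.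
split => // r r0.
by have := dv r; rewrite /F clamp_id//; exact: uM.
Unshelve. all: by end_near. Qed.

End existence.

(** * Gronwall estimates and the flow *)

Section gronwall.
Variable R : realType.
Implicit Types (e g r s y M L a b : R) (u v : R -> R).

Lemma growth_le (f df : R -> R) K a b : a <= b ->
  (forall r, a <= r <= b -> is_derive r 1 f (df r)) ->
  (forall r, a <= r <= b -> df r <= K * f r) ->
  f b <= f a * expR (K * (b - a)).
Proof.
move=> ab hf hK.
have H : f b * expR (- K * b) <= f a * expR (- K * a).
  apply: (@der_le0 _ (fun r => f r * expR (- K * r))
    (fun r => (df r - K * f r) * expR (- K * r)) _ _ ab) => r rab.
    by have dfr := hf r rab; derive; ring.
  by rewrite mulr_le0_ge0 ?expR_ge0// subr_le0 hK.
have -> : expR (K * (b - a)) = expR (- K * a) / expR (- K * b).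
  by rewrite -expRN -expRD; congr expR; ring.
by rewrite mulrA ler_pdivlMr ?expR_gt0.
Qed.

(** The constant [h] measures a defect of the equation, so the same estimate compares
    solutions of two different equations. *)
Lemma gronwall (D dD w : R -> R) L h a b : a <= b -> 0 <= L ->
  (forall r, a <= r <= b -> is_derive r 1 D (dD r)) ->
  (forall r, a <= r <= b -> is_derive r 1 dD (w r)) ->
  (forall r, a <= r <= b -> `|w r| <= L * `|D r| + h) ->
  D b ^+ 2 + dD b ^+ 2 + h ^+ 2 <=
  (D a ^+ 2 + dD a ^+ 2 + h ^+ 2) * expR ((L + 2) * (b - a)).
Proof.
move=> ab L0 hD hdD hw.
apply: (@growth_le (fun r => D r ^+ 2 + dD r ^+ 2 + h ^+ 2)
  (fun r => 2 * D r * dD r + 2 * dD r * w r) _ _ _ ab) => r rab.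
  by have := hD r rab; have := hdD r rab => d1 d2; derive; rewrite /=; ring.
have := hw r rab; move: (D r) (dD r) (w r) => x y z {hw hD hdD}.
have : `|x| ^+ 2 = x ^+ 2 by rewrite real_normK ?num_real.
move: (normr_ge0 x) (`|x|) => _ n nx; rewrite -nx ler_norml => /andP[z1 z2].
have nonneg (s : R) : 0 <= s ^+ 2 by exact: sqr_ge0.
have := nonneg (x - y); have := nonneg (y - h); have := nonneg (y + h).
have := nonneg (n - y); have := nonneg (n + y) => q1 q2 q3 q4 q5.
have l1 := mulr_ge0 L0 q1; have l2 := mulr_ge0 L0 q2.
(* bound the product according to the sign of y, using z <= L n + h or z >= - (L n + h) *)
have c1 : 2 * y * z <= L * (n ^+ 2 + y ^+ 2) + y ^+ 2 + h ^+ 2.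
  case: (lerP 0 y) => y0.
    have : 0 <= y * (L * n + h - z) by rewrite mulr_ge0// subr_ge0.
    by move: l1 l2; nra.
  have : 0 <= (- y) * (z + (L * n + h)) by apply: mulr_ge0; lra.
  by move: l1 l2; nra.
nra.
Qed.

(** Reversing time turns vanishing at the right end into vanishing at the left end. *)
Lemma gronwall_back (D dD w : R -> R) L a b : a <= b -> 0 <= L ->
  (forall r, a <= r <= b -> is_derive r 1 D (dD r)) ->
  (forall r, a <= r <= b -> is_derive r 1 dD (w r)) ->
  (forall r, a <= r <= b -> `|w r| <= L * `|D r|) ->
  D b = 0 -> dD b = 0 -> D a = 0 /\ dD a = 0.
Proof.
move=> ab L0 hD hdD hw Db dDb.
have ba : - b <= - a by rewrite lerN2.
have rng r : - b <= r <= - a -> a <= - r <= b by lra.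
have dN r : is_derive r 1 (fun x : R => - x) (- 1) by exact: derN (der_id r).
have := @gronwall (fun r => D (- r)) (fun r => - dD (- r)) (fun r => w (- r)) L 0
  (- b) (- a) ba L0 _ _ _.
rewrite !opprK Db dDb oppr0 expr0n/= !addr0 mul0r sqrrN => H.
have : D a ^+ 2 + dD a ^+ 2 <= 0.
  apply: H => r /rng rr; last by rewrite addr0; exact: hw.
  - by apply: derE; [exact: (der_comp (hD _ rr) (dN r))|ring].
  - apply: derE; first apply: derN; first exact: (der_comp (hdD _ rr) (dN r)).
    by ring.
move=> H'; have h1 := sqr_ge0 (D a); have h2 := sqr_ge0 (dD a).
split; apply/eqP; rewrite -sqrf_eq0; apply/eqP/le_anti; lra.
Qed.

End gronwall.

Section flow.
Variable R : realType.
Implicit Types (e g r s y M L a b : R) (u v : R -> R).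

(** The linear bound is part of the choice: it pins down one solution, because two
    solutions with such a bound have a Lipschitz difference of forces. *)
Definition flow e g : (R -> R) * (R -> R) :=
  xget (cst 0, cst 0) [set p | profile e g p.1 p.2 /\
    forall r, 0 <= r -> `|p.1 r| <= (`|g| + 2) * r].

Definition traj e g := (flow e g).1.
Definition vel e g := (flow e g).2.

Lemma flowP e g : 0 <= e <= 1 -> profile e g (traj e g) (vel e g) /\
  forall r, 0 <= r -> `|traj e g r| <= (`|g| + 2) * r.
Proof.
move=> e01; have [u [v H]] := profile_exists g e01.
have := @xgetPex _ (cst 0, cst 0) [set p | profile e g p.1 p.2 /\
    forall r, 0 <= r -> `|p.1 r| <= (`|g| + 2) * r].
by apply; exists (u, v).
Qed.

(** Since r (u/r) = u, the factor [r] cancels the singular quotient and the force is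
    Lipschitz in [u] itself, uniformly down to r = 0. *)
Lemma profile_gap e1 e2 u1 u2 M T r : 0 <= e1 <= 1 -> 0 <= M -> 0 <= r <= T ->
  `|u1 r| <= M * r -> `|u2 r| <= M * r ->
  `|r * force e1 (u1 r / r) - r * force e2 (u2 r / r)| <=
  (1 + 3 * M ^+ 2) * `|u1 r - u2 r| + `|e1 - e2| * M * T.
Proof.
move=> e01 M0 /andP[r0 rT] b1 b2.
have L0 : 0 <= 1 + 3 * M ^+ 2 by have := sqr_ge0 M; lra.
move: r0; rewrite le_eqVlt => /predU1P[r0|r0].
  rewrite -r0 in b1 b2 rT *; rewrite !mul0r subrr normr0.
  rewrite !mulr0 !normr_le0 in b1 b2; rewrite (eqP b1) (eqP b2) subrr normr0.
  by rewrite mulr0 add0r !mulr_ge0.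
have r1 : r != 0 by rewrite gt_eqF.
have yM (z : R) : `|z| <= M * r -> `|z / r| <= M.
  by move=> zM; rewrite normrM normfV (gtr0_norm r0) ler_pdivrMr.
have -> : r * force e1 (u1 r / r) - r * force e2 (u2 r / r) =
  r * (force e1 (u1 r / r) - force e1 (u2 r / r)) + (e1 - e2) * u2 r.
  by rewrite /force; field.
apply: le_trans (ler_normD _ _) _; apply: lerD.
  rewrite normrM (gtr0_norm r0).
  apply: le_trans (ler_wpM2l (ltW r0) (force_lip e01 (yM _ b1) (yM _ b2))) _.
  rewrite mulrCA; apply: ler_wpM2l => //.
  rewrite -mulrBl normrM normfV (gtr0_norm r0) mulrCA mulfV// mulr1.
  exact: lexx.
rewrite normrM -mulrA; apply: ler_wpM2l => //.
by apply: le_trans b2 _; apply: ler_wpM2l.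
Qed.

Lemma profile_close e1 e2 g1 g2 u1 v1 u2 v2 M T r :
  profile e1 g1 u1 v1 -> profile e2 g2 u2 v2 -> 0 <= e1 <= 1 -> 0 <= r <= T ->
  (forall s, 0 <= s -> `|u1 s| <= M * s) ->
  (forall s, 0 <= s -> `|u2 s| <= M * s) ->
  (u1 r - u2 r) ^+ 2 + (v1 r - v2 r) ^+ 2 <=
  ((g1 - g2) ^+ 2 + (`|e1 - e2| * M * T) ^+ 2) * expR ((3 + 3 * M ^+ 2) * T).
Proof.
move=> [u10 v10 du1 dv1] [u20 v20 du2 dv2] e01 /andP[r0 rT] b1 b2.
have L0 : 0 <= 1 + 3 * M ^+ 2 by have := sqr_ge0 M; lra.
have M0 : 0 <= M by have := le_trans (normr_ge0 _) (b1 1 ler01); rewrite mulr1.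
have := @gronwall _ (fun s => u1 s - u2 s) (fun s => v1 s - v2 s)
  (fun s => s * force e1 (u1 s / s) - s * force e2 (u2 s / s))
  (1 + 3 * M ^+ 2) (`|e1 - e2| * M * T) 0 r r0 L0.
rewrite u10 u20 v10 v20 subrr expr0n /= add0r subr0 => H.
apply: (@le_trans _ _ (((g1 - g2) ^+ 2 + (`|e1 - e2| * M * T) ^+ 2) *
   expR ((1 + 3 * M ^+ 2 + 2) * r))); last first.
  apply: ler_wpM2l; first by rewrite addr_ge0// sqr_ge0.
  rewrite ler_expR (_ : 3 + 3 * M ^+ 2 = 1 + 3 * M ^+ 2 + 2); last by ring.
  by apply: ler_wpM2l => //; rewrite addr_ge0.
apply: le_trans (H _ _ _); first by rewrite lerDl sqr_ge0.
- by move=> s /andP[s0 _]; have := du1 s s0; have := du2 s s0 => ? ?; derive.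
- by move=> s /andP[s0 _]; have := dv1 s s0; have := dv2 s s0 => ? ?; derive.
- move=> s /andP[s0 sr]; apply: profile_gap => //; last 2 first.
  + exact: b1.
  + exact: b2.
  by rewrite s0 (le_trans sr).
Qed.

Lemma profile_unique e g u v r : 0 <= e <= 1 -> profile e g u v ->
  (exists M, forall s, 0 <= s -> `|u s| <= M * s) -> 0 <= r ->
  traj e g r = u r /\ vel e g r = v r.
Proof.
move=> e01 P [M b] r0; have [P' b'] := flowP g e01.
pose N := Num.max M (`|g| + 2).
have b1 s : 0 <= s -> `|u s| <= N * s.
  by move=> s0; apply: le_trans (b s s0) _; rewrite ler_wpM2r// le_max lexx.
have b2 s : 0 <= s -> `|traj e g s| <= N * s.
  by move=> s0; apply: le_trans (b' s s0) _; rewrite ler_wpM2r// le_max lexx orbT.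
have rr : 0 <= r <= r by rewrite r0 lexx.
have := profile_close P' P e01 rr b2 b1.
rewrite !subrr normr0 !mul0r expr0n/= addr0 mul0r => H.
have h1 := sqr_ge0 (traj e g r - u r); have h2 := sqr_ge0 (vel e g r - v r).
by split; apply/eqP; rewrite -subr_eq0 -sqrf_eq0; apply/eqP/le_anti; lra.
Qed.

Lemma flowN e g r : 0 <= e <= 1 -> 0 <= r ->
  traj e (- g) r = - traj e g r /\ vel e (- g) r = - vel e g r.
Proof.
move=> e01 r0; have [[u0 v0 du dv] b] := flowP g e01.
apply: (@profile_unique e (- g) (fun s => - traj e g s) (fun s => - vel e g s)) => //.
  split; rewrite ?u0 ?v0 ?oppr0//.
    by move=> s s0; have dus := du s s0; derive.
  move=> s s0; have dvs := dv s s0; derive.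
  by rewrite /force; ring.
by exists (`|g| + 2) => s s0; rewrite normrN; exact: b.
Qed.

Lemma flow_zero e r : 0 <= e <= 1 -> 0 <= r -> traj e 0 r = 0 /\ vel e 0 r = 0.
Proof.
move=> e01 r0; apply: (@profile_unique e 0 (fun=> 0) (fun=> 0)) => //.
  split => // s _; first exact: derC.
  by rewrite mul0r /force mulr0 expr0n subrr mulr0; exact: derC.
by exists 0 => s _; rewrite mul0r normr0.
Qed.

Lemma flow_lipschitz e g1 g2 G T r : 0 <= e <= 1 -> 0 <= r <= T ->
  `|g1| <= G -> `|g2| <= G ->
  (traj e g1 r - traj e g2 r) ^+ 2 + (vel e g1 r - vel e g2 r) ^+ 2 <=
  (g1 - g2) ^+ 2 * expR ((3 + 3 * (G + 2) ^+ 2) * T).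
Proof.
move=> e01 rT G1 G2.
have [P1 b1] := flowP g1 e01; have [P2 b2] := flowP g2 e01.
have h g : `|g| <= G -> (forall r, 0 <= r -> `|traj e g r| <= (`|g| + 2) * r) ->
    forall r, 0 <= r -> `|traj e g r| <= (G + 2) * r.
  by move=> gG b s s0; apply: le_trans (b s s0) _; rewrite ler_wpM2r// lerD2r.
have := profile_close P1 P2 e01 rT (h _ G1 b1) (h _ G2 b2).
by rewrite subrr normr0 !mul0r expr0n/= addr0.
Qed.

Lemma sqr_sum_le (x y c : R) : 0 <= c -> x ^+ 2 + y ^+ 2 <= c ^+ 2 ->
  `|x| <= c /\ `|y| <= c.
Proof.
move=> c0 H; have hx := sqr_ge0 x; have hy := sqr_ge0 y.
by split; rewrite -(@ler_pXn2r _ 2)// ?nnegrE// real_normK ?num_real//; lra.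
Qed.

Lemma flow_cont e r : 0 <= e <= 1 -> 0 <= r ->
  continuous (fun g => traj e g r) /\ continuous (fun g => vel e g r).
Proof.
move=> e01 r0.
suff H g0 : exists2 C, 0 < C & forall g, `|g0 - g| <= 1 ->
    `|traj e g0 r - traj e g r| <= `|g0 - g| * C /\ `|vel e g0 r - vel e g r| <= `|g0 - g| * C.
  split=> g0; apply/cvgrPdist_le => d d0; have [C C0 HC] := H g0; near=> g.
  have gg : `|g0 - g| <= 1 by near: g; exact: near_dist.
  have [h1 h2] := HC g gg; apply: le_trans h1 _.
  by rewrite -ler_pdivlMr//; near: g; apply: near_dist; rewrite divr_gt0.
  have gg : `|g0 - g| <= 1 by near: g; exact: near_dist.
  have [h1 h2] := HC g gg; apply: le_trans h2 _.
  by rewrite -ler_pdivlMr//; near: g; apply: near_dist; rewrite divr_gt0.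
pose G := `|g0| + 1.
exists (expR ((3 + 3 * (G + 2) ^+ 2) * r)); first exact: expR_gt0.
move=> g gg.
have rr : 0 <= r <= r by rewrite r0 lexx.
have gG : `|g| <= G.
  have -> : g = g0 - (g0 - g) by ring.
  by apply: le_trans (ler_normB _ _) _; rewrite lerD2l.
have g0G : `|g0| <= G by rewrite lerDl.
have := flow_lipschitz e01 rr g0G gG.
set X := _ * r => H; apply: sqr_sum_le; first by rewrite mulr_ge0// expR_ge0.
rewrite exprMn real_normK ?num_real//; apply: le_trans H _.
apply: ler_wpM2l; first exact: sqr_ge0.
rewrite expr2 -expRD ler_expR -[X in X <= _]addr0 lerD2l /X.
by rewrite mulr_ge0// addr_ge0// mulr_ge0// sqr_ge0.
Unshelve. all: by end_near. Qed.

(** Distinct profiles never meet with the same slope, since they would then agree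
    down to 0. *)
Lemma flow_separated e g1 g2 r : 0 <= e <= 1 -> 0 <= r -> g1 != g2 ->
  0 < (traj e g1 r - traj e g2 r) ^+ 2 + (vel e g1 r - vel e g2 r) ^+ 2.
Proof.
move=> e01 r0 g12; rewrite lt0r addr_ge0 ?sqr_ge0// andbT; apply: contra g12.
rewrite paddr_eq0 ?sqr_ge0// !sqrf_eq0 => /andP[/eqP D0 /eqP dD0].
have [[u10 v10 du1 dv1] b1] := flowP g1 e01.
have [[u20 v20 du2 dv2] b2] := flowP g2 e01.
pose N := Num.max (`|g1| + 2) (`|g2| + 2).
have b1' s : 0 <= s -> `|traj e g1 s| <= N * s.
  by move=> s0; apply: le_trans (b1 s s0) _; rewrite ler_wpM2r// le_max lexx.
have b2' s : 0 <= s -> `|traj e g2 s| <= N * s.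
  by move=> s0; apply: le_trans (b2 s s0) _; rewrite ler_wpM2r// le_max lexx orbT.
have N0 : 0 <= N by rewrite /N le_max addr_ge0.
have L0 : 0 <= 1 + 3 * N ^+ 2 by rewrite addr_ge0// mulr_ge0// sqr_ge0.
have [] := @gronwall_back _ (fun s => traj e g1 s - traj e g2 s)
  (fun s => vel e g1 s - vel e g2 s)
  (fun s => s * force e (traj e g1 s / s) - s * force e (traj e g2 s / s))
  (1 + 3 * N ^+ 2) 0 r r0 L0 _ _ _ D0 dD0.
- by move=> s /andP[s0 _]; have := du1 s s0; have := du2 s s0 => ? ?; derive.
- by move=> s /andP[s0 _]; have := dv1 s s0; have := dv2 s s0 => ? ?; derive.
- move=> s /andP[s0 sr].
  have := @profile_gap e e (traj e g1) (traj e g2) N r s e01 N0 _ (b1' s s0) (b2' s s0).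
  by rewrite subrr normr0 !mul0r addr0; apply; rewrite s0.
by rewrite v10 v20 => _ /eqP; rewrite subr_eq0.
Qed.

End flow.

(** * First crossings *)

Section crossing.
Variable R : realType.
Implicit Types (a b c r s t x y : R).

Lemma chain_le (x : nat -> R) m i j : (forall n, (n < m)%N -> x n < x n.+1) ->
  (i <= j <= m)%N -> x i <= x j.
Proof.
move=> xS /andP[/subnK <-]; elim: (j - i)%N => [//|k IH] jm.
exact: le_trans (IH (ltnW jm)) (ltW (xS _ jm)).
Qed.

Lemma der_pos_left (f : R -> R) d x a : 0 < d -> is_derive x 1 f d -> a < x ->
  exists2 y, a < y < x & f y < f x.
Proof.
move=> d0 [df fd] ax.
have : (fun h => h^-1 *: ((f \o shift x) (h *: 1) - f x)) @ 0^' --> d.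
  by rewrite -fd; exact: df.
move/cvgrPdist_lt => /(_ d d0) /nbhs_ballP[e /= e0 H].
pose h := Num.min (e / 2) ((x - a) / 2).
have h0 : 0 < h by rewrite lt_min !divr_gt0// subr_gt0.
have he : h < e.
  by apply: (@le_lt_trans _ _ (e / 2)); [rewrite ge_min lexx|rewrite ltr_pdivrMr// ltr_pMr// ltr1n].
have hx : h < x - a.
  apply: (@le_lt_trans _ _ ((x - a) / 2)); first by rewrite ge_min lexx orbT.
  by rewrite ltr_pdivrMr// ltr_pMr ?subr_gt0// ltr1n.
exists (x - h); first by rewrite ltrBrDl -ltrBrDr hx ltrBlDr ltrDl h0.
have := H (- h); rewrite /ball /= sub0r opprK gtr0_norm// => /(_ he).
rewrite oppr_eq0 gt_eqF// => /(_ isT).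
rewrite /GRing.scale /= mulr1 [- h + x]addrC.
rewrite ltr_norml invrN mulNr => /andP[_]; rewrite opprK gtrDl pmulr_rlt0 ?invr_gt0//.
by rewrite subr_lt0.
Qed.

(** The infimum of the points where the value is at most [c]. *)
Lemma first_descent (f : R -> R) c a b : a <= b ->
  (forall x, a <= x <= b -> {for x, continuous f}) ->
  c < f a -> f b <= c ->
  exists z, [/\ a < z, z <= b, f z = c & forall x, a <= x -> x < z -> c < f x].
Proof.
move=> ab cf fa fb.
pose Z := [set x | a <= x <= b /\ f x <= c].
have Zb : Z b by split; rewrite // ab lexx.
have Zlb : lbound Z a by move=> x [/andP[]].
have hinf : has_inf Z by split; [exists b|exists a].
pose z := inf Z.
have az : a <= z by apply: lb_le_inf => //; exists b.
have zb : z <= b by apply: ge_inf => //; exists a.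
have zab : a <= z <= b by rewrite az zb.
have fz := cf z zab.
have fzc : f z <= c.
  rewrite leNgt; apply/negP => cz.
  have e0 : 0 < f z - c by rewrite subr_gt0.
  have [d d0 Hd] := cont_delta fz e0.
  have [x [xab fx] xz] := inf_adherent d0 hinf.
  have zx : z <= x by apply: ge_inf => //; exists a.
  have := Hd x; rewrite ger0_norm ?subr_ge0// ltrBlDl => /(_ xz).
  rewrite ltr_norml; lra.
have az' : a < z.
  by rewrite lt_neqAle az andbT; apply: contraTneq fa => ->; rewrite -leNgt.
have before x : a <= x -> x < z -> c < f x.
  move=> ax xz; rewrite ltNge; apply/negP => fx.
  suff : z <= x by rewrite leNgt xz.
  apply: ge_inf; first by exists a.
  by split=> //; rewrite ax (le_trans (ltW xz)).
exists z; split => //.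
apply/le_anti; rewrite fzc /= leNgt; apply/negP => cz.
have e0 : 0 < c - f z by rewrite subr_gt0.
have [d d0 Hd] := cont_delta fz e0.
pose x := Num.max a (z - d / 2).
have xz : x < z by rewrite /x gt_max az' /= ltrBlDr ltrDl divr_gt0.
have := before x; rewrite /x le_max lexx => /(_ isT xz).
have := Hd x; rewrite ltr0_norm ?subr_lt0// opprB.
have -> : z - x < d.
  rewrite ltrBlDr -ltrBlDl; apply: (@lt_le_trans _ _ (z - d / 2)).
    by rewrite ltrD2l ltrN2 ltr_pdivrMr// ltr_pMr// ltr1n.
  by rewrite /x le_max lexx orbT.
move=> /(_ isT); rewrite -/x; move: (f x) (f z) => p q.
rewrite ltr_norml => /andP[_ h1] h2.
by move: h1 h2; rewrite ltrBlDr subrK => /lt_trans h /h; rewrite ltxx.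
Qed.

(** The first return to the level [c] would come from above with a positive
    derivative. *)
Lemma no_downcross (f df : R -> R) c a b : a <= b ->
  (forall x, a <= x <= b -> is_derive x 1 f (df x)) ->
  (forall x, a <= x <= b -> f x = c -> 0 < df x) ->
  c < f a -> c < f b.
Proof.
move=> ab hf pos fa; rewrite ltNge; apply/negP => fb.
have [|z [az zb fzE before]] := first_descent ab _ fa fb.
  by move=> x /hf; exact: der_cont.
have zab : a <= z <= b by rewrite (ltW az) zb.
have [y /andP[ay yz] fy] := der_pos_left (pos z zab fzE) (hf z zab) az.
by have := before y (ltW ay) yz; rewrite -fzE => /(lt_trans fy); rewrite ltxx.
Qed.

End crossing.

(** * The polar angle of a solution and its sign changes *)

Section sine_signs.
Variable R : realType.
Implicit Types (t : R) (n : nat).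

Lemma sin_npi n t : sin (t + n%:R * pi) = (-1) ^+ n * sin t :> R.
Proof.
elim: n => [|n IH]; first by rewrite mul0r addr0 mul1r.
by rewrite -natr1 mulrDl mul1r addrA sinDpi IH exprS mulN1r mulNr.
Qed.

Lemma cos_npi n t : cos (t + n%:R * pi) = (-1) ^+ n * cos t :> R.
Proof.
elim: n => [|n IH]; first by rewrite mul0r addr0 mul1r.
by rewrite -natr1 mulrDl mul1r addrA cosDpi IH exprS mulN1r mulNr.
Qed.

Lemma sin_sign n t : n%:R * pi < t < n.+1%:R * pi -> 0 < (-1) ^+ n * sin t.
Proof.
move=> /andP[h1 h2]; rewrite -(subrK (n%:R * pi) t) sin_npi mulrA -exprMn.
rewrite mulrNN mulr1 expr1n mul1r; apply: sin_gt0_pi.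
by rewrite subr_gt0 h1 ltrBlDl -[X in _ < _ + X]mul1r -mulrDl natr1.
Qed.

Lemma sin_sign_le n t : n%:R * pi <= t <= n.+1%:R * pi -> 0 <= (-1) ^+ n * sin t.
Proof.
move=> /andP[h1 h2]; rewrite -(subrK (n%:R * pi) t) sin_npi mulrA -exprMn.
rewrite mulrNN mulr1 expr1n mul1r; apply: sin_ge0_pi.
by rewrite subr_ge0 h1 lerBlDl -[X in _ <= _ + X]mul1r -mulrDl natr1.
Qed.

Lemma sin_pi_mul n : sin (n%:R * pi) = 0 :> R.
Proof. by rewrite -[n%:R * pi]add0r sin_npi sin0 mulr0. Qed.

Lemma cos_pi_mul n : cos (n%:R * pi) = (-1) ^+ n :> R.
Proof. by rewrite -[n%:R * pi]add0r cos_npi cos0 mulr1. Qed.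

(** The intervals contain their right ends because an angle equal to (n + 1) pi has
    not yet passed that level. *)
Lemma pi_level t : 0 < t -> exists n, n%:R * pi < t <= n.+1%:R * pi.
Proof.
move=> t0; have p0 := @pi_gt0 R.
have H : exists n, (t <= n.+1%:R * pi).
  have /archi_boundP : 0 <= t / pi by rewrite divr_ge0// ltW.
  set n := Num.bound _ => h; exists n; rewrite -ler_pdivrMr//.
  by apply: ltW; apply: lt_trans h _; rewrite ltr_nat.
exists (ex_minn H); case: ex_minnP => -[|n] h1 h2; first by rewrite mul0r t0 h1.
by rewrite h1 andbT ltNge; apply/negP => /h2; rewrite ltnn.
Qed.

Lemma sin_eq0_level n t : n%:R * pi < t <= n.+1%:R * pi -> sin t = 0 ->
  t = n.+1%:R * pi.
Proof.
move=> /andP[h1]; rewrite le_eqVlt => /predU1P[//|h2] s0.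
by have := @sin_sign n t; rewrite h1 h2 s0 mulr0 ltxx => /(_ isT).
Qed.

End sine_signs.

Definition sign_changes (R : realType) (F : R -> R) m :=
  exists x : nat -> R,
    [/\ 0 < x 0%N, forall j, (j < m)%N -> x j < x j.+1, x m < 1 &
        forall j, (j < m)%N -> F (x j) * F (x j.+1) < 0].

Section pruefer.
Variable R : realType.
Local Notation mu := (@lebesgue_measure R).
Implicit Types (r t x y : R) (F G W : R -> R).

(** The derivative of the polar angle of the vector with components [F] (sine) and
    [G] (cosine), when F' = G and G' = W. *)
Definition angular_speed F G W r : R :=
  (G r ^+ 2 - F r * W r) / (F r ^+ 2 + G r ^+ 2).

Definition angle F G W : R := \int[mu]_(r in `[0, 1]) angular_speed F G W r.

Variables (F G W : R -> R) (L : R).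
Hypothesis dF : forall r, 0 <= r -> is_derive r 1 F (G r).
Hypothesis dG : forall r, 0 <= r -> is_derive r 1 G (W r).
Hypothesis cW : continuous (fun r => W `|r|).
Hypothesis L0 : 0 <= L.
Hypothesis WL : forall r, 0 <= r -> `|W r| <= L * `|F r|.
Hypothesis nz : forall r, 0 <= r -> 0 < F r ^+ 2 + G r ^+ 2.
Hypothesis F0 : F 0 = 0.
Hypothesis G0 : 0 < G 0.

Local Notation kap := (angular_speed F G W).

Lemma contF : continuous (fun r => F `|r|).
Proof.
move=> r; apply: (@continuous_comp _ _ _ (fun x : R => `|x|) F); first exact: norm_continuous.
exact: der_cont (dF (normr_ge0 r)).
Qed.

Lemma contG : continuous (fun r => G `|r|).
Proof.
move=> r; apply: (@continuous_comp _ _ _ (fun x : R => `|x|) G); first exact: norm_continuous.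
exact: der_cont (dG (normr_ge0 r)).
Qed.

Lemma angular_speed_cont : continuous (fun r => kap `|r|).
Proof.
move=> r; apply: cvgM; first apply: cvgB.
- by rewrite expr2; under eq_fun do rewrite expr2; apply: cvgM; exact: contG.
- by apply: cvgM; [exact: contF|exact: cW].
- apply: cvgV; first by rewrite gt_eqF// nz.
  rewrite !expr2; under eq_fun do rewrite !expr2.
  by apply: cvgD; apply: cvgM; [exact: contF|exact: contF|exact: contG|exact: contG].
Qed.

Lemma angular_speed_le r : 0 <= r -> `|kap r| <= 1 + L.
Proof.
move=> r0; rewrite normrM normfV (gtr0_norm (nz r0)) ler_pdivrMr ?nz//.
apply: le_trans (ler_normB _ _) _.
rewrite mulrDl mul1r; apply: lerD.
  by rewrite ger0_norm ?sqr_ge0// lerDr sqr_ge0.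
rewrite normrM; apply: (@le_trans _ _ (`|F r| * (L * `|F r|))).
  by apply: ler_wpM2l => //; exact: WL.
rewrite mulrCA -expr2 real_normK ?num_real//.
by apply: ler_wpM2l => //; rewrite lerDl sqr_ge0.
Qed.

(** The angle is defined as the primitive of its speed.  Rotating (F, G) back by it,
    the transversal component [A] satisfies a linear homogeneous equation and
    starts at 0, so it vanishes; the other component [B] is then the radius. *)
Lemma pruefer : exists th rho : R -> R,
  [/\ th 0 = 0, th 1 = angle F G W,
      forall r, 0 <= r -> is_derive r 1 th (kap r),
      forall r, 0 <= r -> 0 < rho r &
      forall r, 0 <= r -> F r = rho r * sin (th r) /\ G r = rho r * cos (th r)].
Proof.
have [th [th0 dth']] := primitive_exists angular_speed_cont.
have dth r : 0 <= r -> is_derive r 1 th (kap r).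
  by move=> r0; have := dth' r; rewrite ger0_norm.
pose A r := F r * cos (th r) - G r * sin (th r).
pose B r := F r * sin (th r) + G r * cos (th r).
pose c r := (F r + W r) * G r / (F r ^+ 2 + G r ^+ 2).
have dA r : 0 <= r -> is_derive r 1 A (c r * A r).
  move=> r0; have := dF r0; have := dG r0; have := dth r r0 => d1 d2 d3.
  have := nz r0 => /gt_eqF/negbT nzr.
  by rewrite /A /c; derive; rewrite /angular_speed; field.
have cb r : 0 <= r -> 2 * c r <= 2 * (1 + L).
  move=> r0; apply: ler_wpM2l => //; rewrite ler_pdivrMr ?nz//.
  have := WL r0; rewrite ler_norml.
  have h : `|F r| ^+ 2 = F r ^+ 2 by rewrite real_normK ?num_real.
  have hg : `|G r| ^+ 2 = G r ^+ 2 by rewrite real_normK ?num_real.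
  have h1 : (F r + W r) * G r <= (1 + L) * (`|F r| * `|G r|).
    apply: le_trans (ler_norm _) _; rewrite normrM mulrA; apply: ler_wpM2r => //.
    apply: le_trans (ler_normD _ _) _; rewrite mulrDl mul1r lerD2l; exact: WL.
  move=> _; apply: le_trans h1 _; apply: ler_wpM2l; first by rewrite addr_ge0.
  rewrite -h -hg; have := sqr_ge0 (`|F r| - `|G r|).
  have := normr_ge0 (F r); have := normr_ge0 (G r).
  by move: (`|F r|) (`|G r|) => p q; nra.
have A0 r : 0 <= r -> A r = 0.
  move=> r0; apply/eqP; rewrite -sqrf_eq0; apply/eqP/le_anti; rewrite sqr_ge0 andbT.
  have := @growth_le _ (fun s => A s ^+ 2) (fun s => 2 * c s * A s ^+ 2) (2 * (1 + L)) 0 r r0.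
  have A00 : A 0 = 0 by rewrite /A F0 th0 sin0 mul0r mulr0 subrr.
  rewrite A00 expr0n/= mul0r; apply.
    by move=> s /andP[s0 _]; have dAs := dA s s0; derive; rewrite /=; ring.
  by move=> s /andP[s0 _]; apply: ler_wpM2r; [exact: sqr_ge0|exact: cb].
have FB r : 0 <= r -> F r = B r * sin (th r) /\ G r = B r * cos (th r).
  move=> r0; have := A0 r r0; have := cos2Dsin2 (th r); rewrite /A /B.
  move: (F r) (G r) (cos _) (sin _) => f g co si h1 h2; split; apply/eqP.
    have e1 : f - (f * si + g * co) * si =
      co * (f * co - g * si) + f * (1 - (co ^+ 2 + si ^+ 2)) by ring.
    by rewrite -subr_eq0 e1 h1 h2 mulr0 subrr mulr0 addr0.
  have e1 : g - (f * si + g * co) * co =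
    - si * (f * co - g * si) + g * (1 - (co ^+ 2 + si ^+ 2)) by ring.
  by rewrite -subr_eq0 e1 h1 h2 mulr0 subrr mulr0 addr0.
have Bn0 r : 0 <= r -> B r != 0.
  move=> r0; apply: contraTneq (nz r0) => B0; have [-> ->] := FB r r0.
  by rewrite B0 !mul0r expr0n addr0 ltxx.
have B00 : 0 < B 0 by rewrite /B th0 sin0 cos0 mulr0 add0r mulr1.
exists th, B; split=> //; last first.
  move=> r r0; rewrite lt_neqAle eq_sym Bn0//= leNgt; apply/negP => Br.
  have [||x] := @IVT R B 0 r 0 r0.
  - apply: (@der_within _ B (fun s => G s * sin (th s) + F s * (cos (th s) * kap s)
      + (W s * cos (th s) + G s * (- sin (th s) * kap s)))) => s /andP[s0 _].
    by have := dF s0; have := dG s0; have := dth s s0 => ? ? ?; rewrite /B; derive.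
  - by rewrite ge_min le_max (ltW Br) (ltW B00) orbT.
  - by rewrite in_itv /= => /andP[x0 _]; apply/eqP; exact: Bn0.
have -> : angle F G W = \int[mu]_(r in `[0, 1]) kap `|r|.
  apply: eq_Rintegral => x; rewrite inE/= in_itv/= => /andP[x0 _].
  by rewrite ger0_norm.
have FTC : (\int[mu]_(x in `[0%R, 1%R]) (kap `|x|)%:E = (th 1)%:E - (th 0)%:E)%E.
  apply: (@continuous_FTC2 R (fun x => kap `|x|) th 0 1 ltr01).
  - by apply: continuous_subspaceT; exact: angular_speed_cont.
  - split.
    + by move=> x _; have [] := dth' x.
    + exact/cvg_at_right_filter/(der_cont (dth' 0)).
    + exact/cvg_at_left_filter/(der_cont (dth' 1)).
  - by move=> x _; rewrite derive1E; have [_ ->] := dth' x.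
by rewrite /Rintegral FTC th0 sube0.
Qed.

(** At a multiple of pi the solution [F] vanishes and the angular speed is 1. *)
Lemma level_passed (th rho : R -> R) n a b :
  (forall r, 0 <= r -> is_derive r 1 th (kap r)) ->
  (forall r, 0 <= r -> F r = rho r * sin (th r) /\ G r = rho r * cos (th r)) ->
  0 <= a -> a <= b -> n%:R * pi < th a -> n%:R * pi < th b.
Proof.
move=> dth FG a0 ab; apply: (@no_downcross R th kap (n%:R * pi) a b ab).
  by move=> x /andP[ax _]; apply: dth; exact: le_trans ax.
move=> x /andP[ax _] thx; have x0 := le_trans a0 ax.
have [Fx _] := FG x x0; rewrite thx sin_pi_mul mulr0 in Fx.
have := nz x0; rewrite /angular_speed Fx mul0r subr0 expr0n add0r => Gx.
by rewrite divr_gt0.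
Qed.

(** The angle starts at 0 with speed 1, and then cannot return to 0. *)
Lemma early_gt0 (th rho : R -> R) x :
  (forall r, 0 <= r -> is_derive r 1 th (kap r)) ->
  (forall r, 0 <= r -> F r = rho r * sin (th r) /\ G r = rho r * cos (th r)) ->
  th 0 = 0 -> 0 < x -> 0 < th x.
Proof.
move=> dth FG th0 x0.
have k1 : kap 0 = 1.
  rewrite /angular_speed F0 mul0r subr0 expr0n add0r divff//.
  by rewrite expf_neq0// gt_eqF.
have d0 : is_derive (- 0 : R) 1 th 1 by rewrite oppr0; exact: derE (dth 0 (lexx 0)) k1.
have dm : is_derive (0 : R) 1 (fun x : R => - x) (- 1) by exact: derN (der_id 0).
have dN : is_derive (0 : R) 1 (fun x : R => - th (- x)) 1.
  by apply: derE (derN (der_comp d0 dm)) _; rewrite mulrN1 opprK.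
have xN : - x < 0 by rewrite oppr_lt0.
have [y /andP[y1 y0]] := der_pos_left ltr01 dN xN.
rewrite oppr0 th0 oppr0 oppr_lt0 => ty.
have := @level_passed th rho 0 (- y) x dth FG; rewrite mul0r; apply => //.
  by rewrite oppr_ge0 ltW.
by rewrite lerNl ltW.
Qed.

Lemma angle_gt0 : 0 < angle F G W.
Proof.
have [th [rho [th0 <- dth rho0 FG]]] := pruefer.
exact: early_gt0 dth FG th0 ltr01.
Qed.

(** Points of opposite sign lie in different intervals between consecutive multiples
    of pi, and these are visited in increasing order.  Conversely the points where
    the angle equals (j + s) pi alternate in sign, for a small positive shift [s]. *)
Lemma sign_changesP m : sign_changes F m <-> m%:R * pi < angle F G W.
Proof.
have [th [rho [th0 th1 dth rho0 FG]]] := pruefer.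
rewrite -th1.
have pass n a b := @level_passed th rho n a b dth FG.
have thpos x := @early_gt0 th rho x dth FG th0.
have thc : {within `[0, 1], continuous th}.
  by apply: (@der_within _ th kap) => x /andP[x0 _]; exact: dth.
split.
  move=> [x [x0 xS xm xF]].
  have xpos j : (j <= m)%N -> 0 < x j.
    by move=> jm; apply: lt_le_trans x0 _; exact: chain_le xS _.
  have lev j : (j <= m)%N -> exists n, n%:R * pi < th (x j) <= n.+1%:R * pi /\ (j <= n)%N.
    elim: j => [_|j IH jm]; first by have [n nP] := pi_level (thpos _ x0); exists n.
    have [n [/andP[n1 n2] jn]] := IH (ltnW jm).
    have [n' /andP[n1' n2']] := pi_level (thpos _ (xpos _ jm)).
    exists n'; rewrite n1' n2'; split => //.
    apply: leq_ltn_trans jn _; rewrite ltn_neqAle; apply/andP; split; last first.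
      rewrite -ltnS -(ltr_nat R) -(ltr_pM2r (@pi_gt0 R)); apply: lt_le_trans n2'.
      apply: (pass n (x j)) => //; first exact/ltW/xpos/ltnW.
      exact/ltW/xS.
    apply/eqP => nn; subst n'.
    have := xF j jm; have [-> _] := FG _ (ltW (xpos _ (ltnW jm))).
    have [-> _] := FG _ (ltW (xpos _ jm)); apply/negP; rewrite -leNgt.
    have s1 : 0 <= (-1) ^+ n * sin (th (x j)) by apply: sin_sign_le; rewrite n2 ltW.
    have s2 : 0 <= (-1) ^+ n * sin (th (x j.+1)) by apply: sin_sign_le; rewrite n2' ltW.
    have r1 := rho0 _ (ltW (xpos _ (ltnW jm))); have r2 := rho0 _ (ltW (xpos _ jm)).
    have -> : rho (x j) * sin (th (x j)) * (rho (x j.+1) * sin (th (x j.+1))) =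
      (rho (x j) * rho (x j.+1)) * (((-1) ^+ n * sin (th (x j))) * ((-1) ^+ n * sin (th (x j.+1)))).
      rewrite mulrACA [X in _ = _ * X]mulrACA -exprMn mulrNN mulr1 expr1n mul1r.
      by [].
    by rewrite mulr_ge0// mulr_ge0// ltW.
  have [n [/andP[n1 n2] mn]] := lev m (leqnn m).
  have xm0 := xpos m (leqnn m).
  apply: (pass m (x m) 1 (ltW xm0) (ltW xm)).
  by apply: le_lt_trans n1; rewrite ler_wpM2r ?pi_ge0// ler_nat.
move=> mth; have p0 := @pi_gt0 R.
(* a shift small enough that (m + s) pi is reached before the end *)
pose s := Num.min (1 / 2) ((th 1 / pi - m%:R) / 2).
have s0 : 0 < s by rewrite lt_min !divr_gt0// subr_gt0 ltr_pdivlMr.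
have s1 : s < 1 by rewrite gt_min ltr_pdivrMr// mul1r ltr1n.
have sm : (m%:R + s) * pi < th 1.
  rewrite -ltr_pdivlMr// -ltrBrDl; apply: (@le_lt_trans _ _ ((th 1 / pi - m%:R) / 2)).
    by rewrite ge_min lexx orbT.
  by rewrite ltr_pdivrMr// ltr_pMr ?ltr1n// subr_gt0 ltr_pdivlMr.
have ex (j : nat) : exists x, (j <= m)%N -> 0 <= x <= 1 /\ th x = (j%:R + s) * pi.
  case: (leqP j m) => jm; last by exists 0.
  have [|x] := @IVT R th 0 1 ((j%:R + s) * pi) ler01 thc.
    have jm' : (j%:R + s) * pi <= th 1.
      by apply: le_trans (ltW sm); rewrite ler_wpM2r ?pi_ge0// lerD2r ler_nat.
    have j0 : 0 <= (j%:R + s) * pi by rewrite mulr_ge0 ?pi_ge0// addr_ge0// ltW.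
    by rewrite ge_min le_max th0 j0 jm' orbT.
  by rewrite in_itv /= => x01 thx; exists x.
have [x xP] := choice ex.
have slot j : (j <= m)%N -> j%:R * pi < th (x j) < j.+1%:R * pi.
  move=> jm; have [_ ->] := xP j jm; rewrite !ltr_pM2r//.
  by rewrite ltrDl s0 -natr1 ltrD2l s1.
exists x; split.
- have [/andP[h _] hx] := xP 0%N (leq0n m); rewrite lt_neqAle h andbT.
  apply/eqP => e; have := slot 0%N (leq0n m); rewrite -e th0 mul0r ltxx.
  by [].
- move=> j jm; rewrite ltNge; apply/negP => xx.
  have /andP[h _] := slot j.+1 jm; have [/andP[xj _] _] := xP j.+1 jm.
  have := pass j.+1 _ _ xj xx h; have /andP[_ h'] := slot j (ltnW jm).
  by move=> /(lt_trans h'); rewrite ltxx.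
- have [/andP[_ h] hx] := xP m (leqnn m); rewrite lt_neqAle h andbT.
  by apply/eqP => e; move: sm; rewrite -hx e ltxx.
- move=> j jm; have [/andP[xj _] _] := xP j (ltnW jm); have [/andP[xj' _] _] := xP j.+1 jm.
  have [-> _] := FG _ xj; have [-> _] := FG _ xj'.
  have := sin_sign (slot j (ltnW jm)); have := sin_sign (slot j.+1 jm).
  have := rho0 _ xj; have := rho0 _ xj'; rewrite exprS mulN1r mulNr.
  have : ((-1) ^+ j) ^+ 2 = 1 :> R by rewrite sqrr_sign.
  move: ((-1) ^+ j) (rho (x j)) (rho (x j.+1)) (sin (th (x j))) (sin (th (x j.+1))).
  move=> e a b p q e2 b0 a0 q0 p0'.
  rewrite mulrACA pmulr_rlt0 ?mulr_gt0//.
  have : 0 < (- (e * q)) * (e * p) by rewrite mulr_gt0.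
  have -> : - (e * q) * (e * p) = - (e ^+ 2 * (p * q)) by ring.
  by rewrite e2 mul1r oppr_gt0.
Qed.

End pruefer.

(** * The angle between two profiles *)

Section theta.
Variable R : realType.
Local Notation mu := (@lebesgue_measure R).
Implicit Types (a g r : R).

Local Notation tr := (@traj R 1).
Local Notation ve := (@vel R 1).

Definition accel e g r : R := r * force e (traj e g r / r).

Definition theta a g : R := angle (fun r => tr a r - tr g r)
  (fun r => ve a r - ve g r) (fun r => accel 1 a r - accel 1 g r).

Lemma i01 : 0 <= (1 : R) <= 1. Proof. by rewrite ler01 lexx. Qed.
Hint Resolve i01 : core.

Lemma traj_der e g r : 0 <= e <= 1 -> 0 <= r -> is_derive r 1 (traj e g) (vel e g r).
Proof. by move=> e01; have [[_ _ d _] _] := flowP g e01; exact: d. Qed.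

Lemma vel_der e g r : 0 <= e <= 1 -> 0 <= r -> is_derive r 1 (vel e g) (accel e g r).
Proof. by move=> e01; have [[_ _ _ d] _] := flowP g e01; exact: d. Qed.

Lemma traj_0 e g : 0 <= e <= 1 -> traj e g 0 = 0.
Proof. by move=> e01; have [[]] := flowP g e01. Qed.

Lemma vel_0 e g : 0 <= e <= 1 -> vel e g 0 = g.
Proof. by move=> e01; have [[]] := flowP g e01. Qed.

Lemma accel_cont e g : 0 <= e <= 1 -> continuous (fun r => accel e g `|r|).
Proof.
move=> e01 r; have [_ b] := flowP g e01.
have M0 : 0 <= `|g| + 2 by rewrite addr_ge0.
have [->|r0] := eqVneq r 0.
  rewrite /continuous_at /accel normr0 mul0r.
  set B := 1 + ((`|g| + 2) + (`|g| + 2) ^+ 3).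
  have B0 : 0 < B by rewrite /B ltr_pwDl// addr_ge0// exprn_ge0.
  apply/cvgrPdist_le => d d0; near=> y.
  rewrite sub0r normrN normrM normr_id.
  apply: (@le_trans _ _ (`|y| * B)).
    apply: ler_wpM2l => //; apply: (@le_trans _ _ ((`|g| + 2) + (`|g| + 2) ^+ 3)).
      apply: force_bound => //; have [->|y0] := eqVneq y 0.
        by rewrite normr0 invr0 mulr0 normr0.
      rewrite normrM normfV normr_id ler_pdivrMr ?normr_gt0//.
      exact: b.
    by rewrite /B lerDr.
  rewrite -ler_pdivlMr// -[y]subr0 distrC.
  by near: y; apply: near_dist; rewrite divr_gt0.
apply: (@continuous_comp _ _ _ (fun x : R => `|x|) (accel e g)); first exact: norm_continuous.
have r1 : 0 < `|r| by rewrite normr_gt0.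
have d1 := traj_der g e01 (ltW r1).
have d2 : is_derive `|r| 1 (fun x : R => x^-1) (- 1 / `|r| ^+ 2).
  exact: (@derV _ (fun x => x) _ 1 (lt0r_neq0 r1) (der_id _)).
by rewrite /accel /force; eapply der_cont; derive.
Unshelve. all: by end_near. Qed.

Lemma accel_gap a g N r : `|a| + 2 <= N -> `|g| + 2 <= N -> 0 <= r ->
  `|accel 1 a r - accel 1 g r| <= (1 + 3 * N ^+ 2) * `|tr a r - tr g r|.
Proof.
move=> aN gN r0.
have [_ ba] := flowP a i01; have [_ bg] := flowP g i01.
have rr : 0 <= r <= r by rewrite r0 lexx.
have N0 : 0 <= N by apply: le_trans aN; rewrite addr_ge0.
have := @profile_gap R 1 1 (tr a) (tr g) N r r i01 N0 rr.
rewrite subrr normr0 !mul0r addr0; apply.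
  by apply: le_trans (ba r r0) _; rewrite ler_wpM2r.
by apply: le_trans (bg r r0) _; rewrite ler_wpM2r.
Qed.

Section pair.
Variables a g : R.
Hypothesis ga : g < a.

Let N := Num.max (`|a| + 2) (`|g| + 2).

Let L0 : 0 <= 1 + 3 * N ^+ 2.
Proof. by rewrite addr_ge0// mulr_ge0// sqr_ge0. Qed.

Let dF r : 0 <= r -> is_derive r 1 (fun r => tr a r - tr g r) (ve a r - ve g r).
Proof. by move=> r0; have := traj_der a i01 r0; have := traj_der g i01 r0 => ? ?; derive. Qed.

Let dG r : 0 <= r -> is_derive r 1 (fun r => ve a r - ve g r) (accel 1 a r - accel 1 g r).
Proof. by move=> r0; have := vel_der a i01 r0; have := vel_der g i01 r0 => ? ?; derive. Qed.

Let cW : continuous (fun r => accel 1 a `|r| - accel 1 g `|r|).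
Proof. by move=> r; apply: cvgB; exact: accel_cont. Qed.

Let WL r : 0 <= r ->
  `|accel 1 a r - accel 1 g r| <= (1 + 3 * N ^+ 2) * `|tr a r - tr g r|.
Proof. by apply: accel_gap; rewrite /N le_max lexx ?orbT. Qed.

Let nz r : 0 <= r -> 0 < (tr a r - tr g r) ^+ 2 + (ve a r - ve g r) ^+ 2.
Proof. by move=> r0; apply: flow_separated => //; rewrite gt_eqF. Qed.

Let F0 : tr a 0 - tr g 0 = 0. Proof. by rewrite !traj_0// subrr. Qed.

Let G0 : 0 < ve a 0 - ve g 0. Proof. by rewrite !vel_0// subr_gt0. Qed.

Lemma theta_gt0 : 0 < theta a g.
Proof. exact: (angle_gt0 dF dG cW L0 WL nz F0 G0). Qed.

Lemma theta_sign_changes m :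
  sign_changes (fun r => tr a r - tr g r) m <-> m%:R * pi < theta a g.
Proof. exact: (sign_changesP dF dG cW L0 WL nz F0 G0). Qed.

Lemma theta_polar : exists2 rho : R, 0 < rho &
  tr a 1 - tr g 1 = rho * sin (theta a g) /\ ve a 1 - ve g 1 = rho * cos (theta a g).
Proof.
have [th [rho [_ th1 _ rho0 FG]]] := pruefer dF dG cW L0 WL nz F0 G0.
by exists (rho 1); [exact: rho0|rewrite /theta -th1; exact: FG].
Qed.

(** The angular speed is at most 1 as long as the force pushes the two profiles apart. *)
Lemma theta_le1 : (forall r, 0 <= r <= 1 -> 0 <= (tr a r - tr g r) * (accel 1 a r - accel 1 g r)) ->
  theta a g <= 1.
Proof.
move=> H; have [th [rho [th0 th1 dth _ _]]] := pruefer dF dG cW L0 WL nz F0 G0.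
rewrite /theta -th1.
have [c /andP[c0 c1]] := @der_mvt _ th _ 0 1 ler01 (fun x x01 => dth x (proj1 (andP x01))).
rewrite th0 !subr0 mulr1 => ->; rewrite /angular_speed ler_pdivrMr ?nz// mul1r.
by rewrite lerBlDl addrA lerDr addr_ge0 ?sqr_ge0// H ?c0.
Qed.

End pair.

(** The speed is a ratio of quadratic forms in the difference, hence even in it. *)
Lemma theta_sym a g : theta a g = theta g a.
Proof.
apply: eq_Rintegral => r _; rewrite /angular_speed; congr (_ / _); ring.
Qed.

Lemma theta_opp a g : theta (- a) (- g) = theta a g.
Proof.
apply: eq_Rintegral => r; rewrite inE/= in_itv/= => /andP[r0 _].
have [ta va] := flowN a i01 r0; have [tg vg] := flowN g i01 r0.
rewrite /angular_speed /accel ta va tg vg; congr (_ / _); last by ring.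
by rewrite /force; ring.
Qed.

End theta.

(** * Continuity of the angle *)

Section theta_continuity.
Variable R : realType.

Lemma itv_dist (g d x : R) : x \in `]g - d, g + d[%R -> `|x - g| < d.
Proof. by rewrite in_itv /= ltr_norml => /andP[h1 h2]; lra. Qed.

Local Notation mu := (@lebesgue_measure R).
Implicit Types (a g r : R).

Local Notation tr := (@traj R 1).
Local Notation ve := (@vel R 1).

Let i01 : 0 <= (1 : R) <= 1. Proof. exact: i01. Qed.
Hint Resolve i01 : core.

Definition theta_speed a g r := angular_speed (fun r => tr a r - tr g r)
  (fun r => ve a r - ve g r) (fun r => accel 1 a r - accel 1 g r) r.

Lemma theta_speed_cont a g : g != a -> continuous (fun r => theta_speed a g `|r|).
Proof.
move=> ga; apply: angular_speed_cont.
- move=> r r0; have := traj_der a i01 r0; have := traj_der g i01 r0 => ? ?; derive.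
  by [].
- move=> r r0; have := vel_der a i01 r0; have := vel_der g i01 r0 => ? ?; derive.
  by [].
- by move=> r; apply: cvgB; exact: accel_cont.
- by move=> r r0; apply: flow_separated; rewrite // eq_sym.
Qed.

Lemma theta_speed_le a g N r : g != a -> `|a| + 2 <= N -> `|g| + 2 <= N -> 0 <= r ->
  `|theta_speed a g r| <= 1 + (1 + 3 * N ^+ 2).
Proof.
move=> ga aN gN r0; apply: (@angular_speed_le R (fun r => tr a r - tr g r)
  (fun r => ve a r - ve g r) (fun r => accel 1 a r - accel 1 g r) (1 + 3 * N ^+ 2)) => //.
- by rewrite addr_ge0// mulr_ge0// sqr_ge0.
- by move=> s s0; exact: accel_gap.
- by move=> s s0; apply: flow_separated; rewrite // eq_sym.
Qed.

(** Away from the diagonal the speed is continuous in [g] and locally bounded, so the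
    integral defining the angle is continuous. *)
Lemma theta_cont a g : g != a -> {for g, continuous (theta a)}.
Proof.
move=> ga; have ag : 0 < `|a - g| by rewrite normr_gt0 subr_eq0 eq_sym.
pose d := `|a - g|.
have dE x : x \in `]g - d, g + d[%R -> x != a.
  by move=> /itv_dist h; apply/eqP => xa; move: h; rewrite xa ltxx.
pose N := `|a| + `|g| + d + 2.
have aN : `|a| + 2 <= N by rewrite /N lerD2r -addrA lerDl addr_ge0// ltW.
have gN x : x \in `]g - d, g + d[%R -> `|x| + 2 <= N.
  move=> /itv_dist h; rewrite /N lerD2r -addrA.
  apply: (@le_trans _ _ (`|g| + d)); last by rewrite lerDr.
  have -> : x = g + (x - g) by ring.
  by apply: le_trans (ler_normD _ _) _; rewrite lerD2l ltW.
have thE (y : R) : theta a y = \int[mu]_(r in `[0, 1]) theta_speed a y `|r|.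
  apply: eq_Rintegral => r; rewrite inE/= in_itv/= => /andP[r0 _].
  by rewrite ger0_norm.
have E : theta a = fun x => \int[mu]_(r in `[0, 1]) theta_speed a x `|r| by exact/funext.
suff : {for g, continuous (fun x => \int[mu]_(r in `[0, 1]) theta_speed a x `|r|)}.
  by rewrite -E.
have H : {in `]g - d, g + d[%classic, continuous (fun x => \int[mu]_(r in `[0, 1]) theta_speed a x `|r|)}; last first.
  by apply: H; rewrite inE /= in_itv /= ltrBlDr !ltrDl ag.
apply: (@continuity_under_integral R _ _ mu (fun x r => theta_speed a x `|r|)
  `[0, 1] _ (g - d) (g + d) _ _ (fun=> 1 + (1 + 3 * N ^+ 2))).
- exact: measurable_itv.
- by move=> x /= xI; apply: cont_integrable; apply: theta_speed_cont; exact: dE.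
- apply: aeW => r _ x; rewrite inE /= => xI.
  have r0 := normr_ge0 r.
  have [c1 c2] := flow_cont i01 r0.
  rewrite /continuous_at /theta_speed /angular_speed.
  have ct : tr a `|r| - tr z `|r| @[z --> x] --> tr a `|r| - tr x `|r|.
    by apply: cvgB; [exact: cvg_cst|exact: c1].
  have cv : ve a `|r| - ve z `|r| @[z --> x] --> ve a `|r| - ve x `|r|.
    by apply: cvgB; [exact: cvg_cst|exact: c2].
  have ca : accel 1 a `|r| - accel 1 z `|r| @[z --> x] --> accel 1 a `|r| - accel 1 x `|r|.
    apply: cvgB; first exact: cvg_cst.
    rewrite /accel /force.
    have cy : tr z `|r| / `|r| @[z --> x] --> tr x `|r| / `|r|.
      by apply: cvgM; [exact: c1|exact: cvg_cst].
    apply: cvgM; first exact: cvg_cst.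
    apply: cvgB; first by apply: cvgM; [exact: cvg_cst|exact: cy].
    rewrite !exprS expr0 mulr1; under eq_fun do rewrite !exprS expr0 mulr1.
    by apply: cvgM => //; apply: cvgM.
  apply: cvgM.
    apply: cvgB; last exact: cvgM.
    by rewrite !expr2; under eq_fun do rewrite !expr2; exact: cvgM.
  apply: cvgV; first by rewrite gt_eqF// flow_separated// eq_sym dE.
  by rewrite !expr2; under eq_fun do rewrite !expr2; apply: cvgD; exact: cvgM.
- by apply: cont_integrable => x; exact: cvg_cst.
- move=> x xI; apply: aeW => r _; apply: theta_speed_le => //.
  + exact: dE.
  + exact: gN.
Qed.

(** Near the zero solution |y| <= 1, where y and f(y) = y - y^3 have the same sign. *)
Lemma theta_small : exists2 d : R, 0 < d & forall g, 0 < g < d -> theta g 0 <= 1.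
Proof.
pose K : R := expR ((3 + 3 * (1 + 2) ^+ 2) * 1).
have K0 : 0 < K by exact: expR_gt0.
have K1 : 1 <= K by rewrite -expR0 ler_expR mulr1 addr_ge0// mulr_ge0// exprn_ge0// addr_ge0.
exists (1 / K); first by rewrite divr_gt0.
move=> g /andP[g0 gK]; have g1 : g < 1.
  by apply: lt_le_trans gK _; rewrite ler_pdivrMr// mul1r.
rewrite ltr_pdivlMr// in gK.
have vb r : 0 <= r <= 1 -> `|ve g r| <= 1.
  move=> rr; have := @flow_lipschitz R 1 g 0 1 1 r i01 rr _ _.
  have [-> ->] := flow_zero i01 (proj1 (andP rr)); rewrite !subr0 normr0 gtr0_norm//.
  rewrite -/K => /(_ (ltW g1) ler01) H.
  have [] // := @sqr_sum_le _ (tr g r) (ve g r) 1 ler01 _.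
  apply: le_trans H _; rewrite expr1n expr2 -mulrA.
  by apply: mulr_ile1; rewrite ?ltW// mulr_gt0.
apply: theta_le1 => // r rr; have [tz vz] := flow_zero i01 (proj1 (andP rr)).
rewrite tz subr0 /accel tz mul0r /force mulr0 expr0n subrr mulr0 subr0 mul1r.
have /andP[r0 r1] := rr; move: r0; rewrite le_eqVlt => /predU1P[<-|r0].
  by rewrite mul0r mulr0.
have yb : `|tr g r| <= r.
  have [c /andP[c0 cr]] := @der_mvt _ (tr g) (ve g) 0 r (ltW r0)
    (fun x x0 => traj_der g i01 (proj1 (andP x0))).
  rewrite traj_0// !subr0 => ->; rewrite normrM (gtr0_norm r0) ger_pMl//.
  by apply: vb; rewrite c0 (le_trans cr).
have -> : tr g r * (r * (tr g r / r - (tr g r / r) ^+ 3)) =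
  tr g r ^+ 2 * (1 - (tr g r / r) ^+ 2) by field; rewrite gt_eqF.
apply: mulr_ge0; first exact: sqr_ge0.
rewrite subr_ge0 -(real_normK (num_real _)) -[X in _ <= X](expr1n _ 2).
rewrite lerXn2r ?nnegrE// normrM normfV (gtr0_norm r0) ler_pdivrMr// mul1r.
exact: yb.
Qed.

End theta_continuity.

(** * Oscillation of large profiles *)

Section lane_emden.
Variable R : realType.
Implicit Types (a g r s x y : R).

Let e0 : 0 <= (0 : R) <= 1. Proof. by rewrite lexx ler01. Qed.
Hint Resolve e0 : core.

(** A positive solution is concave, hence nondecreasing, and integrating the equation
    over [x, 2x] gives F' >= F^3 / (2 x).  Then 1/F^2 + ln x is nonincreasing, which
    is impossible for large x. *)
Lemma no_positive_tail (F G : R -> R) a : 0 < a ->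
  (forall r, a <= r -> is_derive r 1 F (G r)) ->
  (forall r, a <= r -> is_derive r 1 G (- F r ^+ 3 / r ^+ 2)) ->
  (forall r, a <= r -> 0 < F r ^+ 2 + G r ^+ 2) ->
  (forall r, a <= r -> 0 <= F r) -> False.
Proof.
move=> a0 dF dG nz F0.
have Gdec x y : a <= x -> x <= y -> G y <= G x.
  move=> ax xy; apply: (@der_le0 _ G (fun r => - F r ^+ 3 / r ^+ 2) _ _ xy) => r /andP[xr _].
    by apply: dG; exact: le_trans xr.
  have ar := le_trans ax xr.
  by rewrite mulNr oppr_le0 divr_ge0 ?sqr_ge0// exprn_ge0// F0.
have G0 b : a <= b -> 0 <= G b.
  move=> ab; rewrite leNgt; apply/negP => Gb.
  pose x := b + (F b + 1) / - G b.
  have h : 0 < (F b + 1) / - G b by rewrite divr_gt0 ?oppr_gt0// ltr_wpDl// F0.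
  have bx : b <= x by rewrite lerDl ltW.
  have [c /andP[bc cx]] := @der_mvt _ F G b x bx (fun r rbx => dF r (le_trans ab (proj1 (andP rbx)))).
  have := F0 x (le_trans ab bx); have := Gdec b c ab bc => Gc Fx E.
  have : F x - F b <= G b * (x - b).
    by rewrite E ler_wpM2r// subr_ge0.
  rewrite /x addrAC subrr add0r.
  have -> : G b * ((F b + 1) / - G b) = - (F b + 1) by field; rewrite lt_eqF.
  rewrite -/x; lra.
have Finc x y : a <= x -> x <= y -> F x <= F y.
  move=> ax xy; apply: (@der_ge0 _ F G _ _ xy) => r /andP[xr _].
    by apply: dF; exact: le_trans xr.
  by apply: G0; exact: le_trans xr.
pose b := a + 1.
have ab : a <= b by rewrite lerDl.
have Fb : 0 < F b.
  rewrite lt_neqAle F0// andbT; apply/eqP => Fb.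
  have Fz r : a <= r <= b -> F r = 0.
    by move=> /andP[ar rb]; apply/le_anti; rewrite F0// andbT Fb Finc.
  have [c cab] := @der_mvt _ F G a b ab (fun r rab => dF r (proj1 (andP rab))).
  rewrite !Fz ?lexx ?ab// subrr /b addrAC subrr add0r mulr1 => Gc.
  have := nz c (proj1 (andP cab)).
  by rewrite Fz// -Gc expr0n addr0 ltxx.
have Fpos r : b <= r -> 0 < F r by move=> br; apply: lt_le_trans Fb (Finc _ _ ab br).
have rpos r : b <= r -> 0 < r by move=> br; apply: lt_le_trans a0 (le_trans ab br).
(* integrate G' = - F^3 / r^2 <= - F(x)^3 / r^2 over [x, 2x], where G stays
   nonnegative *)
have Glow x : b <= x -> F x ^+ 3 / (2 * x) <= G x.
  move=> bx; have x0 := rpos x bx.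
  have xy : x <= 2 * x by rewrite ler_pMl// ler1n.
  have H : G (2 * x) - F x ^+ 3 / (2 * x) <= G x - F x ^+ 3 / x.
    apply: (@der_le0 _ (fun r => G r - F x ^+ 3 / r)
      (fun r => (F x ^+ 3 - F r ^+ 3) / r ^+ 2) x (2 * x) xy) => r /andP[xr _].
      have r1 : r != 0 by rewrite gt_eqF// (lt_le_trans x0).
      have dGr := dG r (le_trans ab (le_trans bx xr)).
      have dr : is_derive r 1 (fun z : R => z^-1) (- 1 / r ^+ 2).
        exact: (@derV _ (fun z => z) r 1 r1 (der_id _)).
      by derive; field.
    have br := le_trans bx xr.
    rewrite mulr_le0_ge0 ?invr_ge0 ?sqr_ge0// subr_le0.
    apply: lerXn2r; rewrite ?nnegrE; [exact/ltW/Fpos|exact/ltW/Fpos|].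
    exact: Finc (le_trans ab bx) xr.
  have G2 := G0 (2 * x) (le_trans ab (le_trans bx xy)).
  have E : F x ^+ 3 / x = 2 * (F x ^+ 3 / (2 * x)) by field; rewrite gt_eqF.
  by rewrite E in H; lra.
pose Q x := (F x ^+ 2)^-1 + ln x.
have Qdec x : b <= x -> ln x <= Q b.
  move=> bx; apply: (@le_trans _ _ (Q x)).
    by rewrite /Q lerDr invr_ge0 sqr_ge0.
  apply: (@der_le0 _ Q (fun r => - (2 * F r * G r) / (F r ^+ 2) ^+ 2 + r^-1) _ _ bx) => r /andP[br _].
    have F2 : F r ^+ 2 != 0 by rewrite expf_neq0// gt_eqF// Fpos.
    have dFr := dF r (le_trans ab br).
    have d2 : is_derive r 1 (fun z => F z ^+ 2) (2 * F r * G r) by derive; rewrite /= expr1.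
    have dV := @derV _ (fun z => F z ^+ 2) r _ F2 d2.
    exact: derD dV (is_derive1_ln (rpos r br)).
  have := Glow r br; have Fr := Fpos r br; have r0 := rpos r br.
  rewrite ler_pdivrMr ?mulr_gt0// => h.
  have -> : - (2 * F r * G r) / (F r ^+ 2) ^+ 2 + r^-1 =
     (F r ^+ 3 - G r * (2 * r)) / (F r ^+ 3 * r) by field; rewrite !gt_eqF.
  by rewrite mulr_le0_ge0 ?invr_ge0 ?subr_le0// mulr_ge0 ?exprn_ge0// ltW.
have := Qdec (expR (Q b + 1)); rewrite expRK gerDl ler10 => H.
suff : b <= expR (Q b + 1) by move/H.
have b0 := rpos b (lexx b).
have : expR (ln b) <= expR (Q b + 1).
  by rewrite ler_expR; apply: le_trans (Qdec b (lexx b)) _; rewrite lerDl.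
by rewrite lnK.
Qed.

(** Otherwise [- s * traj 0 1] would be a nonnegative solution on a half-line. *)
Lemma lane_emden_changes_sign (s x : R) : s ^+ 2 = 1 -> exists2 y, x < y & 0 < s * traj 0 1 y.
Proof.
move=> s1; pose a := `|x| + 1.
have a0 : 0 < a by rewrite ltr_wpDl.
have xa : x < a by rewrite /a ltr_pwDr// ler_norm.
have [//|H] := pselect (exists2 y, x < y & 0 < s * traj 0 1 y).
exfalso; apply: (@no_positive_tail (fun r => - s * traj 0 1 r) (fun r => - s * vel 0 1 r) a a0).
- move=> r ar; have := traj_der 1 e0 (le_trans (ltW a0) ar) => d; derive.
  by rewrite mul0r add0r.
- move=> r ar; have := vel_der 1 e0 (le_trans (ltW a0) ar) => d; derive.
  rewrite mul0r add0r /accel /force mul0r sub0r.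
  have r0 : r != 0 by rewrite gt_eqF// (lt_le_trans a0).
  have s3 : (- s) ^+ 3 = - s by rewrite exprS sqrrN s1 mulr1.
  have -> : (- s * traj 0 1 r) ^+ 3 = - s * traj 0 1 r ^+ 3 by rewrite exprMn s3.
  by field.
- move=> r ar; have r0 := le_trans (ltW a0) ar.
  have [z1 z2] := flow_zero e0 r0.
  have := @flow_separated R 0 1 0 r e0 r0 (oner_neq0 _).
  by rewrite z1 z2 !subr0 !exprMn sqrrN s1 !mul1r.
- move=> r ar; rewrite mulNr oppr_ge0 leNgt; apply/negP => sr.
  by apply: H; exists r => //; exact: lt_le_trans xa ar.
Qed.

(** The uniform lower bound [d] makes the alternation stable under small
    perturbations. *)
Lemma lane_emden_alternates m : exists (x : nat -> R) (d : R),
  [/\ 0 < d, 0 < x 0%N, forall j, (j < m)%N -> x j < x j.+1 &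
    forall j, (j <= m)%N -> d < (-1) ^+ j * traj 0 1 (x j)].
Proof.
elim: m => [|m [x [d [d0 x0 xS xd]]]].
  have [y y0 ty] := @lane_emden_changes_sign 1 0 (expr1n _ _).
  exists (fun=> y), (1 * traj 0 1 y / 2); split => //; first by rewrite divr_gt0.
  by case=> // _; rewrite expr0 ltr_pdivrMr// ltr_pMr// ltr1n.
have [y xy ty] := @lane_emden_changes_sign ((-1) ^+ m.+1) (x m) (sqrr_sign _ _).
exists (fun j => if (j <= m)%N then x j else y).
exists (Num.min d ((-1) ^+ m.+1 * traj 0 1 y / 2)); split => //.
- by rewrite lt_min d0 divr_gt0.
- move=> j jm1; have /predU1P[->|jm] : (j == m) || (j < m)%N by rewrite -leq_eqVlt.
    by rewrite leqnn ltnn.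
  by rewrite (ltnW jm) jm; exact: xS.
- move=> j jm1; have /predU1P[->|jm] : (j == m.+1) || (j < m.+1)%N by rewrite -leq_eqVlt.
    by rewrite ltnn gt_min ltr_pdivrMr// ltr_pMr// ltr1n orbT.
  by rewrite ltnS in jm; rewrite jm gt_min xd.
Qed.

(** Seen at the scale of its height [g], a profile solves the equation with linear
    term 1 / g^2, which is close to the Lane-Emden equation for large [g]. *)
Lemma rescaled_profile g : 1 <= g ->
  profile (g ^+ 2)^-1 1 (fun r => traj 1 g (r / g)) (fun r => vel 1 g (r / g) / g) /\
  forall r, 0 <= r -> `|traj 1 g (r / g)| <= 3 * r.
Proof.
move=> g1; have g0 : 0 < g by exact: lt_le_trans g1.
have gn : g != 0 by rewrite gt_eqF.
have rg r : 0 <= r -> 0 <= r / g by move=> r0; rewrite divr_ge0// ltW.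
have [_ b] := flowP g (@i01 R).
have dsc r : is_derive r 1 (fun z : R => z / g) g^-1.
  by derive; rewrite mulr0 addr0 mul1r.
split; last first.
  move=> r r0; apply: le_trans (b _ (rg r r0)) _.
  rewrite mulrCA mulrC ler_wpM2r// ler_pdivrMr// (ger0_norm (ltW g0)); lra.
split.
- by rewrite mul0r traj_0// i01.
- by rewrite mul0r vel_0 ?i01// divff.
- move=> r r0; exact: (@der_comp R (traj 1 g) (fun z => z / g) r _ _ (traj_der g (@i01 R) (rg r r0)) (dsc r)).
- move=> r r0.
  have d := @der_comp R (vel 1 g) (fun z => z / g) r _ _ (vel_der g (@i01 R) (rg r r0)) (dsc r).
  apply: derE (derM d (derC g^-1 r)) _.
  rewrite mulr0 addr0 /accel /force.
  move: r0; rewrite le_eqVlt => /predU1P[<-|r0]; first by rewrite !mul0r.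
  by field; rewrite gn gt_eqF.
Qed.

(** On a fixed interval the rescaled profile converges to the Lane-Emden profile, and
    thus has as many sign changes as desired before r = 1. *)
Lemma theta_unbounded m : exists2 g : R, 0 < g & m%:R * pi < theta g 0.
Proof.
have [x [d [d0 x0 xS xd]]] := lane_emden_alternates m.
have xpos j : (j <= m)%N -> 0 < x j.
  by move=> jm; apply: lt_le_trans x0 _; exact: chain_le xS _.
pose T := x m; have T0 : 0 < T by exact: xpos.
pose K := 3 * T * expR ((3 + 3 * 3 ^+ 2) * T).
have K0 : 0 < K by rewrite !mulr_gt0// expR_gt0.
(* large enough for T / g < 1 and for the rescaled profile to be d-close to the limit *)
pose g := 1 + T + K / d.
have Kd : 0 < K / d by rewrite divr_gt0.
have g1 : 1 <= g by rewrite /g -addrA lerDl addr_ge0 ?ltW.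
have g0 : 0 < g by exact: lt_le_trans g1.
have gT : T < g by rewrite /g addrAC ltrDr addr_gt0.
have gK : K / d < g by rewrite /g ltrDr addr_gt0.
have gi : g^-1 <= 1 by rewrite invf_le1.
have gi0 : 0 < g^-1 by rewrite invr_gt0.
exists g => //; apply/(theta_sign_changes g0).
have [P b] := rescaled_profile g1.
have [P0 b0] := flowP 1 e0.
have b0' r : 0 <= r -> `|traj 0 1 r| <= 3 * r.
  by move=> r0; apply: le_trans (b0 r r0) _; rewrite normr1 (_ : 1 + 2 = 3)//; ring.
have eg : 0 <= (g ^+ 2)^-1 <= 1.
  by rewrite invr_ge0 sqr_ge0 invf_le1 ?exprn_gt0// exprn_ege1.
have close j : (j <= m)%N -> `|traj 1 g (x j / g) - traj 0 1 (x j)| < d.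
  move=> jm.
  have xT : 0 <= x j <= T.
    by rewrite ltW ?xpos//=; apply: chain_le xS _; rewrite jm leqnn.
  have := profile_close P P0 eg xT b b0'.
  rewrite subrr expr0n add0r subr0 (ger0_norm (proj1 (andP eg))) => H.
  apply: (@le_lt_trans _ _ (K / g)); last by rewrite ltr_pdivrMr// mulrC -ltr_pdivrMr.
  apply: (proj1 (@sqr_sum_le _ _ (vel 1 g (x j / g) / g - vel 0 1 (x j)) _ _ _)).
    by rewrite divr_ge0// ltW.
  apply: le_trans H _.
  set E := expR _.
  have E1 : 1 <= E by rewrite /E -expR0 ler_expR mulr_ge0 ?ltW// addr_ge0// mulr_ge0// exprn_ge0.
  have -> : (K / g) ^+ 2 = g^-1 ^+ 2 * (3 * T) ^+ 2 * (E * E) by rewrite /K -/E; ring.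
  have -> : ((g ^+ 2)^-1 * 3 * T) ^+ 2 * E = (g^-1 ^+ 2) * (g^-1 ^+ 2 * (3 * T) ^+ 2) * E.
    by field; rewrite gt_eqF.
  apply: ler_pM.
  - by apply: mulr_ge0; [exact: sqr_ge0|apply: mulr_ge0; exact: sqr_ge0].
  - exact: le_trans E1.
  - by rewrite ger_pMl ?exprn_gt0 ?mulr_gt0// expr_le1// ltW.
  - by rewrite ler_peMl// (le_trans _ E1).
exists (fun j => x j / g); split.
- by rewrite divr_gt0.
- by move=> j jm; rewrite ltr_pM2r//; exact: xS.
- by rewrite ltr_pdivrMr// mul1r.
- move=> j jm.
  have [-> _] := flow_zero (@i01 R) (ltW (divr_gt0 (xpos _ (ltnW jm)) g0)).
  have [-> _] := flow_zero (@i01 R) (ltW (divr_gt0 (xpos _ jm) g0)).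
  rewrite !subr0; have := close j (ltnW jm); have := close j.+1 jm.
  have := xd j (ltnW jm); have := xd j.+1 jm; rewrite exprS mulN1r mulNr.
  have [->|->] : (-1) ^+ j = 1 :> R \/ (-1) ^+ j = -1 :> R.
    by rewrite -signr_odd; case: (odd j); [right|left].
    rewrite !mul1r !ltr_norml => h1 h2 /andP[h3 h4] /andP[h5 h6].
    by rewrite nmulr_llt0; lra.
  rewrite !mulN1r !ltr_norml => h1 h2 /andP[h3 h4] /andP[h5 h6].
  by rewrite pmulr_llt0; lra.
Qed.

End lane_emden.

(** * Comparing the nodal profiles *)

Section shooting_core.
Variable R : realType.
Implicit Types (a b c d g x y z : R) (i j k n : nat).

Local Notation A g := (@traj R 1 g 1).
Local Notation B g := (@vel R 1 g 1).
Local Notation T g := (@theta R g 0).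

Let i01 : 0 <= (1 : R) <= 1. Proof. exact: i01. Qed.
Let p0 : 0 < @pi R. Proof. exact: pi_gt0. Qed.

Lemma theta_ivt a x y c : x <= y -> (forall z, x <= z <= y -> z != a) ->
  (theta a x <= c <= theta a y) || (theta a y <= c <= theta a x) ->
  exists2 z, x <= z <= y & theta a z = c.
Proof.
move=> xy nea H; have [||z] := @IVT R (theta a) x y c xy.
- apply: continuous_in_subspaceT => z; rewrite inE /= in_itv /= => zxy.
  exact/theta_cont/nea.
- case/orP: H => /andP[h1 h2]; rewrite ge_min le_max h1 h2 ?orbT//.
- by rewrite in_itv /= => zxy E; exists z.
Qed.

Lemma T_ivt x y c : 0 < x -> x <= y ->
  (T x <= c <= T y) || (T y <= c <= T x) -> exists2 z, x <= z <= y & T z = c.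
Proof.
move=> x0 xy; rewrite ![theta _ 0]theta_sym => H.
have [|z zxy E] := theta_ivt xy _ H; last by exists z; rewrite // theta_sym.
by move=> z /andP[xz _]; rewrite gt_eqF// (lt_le_trans x0).
Qed.

Lemma flow1N g : A (- g) = - A g /\ B (- g) = - B g.
Proof. exact: (flowN g i01 ler01). Qed.

Lemma flow10 : A 0 = 0 /\ B 0 = 0.
Proof. exact: (flow_zero i01 ler01). Qed.

Lemma theta_le_small n : (0 < n)%N -> exists2 d : R, 0 < d & forall g, 0 < g < d -> T g < n%:R * pi.
Proof.
move=> n0; have [d d0 H] := theta_small R; exists d => // g gd.
apply: le_lt_trans (H g gd) _; apply: (@lt_le_trans _ _ pi).
  by apply: lt_le_trans (pi_ge2 R); rewrite ltr1n.
by apply: ler_peMl; [exact: ltW|rewrite ler1n].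
Qed.

Lemma T_reached n g : (0 < n)%N -> 0 < g -> n%:R * pi <= T g ->
  exists2 z, 0 < z <= g & T z = n%:R * pi.
Proof.
move=> n0 g0 Tg; have [d d0 Hd] := theta_le_small n0.
pose s := Num.min g (d / 2).
have s0 : 0 < s by rewrite lt_min g0 divr_gt0.
have sg : s <= g by rewrite ge_min lexx.
have sd : s < d by rewrite gt_min ltr_pdivrMr// ltr_pMr// ltr1n orbT.
have [|z /andP[sz zg] E] := @T_ivt s g (n%:R * pi) s0 sg.
  by rewrite Tg (ltW (Hd s _)) ?s0.
by exists z; rewrite // zg (lt_le_trans s0 sz).
Qed.

(** The angle from the zero solution is continuous, small near 0 and unbounded. *)
Lemma T_level n : (0 < n)%N -> exists2 g, 0 < g & T g = n%:R * pi.
Proof.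
move=> n0; have [g g0 Tg] := theta_unbounded R n.
by have [z /andP[z0 _] E] := T_reached n0 g0 (ltW Tg); exists z.
Qed.

Lemma sign_agree i j x : 0 < (-1) ^+ i * x -> 0 < (-1) ^+ j * x ->
  (-1) ^+ i = (-1) ^+ j :> R.
Proof.
rewrite -signr_odd -(signr_odd _ j); case: (odd i); case: (odd j) => //=;
  rewrite expr0 expr1 mul1r mulN1r; lra.
Qed.

Section unique_levels.
Hypothesis T_inj : forall n g g', (0 < n)%N -> 0 < g -> 0 < g' ->
  T g = n%:R * pi -> T g' = n%:R * pi -> g = g'.
Variable gam : nat -> R.
Hypothesis gam_gt0 : forall n, (0 < n)%N -> 0 < gam n.
Hypothesis gamT : forall n, (0 < n)%N -> T (gam n) = n%:R * pi.

(** Otherwise the level n pi would be attained twice, once below [gam n]. *)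
Lemma T_lt n g : (0 < n)%N -> 0 < g -> g < gam n -> T g < n%:R * pi.
Proof.
move=> n0 g0 gn; rewrite ltNge; apply/negP => Tg.
have [z /andP[z0 zg] E] := T_reached n0 g0 Tg.
by move: (le_lt_trans zg gn); rewrite (T_inj n0 (gam_gt0 n0) z0 (gamT n0) E) ltxx.
Qed.

(** The angle exceeds n pi somewhere beyond [gam n]; if it were at most n pi at [g],
    the level n pi would be attained a second time. *)
Lemma T_gt n g : (0 < n)%N -> gam n < g -> n%:R * pi < T g.
Proof.
move=> n0 gn; rewrite ltNge; apply/negP => Tg.
have g0 := lt_trans (gam_gt0 n0) gn.
have [h h0 Th] := theta_unbounded R n.
have nh : gam n < h.
  rewrite ltNge le_eqVlt; apply/negP => /predU1P[hn|hn].
    by rewrite hn gamT// ltxx in Th.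
  by have := lt_trans Th (T_lt n0 h0 hn); rewrite ltxx.
have [z nz E] : exists2 z, gam n < z & T z = n%:R * pi.
  case: (leP g h) => gh.
    have [|z /andP[z1 _] E] := @T_ivt g h (n%:R * pi) g0 gh.
      by rewrite Tg (ltW Th).
    by exists z => //; exact: lt_le_trans z1.
  have [|z /andP[z1 _] E] := @T_ivt h g (n%:R * pi) h0 (ltW gh).
    by rewrite Tg (ltW Th) orbT.
  by exists z => //; exact: lt_le_trans z1.
have := T_inj n0 (gam_gt0 n0) (lt_trans (gam_gt0 n0) nz) (gamT n0) E => gz.
by rewrite -gz ltxx in nz.
Qed.

Lemma gam_mono i k : (0 < i)%N -> (i < k)%N -> gam i < gam k.
Proof.
move=> i0 ik; have k0 := leq_ltn_trans (leq0n i) ik.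
rewrite ltNge le_eqVlt; apply/negP => /predU1P[e|ki].
  have := gamT k0; rewrite e gamT// => /(mulIf (lt0r_neq0 p0))/eqP.
  by rewrite eqr_nat => /eqP eik; rewrite eik ltnn in ik.
have := T_gt k0 ki; rewrite gamT// ltr_pM2r// ltr_nat => /(ltn_trans ik).
by rewrite ltnn.
Qed.

Lemma polar0 g : 0 < g -> exists2 rho, 0 < rho & A g = rho * sin (T g) /\ B g = rho * cos (T g).
Proof.
move=> g0; have [rho rho0 [h1 h2]] := theta_polar g0; exists rho => //.
by move: h1 h2; have [-> ->] := flow10; rewrite !subr0.
Qed.

Lemma A_zero g : 0 < g -> A g = 0 -> exists2 j, (0 < j)%N & g = gam j.
Proof.
move=> g0 Ag; have [rho rho0 [h1 _]] := polar0 g0.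
have [n nT] := pi_level (theta_gt0 g0).
exists n.+1 => //; apply: (T_inj (n := n.+1)) => //; [exact: gam_gt0| |exact: gamT].
apply: sin_eq0_level nT _; apply/eqP; have /eqP := h1.
by rewrite Ag eq_sym mulf_eq0 gt_eqF.
Qed.

Lemma A_gam j : (0 < j)%N -> A (gam j) = 0.
Proof.
by move=> j0; have [rho _ [-> _]] := polar0 (gam_gt0 j0); rewrite gamT// sin_pi_mul mulr0.
Qed.

(** By [slope_gt0] this is the absolute value of the slope of the j-th nodal profile
    at the boundary. *)
Definition slope j := (-1) ^+ j * B (gam j).

Lemma slope_gt0 j : (0 < j)%N -> 0 < slope j.
Proof.
move=> j0; have [rho rho0 [_ h]] := polar0 (gam_gt0 j0).
by rewrite /slope h gamT// cos_pi_mul mulrCA -expr2 sqrr_sign mulr1.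
Qed.

Lemma slope_abs j n : (0 < j)%N -> `|(-1) ^+ n * B (gam j)| = slope j.
Proof.
move=> j0; rewrite -(gtr0_norm (slope_gt0 j0)).
by rewrite /slope !normrM !normrX normrN1 !expr1n.
Qed.

Lemma A_sign j g : 0 < g -> g < gam j.+1 -> ((0 < j)%N -> gam j < g) -> 0 < (-1) ^+ j * A g.
Proof.
move=> g0 gj jg; have [rho rho0 [-> _]] := polar0 g0.
rewrite mulrCA mulr_gt0//; apply: sin_sign; rewrite T_lt// andbT.
by case: j jg {gj} => [_|j jg]; [rewrite mul0r; exact: theta_gt0|exact/T_gt/jg].
Qed.

(** In polar coordinates the difference of boundary slopes is a positive multiple of
    the cosine of the angle. *)
Lemma A_cross k d n : (0 < k)%N -> d < gam k -> A d = 0 ->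
  theta (gam k) d = n%:R * pi -> 0 < (-1) ^+ n * (B (gam k) - B d).
Proof.
move=> k0 dk Ad thn; have [rho rho0 [_ h]] := theta_polar dk.
by rewrite h thn cos_pi_mul mulrCA -expr2 sqrr_sign mulr1.
Qed.

Lemma theta_pi_A k d n : (0 < k)%N -> d < gam k -> theta (gam k) d = n%:R * pi -> A d = 0.
Proof.
move=> k0 dk thn; have [rho rho0 [h _]] := theta_polar dk.
move: h; rewrite thn sin_pi_mul mulr0 A_gam// => /eqP.
by rewrite sub0r oppr_eq0 => /eqP.
Qed.

(** Whenever the angle equals n pi, the sign condition forces (-1)^n = (-1)^k.  The
    angle is k pi at [d = 0] and continuous in [d], so it stays strictly between
    (k - 1) pi and (k + 1) pi, and a zero of its sine there can only be k pi. *)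
Lemma level_persists k lo hi : (0 < k)%N -> lo <= 0 -> 0 <= hi -> hi < gam k ->
  (forall d, lo <= d <= hi -> A d = 0 -> 0 < (-1) ^+ k * (B (gam k) - B d)) ->
  forall d, lo <= d <= hi -> A d = 0 -> theta (gam k) d = k%:R * pi.
Proof.
move=> k0 lo0 hi0 hik H d dI Ad.
have sub0 d1 c : lo <= d1 <= hi ->
    (theta (gam k) d1 <= c <= k%:R * pi) || (k%:R * pi <= c <= theta (gam k) d1) ->
    exists2 z, lo <= z <= hi & theta (gam k) z = c.
  move=> /andP[h1 h2]; rewrite -(gamT k0) => h.
  case: (leP d1 0) => d10.
    have [||z /andP[z1 z2] E] := @theta_ivt (gam k) d1 0 c d10 _ _.
    - by move=> z /andP[_ z0]; rewrite lt_eqF// (le_lt_trans z0)// gam_gt0.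
    - by [].
    - by exists z; rewrite // (le_trans h1 z1) (le_trans z2).
  have [||z /andP[z1 z2] E] := @theta_ivt (gam k) 0 d1 c (ltW d10) _ _.
  - by move=> z /andP[_ z0]; rewrite lt_eqF// (le_lt_trans z0)// (le_lt_trans h2).
  - by rewrite orbC.
  - by exists z; rewrite // (le_trans lo0 z1) (le_trans z2).
have nolev d1 n : lo <= d1 <= hi -> theta (gam k) d1 = n%:R * pi ->
    (-1) ^+ n = - (-1) ^+ k :> R -> False.
  move=> d1I thn en.
  have d1k : d1 < gam k by apply: le_lt_trans hik; case/andP: d1I.
  have A1 := theta_pi_A k0 d1k thn.
  have := A_cross k0 d1k A1 thn; rewrite en mulNr oppr_gt0 => h.
  by have := lt_trans h (H _ d1I A1); rewrite ltxx.
have dk : d < gam k by apply: le_lt_trans hik; case/andP: dI.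
have up : theta (gam k) d < k.+1%:R * pi.
  rewrite ltNge; apply/negP => h.
  have [|z zI E] := sub0 d (k.+1%:R * pi) dI.
    by apply/orP; right; rewrite h andbT ler_pM2r// ler_nat.
  by apply: (nolev z k.+1 zI E); rewrite exprS mulN1r.
have dn : k.-1%:R * pi < theta (gam k) d.
  rewrite ltNge; apply/negP => h.
  have [|z zI E] := sub0 d (k.-1%:R * pi) dI.
    by apply/orP; left; rewrite h /= ler_pM2r// ler_nat leq_pred.
  by apply: (nolev z k.-1 zI E); rewrite -[in RHS](prednK k0) exprS mulN1r opprK.
have s0 : sin (theta (gam k) d) = 0.
  have [rho rho0 [h _]] := theta_polar dk.
  by move/eqP: h; rewrite Ad A_gam// subrr eq_sym mulf_eq0 gt_eqF// => /eqP.
case: (leP (theta (gam k) d) (k%:R * pi)) => h.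
  have := @sin_eq0_level _ k.-1 (theta (gam k) d); rewrite (prednK k0).
  by apply; rewrite // dn h.
have := @sin_eq0_level _ k (theta (gam k) d); rewrite h (ltW up) => /(_ isT s0) e.
by rewrite e ltxx in up.
Qed.

(** Let - z be the first point, going down from 0, where the angle is (k - 1) pi.
    Then z = gam j, and the sign of the slope difference forces (-1)^(k-1) = (-1)^j.
    Just before, the angle lies between (k - 1) pi and k pi, which gives the
    boundary value at [x] the sign (-1)^(k-1); but gam (j-1) < x < gam j gives it
    the sign (-1)^(j-1). *)
Lemma angle_lower_bound k d : (0 < k)%N -> - gam k < d -> d <= 0 -> k.-1%:R * pi < theta (gam k) d.
Proof.
move=> k0 kd d0; rewrite ltNge; apply/negP => H.
have cf x : 0 <= x <= - d -> {for x, continuous (fun x => theta (gam k) (- x))}.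
  move=> /andP[x0 xd]; apply: (@continuous_comp _ _ _ (fun x : R => - x) (theta (gam k))).
    exact: oppr_continuous.
  by apply: theta_cont; rewrite lt_eqF// (le_lt_trans _ (gam_gt0 k0))// oppr_le0.
have Nd0 : 0 <= - d by rewrite oppr_ge0.
have f0 : k.-1%:R * pi < theta (gam k) (- 0).
  by rewrite oppr0 gamT// ltr_pM2r// ltr_nat prednK.
rewrite -[d]opprK in H.
have [z [z0 zd fz before]] := first_descent Nd0 cf f0 H.
have zk : - z < gam k by apply: lt_trans (gam_gt0 k0); rewrite oppr_lt0.
have Az' := theta_pi_A k0 zk fz.
have Az : A z = 0 by move/eqP: Az'; rewrite (flow1N z).1 oppr_eq0 => /eqP.
have [j j0 zj] := A_zero z0 Az.
have := A_cross k0 zk Az' fz; rewrite (flow1N z).2 opprK mulrDr zj => pos.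
have sk : (-1) ^+ k = - (-1) ^+ k.-1 :> R by rewrite -[in LHS](prednK k0) exprS mulN1r.
have Bk := slope_gt0 k0; rewrite /slope sk mulNr oppr_gt0 in Bk.
have Bj : 0 < (-1) ^+ k.-1 * B (gam j).
  by rewrite -(ltrD2l ((-1) ^+ k.-1 * B (gam k))) addr0 (lt_trans Bk).
have parity : (-1) ^+ k.-1 = (-1) ^+ j :> R.
  exact: sign_agree Bj (slope_gt0 j0).
(* the zero of the boundary value preceding gam j *)
pose m := if j == 1%N then 0 else gam j.-1.
have j1 : j != 1%N -> (0 < j.-1)%N by case: (j) j0 => [|[]].
have m0 : 0 <= m by rewrite /m; case: eqP => // /eqP /j1 /gam_gt0/ltW.
have mz : m < z.
  rewrite /m zj; case: eqP => [_|/eqP /j1 jj]; first exact: gam_gt0.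
  by apply: gam_mono; rewrite ?prednK.
have zz : 0 <= z <= - d by rewrite ltW.
have [dl dl0 Hdl] := cont_delta (cf z zz) p0.
(* a point before z, close enough for the angle to stay below k pi, and above the
   previous zero m *)
pose x := Num.max (z - dl / 2) ((m + z) / 2).
have xz : x < z.
  by rewrite gt_max ltrBlDr ltrDl divr_gt0//= ltr_pdivrMr// mulr_natr mulr2n ltrD2r.
have mx : m < x.
  by rewrite lt_max ltr_pdivlMr// mulr_natr mulr2n ltrD2l mz orbT.
have x0 := le_lt_trans m0 mx.
have xd : `|x - z| < dl.
  rewrite ltr0_norm ?subr_lt0// opprB ltrBlDr -ltrBlDl.
  rewrite lt_max ltrD2l ltrN2 ltr_pdivrMr// ltr_pMr// ltr1n.
  by [].
have fx1 := before x (ltW x0) xz.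
have fx2 : theta (gam k) (- x) < k%:R * pi.
  have := Hdl x xd; rewrite fz ltr_norml => /andP[_]; rewrite ltrBlDl.
  by rewrite -[X in _ + X]mul1r -mulrDl natr1 prednK.
have xk : - x < gam k by apply: lt_trans (gam_gt0 k0); rewrite oppr_lt0.
have [rho rho0 [h _]] := theta_polar xk.
have s1 : 0 < (-1) ^+ k.-1 * A x.
  have -> : A x = rho * sin (theta (gam k) (- x)).
    by rewrite -h A_gam// (flow1N x).1 sub0r opprK.
  rewrite mulrCA mulr_gt0//; apply: sin_sign.
  by rewrite fx1 prednK.
have s2 : 0 < (-1) ^+ j.-1 * A x.
  apply: A_sign => //; first by rewrite prednK// -zj.
  move=> jj; move: mx; rewrite /m; case: eqP => // e.
  by rewrite e in jj.
have := sign_agree s1 s2; rewrite parity -[in LHS](prednK j0) exprS mulN1r => /eqP.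
by rewrite eqNr signr_eq0.
Qed.

(** If the slope did not increase, [level_persists] for [gam i] on [- gam (i+1), 0]
    would give the angle i pi between [gam i] and [- gam (i+1)], which by symmetry
    contradicts [angle_lower_bound] for [gam (i+1)].  Equal slopes are excluded since
    the profiles of [gam i] and [- gam (i+1)] would have the same boundary data. *)
Lemma slope_step i : (0 < i)%N -> (forall j, (0 < j)%N -> (j < i)%N -> slope j < slope i) ->
  slope i < slope i.+1.
Proof.
move=> i0 IH; rewrite ltNge; apply/negP => H.
have gi := gam_gt0 i0; have gi1 : 0 < gam i.+1 by exact: gam_gt0.
have sep : slope i.+1 != slope i.
  apply/eqP => e.
  have neq : gam i != - gam i.+1 by rewrite gt_eqF// (lt_trans _ gi)// oppr_lt0.
  have := flow_separated i01 ler01 neq.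
  rewrite (flow1N _).1 (flow1N _).2 !A_gam// oppr0 subrr expr0n add0r opprK.
  suff -> : B (gam i) + B (gam i.+1) = 0 by rewrite expr0n ltxx.
  move: e; rewrite /slope exprS mulN1r mulNr => /eqP; rewrite eqr_oppLR -subr_eq0 opprK -mulrDr.
  by rewrite mulf_eq0 signr_eq0 /= addrC => /eqP.
have lt1 : slope i.+1 < slope i by rewrite lt_neqAle sep.
have ths : theta (gam i) (- gam i.+1) = i%:R * pi.
  apply: (@level_persists i (- gam i.+1) 0 i0) => //.
  - by rewrite oppr_le0 ltW.
  - move=> d /andP[d1 d0] Ad; rewrite mulrBr.
    move: d0; rewrite le_eqVlt => /predU1P[->|d0].
      by rewrite flow10.2 mulr0 subr0; exact: slope_gt0.
    have nd0 : 0 < - d by rewrite oppr_gt0.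
    have [j j0 dj] : exists2 j, (0 < j)%N & - d = gam j.
      by apply: A_zero; rewrite // (flow1N d).1 Ad oppr0.
    have ji : (j <= i.+1)%N.
      rewrite leqNgt; apply/negP => /(gam_mono (ltn0Sn i)); rewrite -dj.
      by rewrite ltrNr ltNge d1.
    have -> : B d = - B (gam j) by rewrite -dj (flow1N d).2 opprK.
    rewrite mulrN opprK -/(slope i).
    have sj := slope_abs i j0.
    have : - slope j <= (-1) ^+ i * B (gam j) by rewrite -sj lerNl -normrN ler_norm.
    move: ji; rewrite leq_eqVlt => /predU1P[ji|]; first by rewrite ji; lra.
    rewrite ltnS leq_eqVlt => /predU1P[->|ji].
      by move=> _; rewrite -/(slope i); have := slope_gt0 i0; lra.
    by have := IH j j0 ji; lra.
  - by rewrite lexx oppr_le0 ltW.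
  - by rewrite (flow1N _).1 A_gam// oppr0.
have := @angle_lower_bound i.+1 (- gam i) (ltn0Sn i); rewrite ltrN2 oppr_le0 => /(_ (gam_mono i0 (ltnSn i)) (ltW gi)).
by rewrite theta_sym -theta_opp opprK ths ltxx.
Qed.

Lemma slope_mono i k : (0 < i)%N -> (i < k)%N -> slope i < slope k.
Proof.
elim: k i => [//|k IH] i i0; rewrite ltnS leq_eqVlt => /predU1P[ik|ik].
  by rewrite ik in i0 *; apply: slope_step => // j j0 jk; exact: IH.
have k0 := leq_ltn_trans (leq0n i) ik.
by apply: lt_trans (IH i i0 ik) _; apply: slope_step => // j j0 jk; exact: IH.
Qed.

(** For |d| <= gam i every boundary slope occurring at a zero is smaller than that of
    the k-th profile, so [level_persists] applies on the whole interval. *)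
Theorem theta_levels i k : (0 < i)%N -> (i < k)%N ->
  theta (gam k) (gam i) = k%:R * pi /\ theta (gam k) (- gam i) = k%:R * pi.
Proof.
move=> i0 ik; have k0 := leq_ltn_trans (leq0n i) ik.
have gi := gam_gt0 i0.
have H := @level_persists k (- gam i) (gam i) k0 _ (ltW gi) (gam_mono i0 ik).
suff H' d : - gam i <= d <= gam i -> A d = 0 -> theta (gam k) d = k%:R * pi.
  split; apply: H'; rewrite ?lexx ?andbT ?(flow1N _).1 ?A_gam ?oppr0//.
    by rewrite (le_trans _ (ltW gi))// oppr_le0 ltW.
  by rewrite /= (le_trans _ (ltW gi))// oppr_le0 ltW.
apply: H; first by rewrite oppr_le0 ltW.
move=> {}d /andP[d1 d2] Ad; rewrite mulrBr -/(slope k).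
(* the slope at a zero of the boundary value, up to sign, is one of the slopes
   below the k-th *)
have aux g : 0 < g -> g <= gam i -> A g = 0 -> `|(-1) ^+ k * B g| < slope k.
  move=> g0 gg Ag; have [j j0 gj] := A_zero g0 Ag; subst g.
  have ji : (j <= i)%N by rewrite leqNgt; apply/negP => /(gam_mono i0); rewrite ltNge gg.
  by rewrite (slope_abs _ j0); exact: slope_mono j0 (leq_ltn_trans ji ik).
case: (ltrgtP d 0) => [dn|dp|->].
- have := aux (- d); rewrite oppr_gt0 (flow1N d).1 (flow1N d).2 Ad oppr0 mulrN normrN => /(_ dn).
  by rewrite lerNl d1 => /(_ isT erefl); rewrite ltr_norml; lra.
- by have := aux d dp d2 Ad; rewrite ltr_norml; lra.
- by rewrite flow10.2 mulr0 subr0; exact: slope_gt0.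
Qed.

End unique_levels.
End shooting_core.

(** * The unit ball in Lebesgue measure *)

Section measure3.
Variable R : realType.
Local Notation mu := (lebesgue3 R).
Local Notation B1 := (@B1 R).

Lemma rat_approx (x e : R) : 0 < e -> exists q : rat, `|ratr q - x| < e.
Proof.
move=> e0; have xe : x - e < x + e by lra.
have [q] := rat_in_itvoo xe.
by rewrite in_itv /= => /andP[h1 h2]; exists q; rewrite ltr_norml; lra.
Qed.

Lemma dist_via (a b c d1 d2 e : R) : `|a - b| < d1 -> `|a - c| < d2 -> d1 + d2 <= e -> `|b - c| < e.
Proof. rewrite !ltr_norml; lra. Qed.

Lemma ball3E (q x : R3 R) (e : R) : ball q e x <->
  [/\ `|q.1.1 - x.1.1| < e, `|q.1.2 - x.1.2| < e & `|q.2 - x.2| < e].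
Proof. by split => [[[h1 h2] h3]|[h1 h2 h3]]. Qed.

Lemma measurable_ball3 (q : R3 R) (e : R) : measurable (ball q e).
Proof.
have -> : ball q e = (ball q.1.1 e `*` ball q.1.2 e) `*` ball q.2 e.
  by apply/seteqP; split => x [[h1 h2] h3].
by apply: measurableX; [apply: measurableX|]; rewrite ball_itv; exact: measurable_itv.
Qed.

(** The sup-norm balls with rational centre and radius form a countable base of
    products of intervals. *)
Lemma open_measurable3 (O : set (R3 R)) : open O -> measurable O.
Proof.
move=> oO.
pose pt (a b c : rat) : R3 R := (ratr a, ratr b, ratr c).
pose F a b c d := if `[< ball (pt a b c) (ratr d : R) `<=` O >]
  then ball (pt a b c) (ratr d : R) else set0.
have -> : O = \bigcup_a \bigcup_b \bigcup_c \bigcup_d F a b c d.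
  apply/seteqP; split => [x Ox|x [a _ [b _ [c _ [d _]]]]]; last first.
    by rewrite /F; case: asboolP => // H /H.
  have /nbhs_ballP[e /= e0 He] : nbhs x O by exact: open_nbhs_nbhs.
  have e4 : 0 < e / 4 by rewrite divr_gt0.
  have [a Ha] := rat_approx x.1.1 e4; have [b Hb] := rat_approx x.1.2 e4.
  have [c Hc] := rat_approx x.2 e4.
  have [d Hd] : exists d : rat, e / 4 < ratr d < e / 2.
    have xe : e / 4 < e / 2 by lra.
    by have [q] := rat_in_itvoo xe; rewrite in_itv /=; exists q.
  have /andP[d1 d2] := Hd.
  exists a => //; exists b => //; exists c => //; exists d => //.
  rewrite /F; case: asboolP => [_|[]].
    by apply/ball3E; split; apply: lt_trans d1.
  move=> y /ball3E[/= h1 h2 h3]; apply: He; apply/ball3E.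
  have ed : e / 4 + ratr d <= e by lra.
  by split; [exact: dist_via Ha h1 ed|exact: dist_via Hb h2 ed|exact: dist_via Hc h3 ed].
do 4! (apply: bigcupT_measurable_rat => ?).
by rewrite /F; case: ifP => // _; exact: measurable_ball3.
Qed.

Lemma continuous_measurable3 (f : R3 R -> R) : continuous f -> measurable_fun setT f.
Proof.
move=> /continuousP cf; apply: (measurability _ (RGenOpens.measurableE R)).
move=> _ [_ [a [b ->] <-]]; rewrite setTI; apply: open_measurable3.
exact/cf/interval_open.
Qed.

Lemma continuous_fst3 : continuous (fun x : R3 R => x.1.1).
Proof. by move=> x; apply: continuous_comp; exact: cvg_fst. Qed.

Lemma continuous_snd3 : continuous (fun x : R3 R => x.1.2).
Proof. by move=> x; apply: continuous_comp; [exact: cvg_fst|exact: cvg_snd]. Qed.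

Lemma continuous_thd3 : continuous (fun x : R3 R => x.2).
Proof. by move=> x; exact: cvg_snd. Qed.

Definition sqnorm (x : R3 R) : R := x.1.1 ^+ 2 + x.1.2 ^+ 2 + x.2 ^+ 2.

Lemma continuous_sqr3 (f : R3 R -> R) : continuous f -> continuous (fun x => f x ^+ 2).
Proof.
move=> cf x; apply: (@continuous_comp _ _ _ f (fun y => y ^+ 2)); first exact: cf.
exact: exprn_continuous.
Qed.

Lemma continuous_sqnorm : continuous sqnorm.
Proof.
move=> x; apply: cvgD; first apply: cvgD.
- exact: (continuous_sqr3 continuous_fst3).
- exact: (continuous_sqr3 continuous_snd3).
- exact: (continuous_sqr3 continuous_thd3).
Qed.

Lemma continuous_enorm : continuous (@enorm R).
Proof.
move=> x; apply: (@continuous_comp _ _ _ sqnorm Num.sqrt); first exact: continuous_sqnorm.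
exact: sqrt_continuous.
Qed.

Lemma open_B1 : open B1.
Proof.
have -> : B1 = @enorm R @^-1` [set y | y < 1] by [].
apply: open_comp; last exact: open_lt.
by move=> x _; exact: continuous_enorm.
Qed.

Lemma measurable_B1 : measurable B1.
Proof. by apply: open_measurable3; exact: open_B1. Qed.

Definition cube : set (R3 R) := (`[-1, 1] `*` `[-1, 1]) `*` `[-1, 1].

Lemma measurable_cube : measurable cube.
Proof. by apply: measurableX; [apply: measurableX|]; exact: measurable_itv. Qed.

Lemma mu_cube : (mu cube < +oo)%E.
Proof.
have mI : measurable (`[-1, 1] : set R) by exact: measurable_itv.
have mII : measurable (`[-1, 1] `*` `[-1, 1] : set (R * R)) by exact: measurableX.
have := @product_measure1E _ _ _ _ R (@lebesgue_measure R \x @lebesgue_measure R)%E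
  (@lebesgue_measure R) _ _ mII mI.
have := @product_measure1E _ _ _ _ R (@lebesgue_measure R) (@lebesgue_measure R) _ _ mI mI.
move=> E1 E2; have := etrans E2 (congr1 (fun z => z * _)%E E1).
rewrite /= !lebesgue_measure_itv /= lte_fin => ->.
by case: ifP => _; rewrite ?mule0 ?mul0e// -EFinB -!EFinM ltry.
Qed.

Lemma B1_cube : B1 `<=` cube.
Proof.
move=> [[x y] z]; rewrite /B1 /enorm /= => H.
have H1 : x ^+ 2 + y ^+ 2 + z ^+ 2 <= 1.
  rewrite leNgt; apply/negP => h; move: H; rewrite ltNge => /negP; apply.
  by rewrite -[1]sqrtr1 ler_sqrt ?ltW// (lt_trans _ h).
have hx := sqr_ge0 x; have hy := sqr_ge0 y; have hz := sqr_ge0 z.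
have key (t : R) : t ^+ 2 <= 1 -> `[-1, 1]%classic t.
  move=> ht; rewrite /= in_itv /= -ler_norml -(@ler_pXn2r _ 2)// ?nnegrE//.
  by rewrite expr1n real_normK ?num_real.
by split; [split|] => /=; apply: key; lra.
Qed.

Lemma mu_B1 : (mu B1 < +oo)%E.
Proof.
apply: le_lt_trans mu_cube; apply: le_measure; rewrite ?inE.
- exact: measurable_B1.
- exact: measurable_cube.
- exact: B1_cube.
Qed.

End measure3.

(** * Integrals along coordinate lines *)

Section line_integrals.
Variable R : realType.
Local Notation leb := (@lebesgue_measure R).
Local Notation mu := (lebesgue3 R).
Local Notation B1 := (@B1 R).

(** A name for the product measure on the plane that carries its sigma-finiteness,
    which Fubini for the last coordinate requires. *)
Definition leb2 : set (measurableTypeR R * measurableTypeR R) -> \bar R := (leb \x leb)%E.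

HB.instance Definition _ := Measure.copy leb2 (leb \x leb)%E.

Lemma leb2_sigma_finite : sigma_finite setT leb2.
Proof.
have /sigma_finiteP[F [TF ndF Foo]] := sigma_finiteT leb.
exists (fun n => F n `*` F n).
  rewrite -setXTT TF predeqE => -[x y]; split.
    move=> [/= [n _ Fnx] [k _ Gky]]; exists (maxn n k) => //; split.
    - by move: x Fnx; exact/subsetPset/ndF/leq_maxl.
    - by move: y Gky; exact/subsetPset/ndF/leq_maxr.
  by move=> [n _ []/= ? ?]; split; exists n.
move=> k; have [? ?] := Foo k.
split; first exact: measurableX.
rewrite (_ : leb2 _ = leb (F k) * leb (F k))%E ?lte_mul_pinfty// ?ge0_fin_numE//.
exact: product_measure1E.
Qed.

HB.instance Definition _ := Measure_isSigmaFinite.Build _ _ _ leb2 leb2_sigma_finite.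

Lemma line_integral0 (f df : R -> R) :
  (forall t : R, is_derive t 1 f (df t)) -> continuous df ->
  (forall t, 1 <= `|t| -> f t = 0 /\ df t = 0) ->
  (\int[leb]_t (df t)%:E = 0)%E.
Proof.
move=> hf cdf h0.
have H : (\int[leb]_(x in `[(- 1)%R, 1%R]) (df x)%:E = (f 1)%:E - (f (-1))%:E)%E.
  have lt11 : (- 1 : R) < 1 by lra.
  apply: (@continuous_FTC2 R df f (-1) 1 lt11).
  - exact: continuous_subspaceT.
  - split.
    + by move=> x _; have [] := hf x.
    + exact/cvg_at_right_filter/(der_cont (hf _)).
    + exact/cvg_at_left_filter/(der_cont (hf _)).
  - by move=> x _; rewrite derive1E; have [_ ->] := hf x.
have [f1 _] := h0 1 (ltac:(rewrite normr1; exact: lexx)).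
have [fm1 _] := h0 (-1) (ltac:(rewrite normrN normr1; exact: lexx)).
rewrite f1 fm1 sube0 in H; apply: etrans H; rewrite [RHS]integral_mkcond.
apply: eq_integral => x _.
rewrite patchE; case: ifPn => // /negP xI; congr EFin; apply: (h0 x _).2.
rewrite leNgt; apply/negP => x1; apply: xI; rewrite inE /= in_itv /= -ler_norml.
exact: ltW.
Qed.

Definition square : set (R * R) := `[-1, 1] `*` `[-1, 1].

Lemma mu_square : ((leb \x leb) square < +oo)%E.
Proof.
have mI : measurable (`[-1, 1] : set R) by exact: measurable_itv.
have := @product_measure1E _ _ _ _ R leb leb _ _ mI mI.
rewrite /= !lebesgue_measure_itv /= lte_fin /square => ->.
by case: ifP => _; rewrite ?mule0// -EFinB -EFinM ltry.
Qed.

Lemma bounded_support_integrable d (T : measurableType d) (m : {measure set T -> \bar R})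
    (A : set T) (D : T -> R) (C : R) :
  measurable A -> (m A < +oo)%E -> measurable_fun setT D ->
  (forall p, `|D p| <= C) -> (forall p, ~ A p -> D p = 0) ->
  m.-integrable setT (EFin \o D).
Proof.
move=> mA Aoo mD DC D0.
have DE : D = D \_ A.
  apply/funext => p; rewrite patchE; case: ifPn => // /negP h; apply: D0.
  by move=> q; apply: h; rewrite inE.
rewrite DE -restrict_EFin; apply/integrable_restrict => //; rewrite setTI.
apply: measurable_bounded_integrable => //; first exact: measurable_funS mD.
by exists C; split; [exact: num_real|move=> M CM x _; exact: le_trans (DC x) (ltW CM)].
Qed.

Lemma square_integrable (D : R * R -> R) C : measurable_fun setT D ->
  (forall p, `|D p| <= C) -> (forall p, ~ square p -> D p = 0) ->
  (leb \x leb)%E.-integrable setT (EFin \o D).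
Proof.
have mQ : measurable square by apply: measurableX; exact: measurable_itv.
exact: (@bounded_support_integrable _ _ (leb \x leb)%E square D C mQ mu_square).
Qed.

Lemma cube_integrable (D : R3 R -> R) C : measurable_fun setT D ->
  (forall p, `|D p| <= C) -> (forall p, ~ @cube R p -> D p = 0) ->
  mu.-integrable setT (EFin \o D).
Proof.
exact: (@bounded_support_integrable _ _ mu (@cube R) D C (@measurable_cube R) (@mu_cube R)).
Qed.

(** The hypothesis excludes only the vertical line through the origin, which is a
    null set of base points. *)
Lemma integral0_dir2 (D : R3 R -> R) : mu.-integrable setT (EFin \o D) ->
  (forall x y, (x != 0) || (y != 0) -> (\int[leb]_z (D (x, y, z))%:E = 0)%E) ->
  (\int[mu]_p (D p)%:E = 0)%E.
Proof.
move=> iD H.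
apply: etrans (esym (@integral12_prod_meas1 _ _ _ _ R leb2 leb (EFin \o D) iD)) _.
rewrite -[RHS](@integral0 _ _ R leb2 setT); apply: ae_eq_integral => //.
- exact: (@measurable_fubini_F _ _ _ _ R leb2 leb (EFin \o D) iD).
- have E : [set ((0:R), (0:R))] = [set 0] `*` [set 0].
    by apply/seteqP; split => [_ -> //|[a b] [/= -> ->]].
  exists [set (0, 0)]; split.
  + by rewrite E; apply: measurableX; exact: measurable_set1.
  + rewrite E; have := @product_measure1E _ _ _ _ R leb leb [set 0] [set 0]
      (measurable_set1 _) (measurable_set1 _).
    by move=> h; apply: etrans h _; rewrite [X in (X * _)%E]lebesgue_measure_set1 mul0e.
  + move=> [x y] /= h; apply: contrapT => xy; apply: h => _; apply: H.
    rewrite -negb_and; apply/negP => /andP[/eqP x0 /eqP y0].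
    by apply: xy; rewrite x0 y0.
Qed.

Lemma integral0_slices (D : R3 R -> R) : mu.-integrable setT (EFin \o D) ->
  (forall z, z != 0 -> (\int[leb \x leb]_p (D (p, z))%:E = 0)%E) ->
  (\int[mu]_p (D p)%:E = 0)%E.
Proof.
move=> iD H.
apply: etrans (esym (@integral21_prod_meas1 _ _ _ _ R leb2 leb (EFin \o D) iD)) _.
rewrite -[RHS](@integral0 _ _ R leb setT); apply: ae_eq_integral => //.
- exact: (@measurable_fubini_G _ _ _ _ R leb2 leb (EFin \o D) iD).
- exists [set 0]; split; [exact: measurable_set1|exact: lebesgue_measure_set1|].
  move=> z /= h; apply: contrapT => z0; apply: h => _; apply: H.
  exact/eqP.
Qed.

Lemma integral0_dir0 (D : R * R -> R) : (leb \x leb)%E.-integrable setT (EFin \o D) ->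
  (forall y, (\int[leb]_x (D (x, y))%:E = 0)%E) -> (\int[leb \x leb]_p (D p)%:E = 0)%E.
Proof.
move=> iD H.
apply: etrans (esym (@integral21_prod_meas1 _ _ _ _ R leb leb (EFin \o D) iD)) _.
by apply: integral0_eq => y _; exact: H.
Qed.

Lemma integral0_dir1 (D : R * R -> R) : (leb \x leb)%E.-integrable setT (EFin \o D) ->
  (forall x, (\int[leb]_y (D (x, y))%:E = 0)%E) -> (\int[leb \x leb]_p (D p)%:E = 0)%E.
Proof.
move=> iD H.
apply: etrans (esym (@integral12_prod_meas1 _ _ _ _ R leb leb (EFin \o D) iD)) _.
by apply: integral0_eq => y _; exact: H.
Qed.

(** The preimage of an open interval is open, up to the origin. *)
Lemma off0_measurable (f : R3 R -> R) : (forall x, x != 0 -> {for x, continuous f}) ->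
  measurable_fun setT f.
Proof.
move=> cf; apply: (measurability _ (RGenOpens.measurableE R)).
move=> _ [_ [a [b ->] <-]]; rewrite setTI.
have o0 : open (~` [set (0 : R3 R)]).
  by apply: closed_openC; apply: accessible_closed_set1; apply: hausdorff_accessible; exact: norm_hausdorff.
have m0 : measurable [set (0 : R3 R)].
  by rewrite -[X in measurable X]setCK; apply: measurableC; exact: open_measurable3.
rewrite -(setIT (f @^-1` _)) -(setUv [set (0 : R3 R)]) setIUr; apply: measurableU.
  case: (pselect (f 0 \in `]a, b[%R)) => h.
    suff -> : f @^-1` `]a, b[ `&` [set 0] = [set 0] by [].
    by apply/seteqP; split => [x [_ ->] //|x ->]; split.
  suff -> : f @^-1` `]a, b[ `&` [set 0] = set0 by exact: measurable0.
  by apply/seteqP; split => [x [+ x0]|//]; rewrite x0.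
apply: open_measurable3; rewrite openE => x [fx /= x0]; rewrite /interior.
have x0' : x != 0 by exact/eqP.
have := cf x x0' => /(_ `]a, b[%classic) H; near=> y; split; last first.
  by near: y; exact: open_nbhs_nbhs.
near: y; apply: H; apply: open_nbhs_nbhs; split => //; exact: interval_open.
Unshelve. all: by end_near. Qed.

End line_integrals.

(** * Integration by parts across a point singularity *)

Section ibp.
Variable R : realType.
Local Notation leb := (@lebesgue_measure R).
Local Notation mu := (lebesgue3 R).
Local Notation B1 := (@B1 R).

Definition line (i : 'I_3) (x : R3 R) (t : R) : R3 R :=
  (if i == 0 :> nat then t else x.1.1,
   if i == 1 :> nat then t else x.1.2,
   if i == 2 :> nat then t else x.2).

Definition component (i : 'I_3) (x : R3 R) : R :=
  if i == 0 :> nat then x.1.1 else if i == 1 :> nat then x.1.2 else x.2.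

Lemma line_shift i x t h : line i x (h + t) = h *: Defs.basis R i + line i x t.
Proof.
have pe (a b c a' b' c' : R) : a = a' -> b = b' -> c = c' -> (a, b, c) = (a', b', c').
  by move=> -> -> ->.
case: i => -[|[|[|//]]] ?; apply: pe;
  by rewrite /= /GRing.scale /= ?mulr1 ?mulr0 ?add0r.
Qed.

Lemma line_der i x t (f : R3 R -> R) d : is_derive (line i x t) (Defs.basis R i) f d ->
  is_derive t 1 (fun s => f (line i x s)) d.
Proof.
move=> [df fd].
have E : (fun h : R => h^-1 *: (((fun s => f (line i x s)) \o shift t) (h *: 1) - f (line i x t))) =
    (fun h => h^-1 *: ((f \o shift (line i x t)) (h *: Defs.basis R i) - f (line i x t))).
  by apply/funext => h; rewrite /= -line_shift /GRing.scale /= mulr1.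
split; first by rewrite /derivable E.
by rewrite /derive E.
Qed.

Lemma triple_continuous (f g k : R -> R) : continuous f -> continuous g ->
  continuous k -> continuous (fun t => (f t, g t, k t) : R3 R).
Proof.
move=> cf cg ck t; apply/cvg_ballP => e e0.
move/cvg_ballP: (cf t) => /(_ e e0) h1.
move/cvg_ballP: (cg t) => /(_ e e0) h2.
move/cvg_ballP: (ck t) => /(_ e e0) h3.
near=> s; split; [split|]; by near: s.
Unshelve. all: by end_near. Qed.

Lemma line_continuous i x : continuous (line i x).
Proof.
rewrite /line; case: i => -[|[|[|//]]] ? /=; apply: triple_continuous => t;
  by [exact: cvg_id|exact: cvg_cst].
Qed.

Lemma coord_sq_le (i : 'I_3) (x : R3 R) : component i x ^+ 2 <= sqnorm x.
Proof.
have h1 := sqr_ge0 x.1.1; have h2 := sqr_ge0 x.1.2; have h3 := sqr_ge0 x.2.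
by rewrite /component /sqnorm; case: i => -[|[|[|//]]] ? /=; lra.
Qed.

Lemma coord_line i x t : component i (line i x t) = t.
Proof. by case: i => -[|[|[|//]]] ?. Qed.

Lemma B1E (x : R3 R) : B1 x <-> sqnorm x < 1.
Proof.
have s0 : 0 <= sqnorm x by rewrite !addr_ge0 ?sqr_ge0.
rewrite /B1 /enorm /= -/(sqnorm x); split => H.
  rewrite ltNge; apply/negP => h; move: H; rewrite ltNge => /negP; apply.
  by rewrite -[1]sqrtr1 ler_sqrt.
by rewrite -[1]sqrtr1 ltr_sqrt.
Qed.

Lemma line_outside i x t : 1 <= `|t| -> ~ B1 (line i x t).
Proof.
move=> t1 /B1E; have := coord_sq_le i (line i x t); rewrite coord_line.
move=> h1 h2; have := le_lt_trans h1 h2; rewrite ltNge => /negP; apply.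
by rewrite -(real_normK (num_real t)) exprn_ege1.
Qed.

Section test_function_facts.
Variable phi : R3 R -> R.
Hypothesis tphi : test_function phi.
Variable i : 'I_3.

Lemma test_cont : continuous phi.
Proof. by have [s _ _] := tphi; have [] := s [::]. Qed.

Lemma test_partial_cont : continuous (partial i phi).
Proof. by have [s _ _] := tphi; have [] := s [:: i]. Qed.

Lemma test_der x : is_derive x (Defs.basis R i) phi (partial i phi x).
Proof. by have [s _ _] := tphi; have [_ d] := s [::]; apply: DeriveDef => //; exact: d. Qed.

Lemma test_off x : ~ B1 x -> phi x = 0 /\ partial i phi x = 0.
Proof.
move=> nx; have [_ _ sub] := tphi.
have nc : ~ closure [set x | phi x != 0] x by move/sub.
have : \near x, phi x = 0.
  have : nbhs x (~` closure [set x | phi x != 0]).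
    by apply: open_nbhs_nbhs; split => //; apply: closed_openC; exact: closed_closure.
  apply: filterS => y ny; apply/eqP/negP => /negP y0; apply: ny.
  exact: subset_closure.
move=> H; split; first exact: nbhs_singleton H.
have H' : \near x, (fun _ : R3 R => 0 : R) x = phi x by apply: filterS H => y ->.
by have [_] := near_eq_is_derive H' (is_derive_cst 0 x (Defs.basis R i)).
Qed.

End test_function_facts.

Lemma compact_cube : compact (@cube R).
Proof. by apply: compact_setX; [apply: compact_setX|]; exact: segment_compact. Qed.

Lemma cont_test_bounded (f : R3 R -> R) : continuous f -> (forall x, ~ B1 x -> f x = 0) ->
  exists2 C, 0 <= C & forall x, `|f x| <= C.
Proof.
move=> cf f0.
have /compact_bounded[M [_ HM]] : compact (f @` (@cube R)).
  by apply: continuous_compact; [exact: continuous_subspaceT|exact: compact_cube].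
exists (`|M| + 1); first by rewrite addr_ge0.
move=> x; case: (pselect (B1 x)) => Bx; last by rewrite f0// normr0 addr_ge0.
apply: HM; first by rewrite ltr_pwDr// ler_norm.
by exists x => //; exact: B1_cube.
Qed.

Lemma off_origin_line i x t : (exists j : 'I_3, j != i /\ component j x != 0) -> line i x t != 0.
Proof.
move=> [j [ji jx]]; apply/eqP => H; move/eqP: jx; apply.
have : component j (line i x t) = 0 by rewrite H; case: (j) => -[|[|[|//]]] ?.
move: ji; rewrite /component /line -(inj_eq val_inj) /=.
by case: i {H} => -[|[|[|//]]] ? /=; case: j => -[|[|[|//]]] ? /=.
Qed.

(** Each direction has its own order of integration; the lines left out form a null
    set. *)
Lemma lines_vanish (i : 'I_3) (D : R3 R -> R) (C : R) : measurable_fun setT D ->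
  (forall x, `|D x| <= C) -> (forall x, ~ B1 x -> D x = 0) ->
  (forall x, (exists j : 'I_3, j != i /\ component j x != 0) ->
     (\int[leb]_t (D (line i x t))%:E = 0)%E) ->
  (\int[mu]_x (D x)%:E = 0)%E.
Proof.
move=> mD DC D0 H.
have Dc p : ~ @cube R p -> D p = 0 by move=> np; apply: D0 => /B1_cube.
have iD := cube_integrable mD DC Dc.
pose o0 : 'I_3 := Ordinal (isT : (0 < 3)%N); pose o1 : 'I_3 := Ordinal (isT : (1 < 3)%N).
pose o2 : 'I_3 := Ordinal (isT : (2 < 3)%N).
have i2 z : (leb \x leb)%E.-integrable setT (EFin \o (fun p : R * R => D (p, z))).
  apply: (@square_integrable R _ C) => //.
  - by apply: measurableT_comp => //; exact: pair2_measurable.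
  - by move=> p np; apply: Dc => -[/np].
case: i H => -[|[|[|//]]] Hi H.
- apply: integral0_slices => // z z0; apply: integral0_dir0; first exact: i2.
  by move=> y; apply: (H (0, y, z)); exists o2.
- apply: integral0_slices => // z z0; apply: integral0_dir1; first exact: i2.
  by move=> x; apply: (H (x, 0, z)); exists o2.
- apply: integral0_dir2 => // x y xy; apply: (H (x, y, 0)).
  by case/orP: xy => h; [exists o0|exists o1].
Qed.

(** On a line that misses the origin, [H * phi] is differentiable with compact
    support, so its derivative integrates to 0.  Almost every line parallel to an
    axis is of this kind. *)
Lemma ibp (i : 'I_3) (H dH phi : R3 R -> R) (C : R) : test_function phi ->
  (forall x : R3 R, x != 0 -> {for x, continuous H}) ->
  (forall x : R3 R, x != 0 -> {for x, continuous dH}) ->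
  (forall x : R3 R, x != 0 -> is_derive x (Defs.basis R i) H (dH x)) ->
  (forall x, B1 x -> `|H x| <= C) -> (forall x, B1 x -> `|dH x| <= C) ->
  [/\ mu.-integrable B1 (EFin \o (fun x => H x * partial i phi x)),
      mu.-integrable B1 (EFin \o (fun x => dH x * phi x)) &
  \int[mu]_(x in B1) (H x * partial i phi x) = - \int[mu]_(x in B1) (dH x * phi x)].
Proof.
move=> tphi cH cdH dH' HC dHC.
have cphi := test_cont tphi; have cpphi := @test_partial_cont phi tphi i.
have off x (nx : ~ B1 x) := @test_off phi tphi i x nx.
have [C1 C10 b1] := cont_test_bounded cphi (fun x nx => (off x nx).1).
have [C2 C20 b2] := cont_test_bounded cpphi (fun x nx => (off x nx).2).
have mH := off0_measurable cH; have mdH := off0_measurable cdH.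
have mphi := continuous_measurable3 cphi; have mpphi := continuous_measurable3 cpphi.
pose C' := `|C|; have C'0 : 0 <= C' := normr_ge0 C.
have HC' x : B1 x -> `|H x| <= C' by move=> /HC h; apply: le_trans h (ler_norm _).
have dHC' x : B1 x -> `|dH x| <= C' by move=> /dHC h; apply: le_trans h (ler_norm _).
pose D1 x := H x * partial i phi x; pose D2 x := dH x * phi x.
have D1C x : `|D1 x| <= C' * C2.
  case: (pselect (B1 x)) => Bx; last by rewrite /D1 (off x Bx).2 mulr0 normr0 mulr_ge0.
  by rewrite normrM ler_pM// HC'.
have D2C x : `|D2 x| <= C' * C1.
  case: (pselect (B1 x)) => Bx; last by rewrite /D2 (off x Bx).1 mulr0 normr0 mulr_ge0.
  by rewrite normrM ler_pM// dHC'.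
have D10 x : ~ B1 x -> D1 x = 0 by move=> nx; rewrite /D1 (off x nx).2 mulr0.
have D20 x : ~ B1 x -> D2 x = 0 by move=> nx; rewrite /D2 (off x nx).1 mulr0.
have mD1 : measurable_fun setT D1 by exact: measurable_funM.
have mD2 : measurable_fun setT D2 by exact: measurable_funM.
have B1c p : ~ @cube R p -> ~ B1 p by move=> np /B1_cube.
have I1 := cube_integrable mD1 D1C (fun p np => D10 p (B1c p np)).
have I2 := cube_integrable mD2 D2C (fun p np => D20 p (B1c p np)).
have mB1 := @measurable_B1 R.
split.
- by apply: integrableS I1.
- by apply: integrableS I2.
have restr (f : R3 R -> R) : (forall x, ~ B1 x -> f x = 0) ->
    \int[mu]_(x in B1) f x = \int[mu]_x f x.
  move=> f0; rewrite Rintegral_mkcond; apply: eq_Rintegral => x _.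
  by rewrite patchE; case: ifPn => // /negP nx; rewrite f0// => Bx; apply: nx; rewrite inE.
rewrite !restr//; apply/eqP; rewrite -subr_eq0 opprK; apply/eqP.
rewrite -RintegralD//.
rewrite /Rintegral (@lines_vanish i (fun x => D1 x + D2 x) (C' * C2 + C' * C1))//.
- exact: measurable_funD.
- by move=> x; apply: le_trans (ler_normD _ _) _; apply: lerD.
- by move=> x nx; rewrite D10// D20// addr0.
move=> x Hx.
have l0 t := off_origin_line t Hx.
apply: (@line_integral0 R (fun t => H (line i x t) * phi (line i x t))
  (fun t => D1 (line i x t) + D2 (line i x t))).
- move=> t; have d1 := line_der (dH' _ (l0 t)); have d2 := line_der (@test_der phi tphi i (line i x t)).
  by apply: derE (derM d1 d2) _; rewrite addrC.
- move=> t; have cl := @line_continuous i x t.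
  have comp (f : R3 R -> R) : {for line i x t, continuous f} ->
      f (line i x s) @[s --> t] --> f (line i x t).
    by move=> cf; apply: (@continuous_comp _ _ _ (line i x) f).
  apply: cvgD; apply: cvgM; apply: comp;
    by [exact: cH|exact: cpphi|exact: cdH|exact: cphi].
- move=> t t1; have nB := @line_outside i x t t1.
  by rewrite (off _ nB).1 mulr0 D10// D20// addr0.
Qed.

End ibp.

(** * Flat functions and a smooth step *)

Section flat_functions.
Variable R : realType.

Lemma pow_le_expR n (t : R) : 0 <= t -> t ^+ n <= n`!%:R * expR t.
Proof.
elim: n t => [|n IH] t t0; first by rewrite expr0 fact0 mul1r -[leLHS]expR0 ler_expR.
pose d (s : R) := n.+1`!%:R * expR s - n.+1%:R * s ^+ n.
have dF s : 0 <= s <= t -> is_derive s 1 (fun s : R => n.+1`!%:R * expR s - s ^+ n.+1) (d s).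
  by move=> _; derive; rewrite /d mulr1 /=; ring.
have d0 s : 0 <= s <= t -> 0 <= d s.
  by move=> /andP[s0 _]; rewrite /d factS natrM -mulrA -mulrBr mulr_ge0// subr_ge0 IH.
have := der_ge0 t0 dF d0; rewrite expR0 expr0n /= subr0 mulr1 => h.
by rewrite -subr_ge0; apply: le_trans h.
Qed.

(** The family x^-k exp(-1/x) is stable under differentiation, which yields smoothness
    without computing higher derivatives. *)
Definition flat k (x : R) : R := if 0 < x then x^-1 ^+ k * expR (- x^-1) else 0.

Lemma flat0 k x : x <= 0 -> flat k x = 0.
Proof. by rewrite /flat ltNge => ->. Qed.

Lemma flat_gt0 k x : 0 < x -> 0 < flat k x.
Proof. by move=> x0; rewrite /flat x0 mulr_gt0 ?expR_gt0// exprn_gt0// invr_gt0. Qed.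

Lemma flat_ge0 k x : 0 <= flat k x.
Proof. by case: (ltrP 0 x) => x0; [exact/ltW/flat_gt0|rewrite flat0]. Qed.

Lemma flat_le k x : 0 < x -> flat k x <= k.+2`!%:R * x ^+ 2.
Proof.
move=> x0; rewrite /flat x0.
have xi : 0 <= x^-1 by rewrite invr_ge0 ltW.
have h := pow_le_expR k.+2 xi.
have e0 := expR_gt0 x^-1.
rewrite expRN ler_pdivrMr// -(@ler_pM2r _ (x^-1 ^+ 2)) ?exprn_gt0 ?invr_gt0//.
rewrite -exprD addn2; apply: le_trans h _.
by rewrite mulrAC -[X in _ <= X * _]mulrA -exprMn divff ?gt_eqF// expr1n mulr1.
Qed.

Lemma der_quadratic (f : R -> R) (C : R) : (forall h, `|f h| <= C * h ^+ 2) ->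
  is_derive (0 : R) 1 f 0.
Proof.
move=> fC.
have f0 : f 0 = 0 by apply/normr0_eq0/eqP; rewrite eq_le normr_ge0 andbT; have := fC 0; rewrite expr0n mulr0.
have C0 : 0 <= C by have := fC 1; rewrite expr1n mulr1; apply: le_trans.
have H : (fun h : R => h^-1 *: ((f \o shift 0) (h *: 1) - f 0)) @ 0^' --> (0 : R).
  apply/cvgrPdist_le => e e0.
  have C1 : 0 < C + 1 by rewrite ltr_pwDr.
  have eC : 0 < e / (C + 1) by rewrite divr_gt0.
  near=> h.
  have h0 : h != 0 by near: h; exact: nbhs_dnbhs_neq.
  have h1 : `|h| <= e / (C + 1).
    near: h; apply: nbhs_dnbhs; have := near_dist (0 : R) eC.
    by apply: filterS => y; rewrite sub0r normrN.
  rewrite /= f0 subr0 addr0 sub0r normrN /GRing.scale /= mulr1 normrM normfV.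
  have nh : 0 < `|h| by rewrite normr_gt0.
  rewrite mulrC ler_pdivrMr//; apply: le_trans (fC h) _.
  rewrite -real_normK ?num_real// expr2 mulrA ler_pM2r//.
  have := ler_wpM2l C0 h1; move/le_trans; apply.
  by rewrite mulrA ler_pdivrMr// mulrDr mulr1 [C * e]mulrC lerDl ltW.
split; first by apply/cvg_ex; exists 0.
exact: cvg_lim H.
Unshelve. all: by end_near. Qed.

Lemma flat_der k (x : R) : is_derive x 1 (flat k) (flat k.+2 x - k%:R * flat k.+1 x).
Proof.
case: (ltrgtP x 0) => [x0|x0|->].
- rewrite !flat0 ?ltW// mulr0 subr0; apply: (@der_near R (fun _ : R => 0 : R)).
  near=> y; rewrite flat0//; near: y.
  by apply: filterS (lt_nbhsl x0) => y; exact: ltW.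
- apply: (@der_near _ (fun y : R => y^-1 ^+ k * expR (- y^-1))).
    near=> y; rewrite /flat ifT//; near: y; exact: lt_nbhsr.
  have xn : x != 0 by rewrite gt_eqF.
  have di : is_derive x 1 (fun y : R => y^-1) (- x^-1 ^+ 2).
    by apply: derE (derV (f := fun y : R => y) xn (der_id x)) _; rewrite exprVn mulN1r.
  derive; rewrite /flat x0; case: k => [|k] /=; last rewrite !exprS; ring.
- rewrite !flat0// mulr0 subr0; apply: (@der_quadratic _ k.+2`!%:R) => h.
  rewrite ger0_norm ?flat_ge0//; case: (ltrP 0 h) => h0; first exact: flat_le.
  by rewrite flat0// mulr_ge0// sqr_ge0.
Unshelve. all: by end_near. Qed.

Lemma flat_cont k : continuous (flat k).
Proof. by move=> x; exact: der_cont (flat_der k x). Qed.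

Definition mollifier x : R := flat 0 x * flat 0 (1 - x).

Lemma mollifier_cont : continuous mollifier.
Proof.
move=> x; apply: cvgM; first exact: flat_cont.
apply: (@continuous_comp _ _ _ (fun y : R => 1 - y) (flat 0)); last exact: flat_cont.
by apply: cvgB; [exact: cvg_cst|exact: cvg_id].
Qed.

Lemma mollifier_ge0 x : 0 <= mollifier x.
Proof. by rewrite mulr_ge0 ?flat_ge0. Qed.

(** The normalised primitive of the bump; its derivative is again a product of flat
    functions. *)
Lemma smooth_step_exists : exists (S : R -> R) (c : R),
  [/\ forall x : R, is_derive x 1 S (c * mollifier x), forall x, x <= 0 -> S x = 0,
      forall x, 1 <= x -> S x = 1 & forall x, 0 <= S x <= 1].
Proof.
have [B [B0 dB]] := primitive_exists mollifier_cont.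
have mono a b : a <= b -> B a <= B b.
  by move=> ab; apply: (der_ge0 ab (fun x _ => dB x)) => x _; exact: mollifier_ge0.
have B1p : 0 < B 1.
  have le1 : (1/4 : R) <= 3/4 by lra.
  have [c /andP[c1 c2] E] := der_mvt le1 (fun x _ => dB x).
  have c0 : 0 < mollifier c by rewrite /mollifier mulr_gt0// flat_gt0//; lra.
  have h1 := mono 0 (1/4) (ltac:(lra)); have h2 := mono (3/4) 1 (ltac:(lra)).
  have h3 : 0 < mollifier c * (3 / 4 - 1 / 4) by rewrite mulr_gt0//; lra.
  lra.
have lo x : x <= 0 -> B x = 0.
  move=> x0; rewrite -B0; apply: (der0_eq x0) => y /andP[_ y0].
  by apply: derE (dB y) _; rewrite /mollifier flat0// mul0r.
have hi x : 1 <= x -> B x = B 1.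
  move=> x1; apply/esym/(der0_eq x1) => y /andP[y1 _].
  by apply: derE (dB y) _; rewrite /mollifier (@flat0 _ (1 - y)) ?mulr0//; lra.
exists (fun x => (B 1)^-1 * B x), (B 1)^-1; split.
- by move=> x; derive; rewrite mul0r add0r.
- by move=> x x0; rewrite (lo x x0) mulr0.
- by move=> x x1; rewrite (hi x x1) mulVf// gt_eqF.
- move=> x; rewrite mulr_ge0 ?invr_ge0 ?(ltW B1p)//=; last first.
    by case: (lerP x 0) => x0; [rewrite lo|rewrite -B0 mono// ltW].
  rewrite mulrC ler_pdivrMr// mul1r.
  by case: (lerP 1 x) => x1; [rewrite hi|exact/mono/ltW].
Qed.

End flat_functions.

(** * Radial test functions *)

Section radial_tests.
Variable R : realType.
Implicit Types (f h F : R -> R).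

(** Smoothness as membership in some class stable under differentiation: it suffices
    to exhibit the class. *)
Definition smooth1 F := exists P : (R -> R) -> Prop,
  P F /\ forall f, P f -> exists2 df, P df & forall x : R, is_derive x 1 f (df x).

Lemma smooth1_primitive F h : smooth1 h -> (forall x : R, is_derive x 1 F (h x)) -> smooth1 F.
Proof.
move=> [P [Ph HP]] dF; exists (fun f => f = F \/ P f); split; first by left.
move=> f [->|/HP[df Pdf fdf]]; first by exists h => //; right.
by exists df => //; right.
Qed.

Section closed_class.
Variable P : (R -> R) -> Prop.
Hypothesis HP : forall f, P f -> exists2 df, P df & forall x : R, is_derive x 1 f (df x).

(** The algebra generated by the coordinates and the radial functions; it is stable
    under every partial derivative. *)
Inductive smooth3 : (R3 R -> R) -> Prop :=
| smooth3_const a : smooth3 (fun=> a)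
| smooth3_coord i : smooth3 (component i)
| smooth3_comp f : P f -> smooth3 (fun x => f (sqnorm x))
| smooth3_add u v : smooth3 u -> smooth3 v -> smooth3 (fun x => u x + v x)
| smooth3_mul u v : smooth3 u -> smooth3 v -> smooth3 (fun x => u x * v x).

Lemma line_coord i (x : R3 R) : line i x (component i x) = x.
Proof. by case: x => [[a b] c]; case: i => -[|[|[|//]]] ?. Qed.

(** Partial derivatives are derivatives along coordinate lines, where the
    one-variable rules apply. *)
Lemma der_line i (x : R3 R) (u : R3 R -> R) d :
  is_derive (component i x) 1 (fun s => u (line i x s)) d -> is_derive x (Defs.basis R i) u d.
Proof.
move=> [df fd].
have E : (fun h : R => h^-1 *: ((u \o shift x) (h *: Defs.basis R i) - u x)) =
   (fun h : R => h^-1 *: (((fun s => u (line i x s)) \o shift (component i x)) (h *: 1) -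
     u (line i x (component i x)))).
  by apply/funext => h; rewrite /= line_coord line_shift line_coord /GRing.scale /= mulr1.
split; first by rewrite /derivable E.
by rewrite /derive E.
Qed.

Lemma sqnorm_line i (x : R3 R) t : sqnorm (line i x t) = sqnorm x - component i x ^+ 2 + t ^+ 2.
Proof. by case: x => [[a b] c]; case: i => -[|[|[|//]]] ?; rewrite /sqnorm /component /=; ring. Qed.

Lemma coord_line_neq i j (x : R3 R) t : j != i -> component j (line i x t) = component j x.
Proof.
rewrite -(inj_eq val_inj) /=.
by case: i => -[|[|[|//]]] ? /=; case: j => -[|[|[|//]]] ? /=.
Qed.

Lemma der_sqnorm_comp i (x : R3 R) f d : is_derive (sqnorm x) 1 f d ->
  is_derive x (Defs.basis R i) (fun x => f (sqnorm x)) (2 * component i x * d).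
Proof.
move=> df; apply: der_line; under eq_fun do rewrite sqnorm_line.
have E : sqnorm x - component i x ^+ 2 + component i x ^+ 2 = sqnorm x by rewrite subrK.
have ds : is_derive (component i x) 1 (fun t : R => sqnorm x - component i x ^+ 2 + t ^+ 2) (2 * component i x).
  by derive; rewrite add0r mulr1.
rewrite -E in df; apply: derE (der_comp (f := f) (g := fun t : R => sqnorm x - component i x ^+ 2 + t ^+ 2) df ds) _.
by rewrite mulrC.
Qed.

Lemma smooth3_der i u : smooth3 u ->
  exists2 du, smooth3 du & forall x : R3 R, is_derive x (Defs.basis R i) u (du x).
Proof.
elim=> [a|j|f /HP[df Pdf fdf]|v w _ [dv Sv Dv] _ [dw Sw Dw]|v w Sv0 [dv Sv Dv] Sw0 [dw Sw Dw]].
- by exists (fun=> 0); [exact: smooth3_const|move=> x; exact: is_derive_cst].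
- exists (fun=> (j == i)%:R); first exact: smooth3_const.
  move=> x; apply: der_line; case: (eqVneq j i) => [->|ji].
    by under eq_fun do rewrite coord_line; exact: der_id.
  by under eq_fun do rewrite coord_line_neq//; exact: derC.
- exists (fun x => 2 * component i x * df (sqnorm x)).
    apply: (@smooth3_mul (fun x => 2 * component i x) (fun x => df (sqnorm x))).
      by apply: (@smooth3_mul (fun=> 2)); [exact: smooth3_const|exact: smooth3_coord].
    exact: smooth3_comp.
  by move=> x; exact: der_sqnorm_comp.
- exists (fun x => dv x + dw x); first exact: smooth3_add.
  by move=> x; have := Dv x; have := Dw x; move=> d2 d1; exact: is_deriveD.
- exists (fun x => v x * dw x + w x * dv x).
    by apply: smooth3_add; exact: smooth3_mul.
  by move=> x; have := Dv x; have := Dw x; move=> d2 d1; exact: is_deriveM.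
Qed.

Lemma coord_cont i : continuous (@component R i).
Proof.
case: i => -[|[|[|//]]] ?;
  by [exact: continuous_fst3|exact: continuous_snd3|exact: continuous_thd3].
Qed.

Lemma smooth3_cont u : smooth3 u -> continuous u.
Proof.
elim=> [a|j|f /HP[df Pdf fdf]|v w _ cv _ cw|v w _ cv _ cw] x.
- exact: cvg_cst.
- exact: coord_cont.
- apply: (@continuous_comp _ _ _ (@sqnorm R) f); first exact: continuous_sqnorm.
  exact: der_cont (fdf _).
- by apply: cvgD; [exact: cv|exact: cw].
- by apply: cvgM; [exact: cv|exact: cw].
Qed.

Lemma smooth3_smooth u : smooth3 u -> smooth u.
Proof.
move=> Su s /=; have {Su} : smooth3 (foldr (@partial R) u s).
  elim: s => [//|i s IH] /=.
  have [du Sdu dE] := smooth3_der i IH.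
  suff -> : partial i (foldr (@partial R) u s) = du by [].
  by apply/funext => x; have [] := dE x.
move=> Sg; split; first exact: smooth3_cont.
by move=> i x; have [du _ dE] := smooth3_der i Sg; have [] := dE x.
Qed.

End closed_class.

Lemma radial_test F (b : R) : smooth1 F -> b < 1 -> (forall s, b <= s -> F s = 0) ->
  test_function (fun x => F (sqnorm x)).
Proof.
move=> [P [PF HP]] b1 F0.
have sub : closure [set x | F (sqnorm x) != 0] `<=` @sqnorm R @^-1` [set s | s <= b].
  have cl : closed (@sqnorm R @^-1` [set s | s <= b]).
    apply: closed_comp; last exact: closed_le.
    by move=> x _; exact: continuous_sqnorm.
  move/closure_id: cl => ->; apply: closureS => x /= Fx.
  by rewrite leNgt; apply/negP => bs; move/eqP: Fx; apply; apply: F0; exact: ltW.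
have subB : closure [set x | F (sqnorm x) != 0] `<=` @B1 R.
  by move=> x /sub /= sx; apply/B1E; exact: le_lt_trans sx b1.
split => //.
- by apply: (smooth3_smooth HP); exact: smooth3_comp.
- apply: subclosed_compact (@compact_cube R) _; first exact: closed_closure.
  by move=> x /subB; exact: B1_cube.
Qed.

End radial_tests.

(** * Regularity of the profile *)

Section profile_regularity.
Variable R : realType.
Variable g : R.
Implicit Types (r s d : R) (f : R -> R).
Local Notation u := (traj 1 g).
Local Notation v := (vel 1 g).
Let N : R := `|g| + 2.
(** A bound for the force along the profile of [g], which also controls how fast the
    profile departs from the value [g] near 0. *)
Definition radial_bound : R := N + N ^+ 3.
Local Notation K := radial_bound.

Let N0 : 0 <= N. Proof. by rewrite addr_ge0. Qed.

Lemma radial_bound_ge0 : 0 <= K.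
Proof. by rewrite addr_ge0// exprn_ge0. Qed.

Lemma quot_bound r : 0 <= r -> `|u r / r| <= N.
Proof.
move=> r0; have [_ b] := flowP g (@i01 R).
rewrite normrM normfV (ger0_norm r0); have [->|rn] := eqVneq r 0; first by rewrite invr0 mulr0.
by rewrite ler_pdivrMr ?lt_neqAle 1?eq_sym ?rn// b.
Qed.

Lemma force_quot_bound r : 0 <= r -> `|force 1 (u r / r)| <= K.
Proof.
by move=> r0; apply: force_bound (@i01 R) N0 (quot_bound r0).
Qed.

Lemma vel_near r : 0 <= r -> `|v r - g| <= K * r ^+ 2.
Proof.
move=> r0; have [c /andP[c0 cr]] := der_mvt r0 (fun s H => vel_der g (@i01 R) (andP H).1).
rewrite vel_0 ?i01// subr0 => ->; rewrite /accel !normrM (ger0_norm r0) (ger0_norm c0).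
have h := force_quot_bound c0.
rewrite expr2 mulrA ler_wpM2r// mulrC; apply: ler_pM => //.
Qed.

Lemma traj_near r : 0 <= r -> `|u r - g * r| <= K * r ^+ 3.
Proof.
move=> r0.
have d s : 0 <= s <= r -> is_derive s 1 (fun s => u s - g * s) (v s - g).
  move=> /andP[s0 _]; have ds := traj_der g (@i01 R) s0.
  by derive; rewrite mul0r add0r mulr1.
have [c /andP[c0 cr]] := der_mvt r0 d.
rewrite traj_0 ?i01// mulr0 !subr0 => ->; rewrite normrM (ger0_norm r0) exprSr mulrA ler_wpM2r//.
apply: le_trans (vel_near c0) _; rewrite ler_wpM2l ?radial_bound_ge0//.
by rewrite lerXn2r// nnegrE.
Qed.

(** The profile y = u / r, completed at r = 0 by its limit [g]. *)
Definition height r : R := if r == 0 then g else u r / r.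

(** This is y'(r) / r, the factor of x in the gradient of the radial function.  It is
    bounded down to r = 0. *)
Definition radial_slope r : R := (r * v r - u r) / r ^+ 3.

Lemma height_bound r : 0 <= r -> `|height r| <= N.
Proof.
move=> r0; rewrite /height; case: ifP => _; last exact: quot_bound.
by rewrite lerDl.
Qed.

Lemma height_near r : 0 <= r -> `|height r - g| <= K * r ^+ 2.
Proof.
move=> r0; rewrite /height; case: ifPn => [_|rn].
  by rewrite subrr normr0 mulr_ge0 ?radial_bound_ge0// sqr_ge0.
have rp : 0 < r by rewrite lt_neqAle eq_sym rn.
have -> : u r / r - g = (u r - g * r) / r by field; exact: rn.
rewrite normrM normfV (ger0_norm r0) ler_pdivrMr//.
by apply: le_trans (traj_near r0) _; rewrite [_ ^+ 3]exprSr mulrA.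
Qed.

(** The numerator is r (u' - g) - (u - g r), and both terms are of order r^3. *)
Lemma slope_bound r : 0 <= r -> `|radial_slope r| <= 2 * K.
Proof.
move=> r0; have [->|rn] := eqVneq r 0.
  by rewrite /radial_slope expr0n /= invr0 mulr0 normr0 mulr_ge0 ?radial_bound_ge0.
have rp : 0 < r by rewrite lt_neqAle eq_sym rn.
have r3 : 0 < r ^+ 3 by rewrite exprn_gt0.
rewrite /radial_slope normrM normfV (gtr0_norm r3) ler_pdivrMr//.
have -> : r * v r - u r = r * (v r - g) - (u r - g * r) by ring.
apply: le_trans (ler_normB _ _) _.
have h1 := traj_near r0; have h2 := ler_wpM2l r0 (vel_near r0).
rewrite normrM (ger0_norm r0).
have E : r * (K * r ^+ 2) = K * r ^+ 3 by ring.
rewrite E in h2; rewrite -mulrA (_ : 2 * (K * r ^+ 3) = K * r ^+ 3 + K * r ^+ 3); last by ring.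
exact: lerD.
Qed.

Lemma der_sqrt (s : R) : 0 < s -> is_derive s 1 (fun s : R => Num.sqrt s) (2^-1 * (Num.sqrt s)^-1).
Proof. by move=> s0; apply: derE (is_derive1_sqrt s0) _; rewrite invfM. Qed.

Lemma der_height_sqrt s : 0 < s ->
  is_derive s 1 (fun s => height (Num.sqrt s)) (radial_slope (Num.sqrt s) / 2).
Proof.
move=> s0; have rp : 0 < Num.sqrt s by rewrite sqrtr_gt0.
apply: (@der_near _ (fun s => u (Num.sqrt s) * (Num.sqrt s)^-1)).
  near=> t; rewrite /height gt_eqF// sqrtr_gt0; near: t; exact: lt_nbhsr.
have ds := der_sqrt s0; have rn : Num.sqrt s != 0 by rewrite gt_eqF.
have du := der_comp (f := u) (g := fun s : R => Num.sqrt s) (traj_der g (@i01 R) (ltW rp)) ds.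
have di := derV (f := fun s : R => Num.sqrt s) rn ds.
by derive; rewrite /radial_slope; field; rewrite rn.
Unshelve. all: by end_near. Qed.

Variable S : R -> R.

(** A class of functions of s = |x|^2 containing everything needed for the cut-off
    derivative of the profile and stable under differentiation for s > 0: the
    differential equation expresses the derivative of [vel] by [traj] and s. *)
Inductive smooth_pos : (R -> R) -> Prop :=
| sp_const a : smooth_pos (fun _ => a)
| sp_sqrt : smooth_pos (fun s => Num.sqrt s)
| sp_isqrt : smooth_pos (fun s => (Num.sqrt s)^-1)
| sp_traj : smooth_pos (fun s => u (Num.sqrt s))
| sp_vel : smooth_pos (fun s => v (Num.sqrt s))
| sp_flat k a b : smooth_pos (fun s => flat k (a * s + b))
| sp_step a b : smooth_pos (fun s => S (a * s + b))
| sp_add f h : smooth_pos f -> smooth_pos h -> smooth_pos (fun s => f s + h s)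
| sp_mul f h : smooth_pos f -> smooth_pos h -> smooth_pos (fun s => f s * h s).

End profile_regularity.

Ltac smooth_pos_tac := cbv beta; match goal with
  | |- smooth_pos _ _ (fun s => @?f s * @?h s) =>
      apply: (@sp_mul _ _ _ f h); smooth_pos_tac
  | |- smooth_pos _ _ (fun s => @?f s + @?h s) =>
      apply: (@sp_add _ _ _ f h); smooth_pos_tac
  | _ => first [assumption | exact: sp_const | exact: sp_sqrt | exact: sp_isqrt
      | exact: sp_traj | exact: sp_vel | exact: sp_flat | exact: sp_step]
  end.

Section smooth_extension.
Variables (R : realType) (g : R) (S : R -> R) (c : R).
Hypothesis dS : forall x : R, is_derive x 1 S (c * mollifier x).
Implicit Types (r s d : R) (f : R -> R).
Local Notation u := (traj 1 g).
Local Notation v := (vel 1 g).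
Local Notation smooth_pos := (smooth_pos g S).

Lemma smooth_pos_der f : smooth_pos f -> exists2 df, smooth_pos df &
  forall s : R, 0 < s -> is_derive s 1 f (df s).
Proof.
have aff (a b s : R) : is_derive s 1 (fun s : R => a * s + b) a by derive; ring.
elim=> [a||||||a b|f1 f2 _ [d1 S1 D1] _ [d2 S2 D2]|f1 f2 T1 [d1 S1 D1] T2 [d2 S2 D2]].
- by exists (fun=> 0); [exact: sp_const|move=> s _; exact: derC].
- exists (fun s => 2^-1 * (Num.sqrt s)^-1); first by smooth_pos_tac.
  by move=> s s0; exact: der_sqrt.
- exists (fun s => - 2^-1 * ((Num.sqrt s)^-1 * ((Num.sqrt s)^-1 * (Num.sqrt s)^-1))).
    by smooth_pos_tac.
  move=> s s0; have rn : Num.sqrt s != 0 by rewrite gt_eqF// sqrtr_gt0.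
  apply: derE (derV (f := fun s : R => Num.sqrt s) rn (der_sqrt s0)) _.
  by field; rewrite rn.
- exists (fun s => v (Num.sqrt s) * (2^-1 * (Num.sqrt s)^-1)); first by smooth_pos_tac.
  move=> s s0; have r0 : 0 <= Num.sqrt s by exact: sqrtr_ge0.
  exact: (der_comp (f := u) (g := fun s : R => Num.sqrt s) (traj_der g (@i01 R) r0) (der_sqrt s0)).
- pose q s := u (Num.sqrt s) * (Num.sqrt s)^-1.
  have sq : smooth_pos q by rewrite /q; smooth_pos_tac.
  exists (fun s => 2^-1 * (q s + (-1) * (q s * (q s * q s)))).
    by clearbody q; smooth_pos_tac.
  move=> s s0; have rp : 0 < Num.sqrt s by rewrite sqrtr_gt0.
  have rn : Num.sqrt s != 0 by rewrite gt_eqF.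
  apply: derE (der_comp (f := v) (g := fun s : R => Num.sqrt s) (vel_der g (@i01 R) (ltW rp)) (der_sqrt s0)) _.
  by rewrite /accel /force /q; field; rewrite rn.
- move=> k a b; exists (fun s => a * (flat k.+2 (a * s + b) + (- k%:R) * flat k.+1 (a * s + b))).
    by smooth_pos_tac.
  move=> s _; apply: derE (der_comp (f := flat k) (g := fun s : R => a * s + b) (flat_der k _) (aff a b s)) _.
  by ring.
- exists (fun s => a * (c * (flat 0 (a * s + b) * flat 0 ((- a) * s + (1 - b))))).
    by smooth_pos_tac.
  move=> s _; apply: derE (der_comp (f := S) (g := fun s : R => a * s + b) (dS _) (aff a b s)) _.
  have -> : - a * s + (1 - b) = 1 - (a * s + b) by ring.
  by rewrite /mollifier; ring.
- exists (fun s => d1 s + d2 s); first exact: sp_add.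
  by move=> s s0; have e1 := D1 s s0; have e2 := D2 s s0; derive.
- exists (fun s => d1 s * f2 s + f1 s * d2 s); first by apply: sp_add; exact: sp_mul.
  by move=> s s0; have e1 := D1 s s0; have e2 := D2 s s0; derive.
Qed.

Definition vanishing_ext (d : R) (f : R -> R) : Prop := exists l, [/\ smooth_pos l,
  forall s, 0 < s -> f s = l s & forall s, s < d -> f s = 0].

(** A function given for s > 0 by the class, and vanishing for s < d, is smooth on the
    whole line: the derivative in the class vanishes on the overlap 0 < s < d by
    uniqueness of derivatives. *)
Lemma smooth1_vanishing d f : 0 < d -> vanishing_ext d f -> smooth1 f.
Proof.
move=> d0 fd; exists (vanishing_ext d); split => [//|{f fd} f [l [sl fl f0]]].
have [dl sdl Dl] := smooth_pos_der sl.
have dlow s : s < d -> is_derive s 1 f 0.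
  move=> sd; apply: (@der_near R (fun _ : R => 0 : R)).
  near=> t; rewrite f0//; near: t; exact: lt_nbhsl.
have dpos s : 0 < s -> is_derive s 1 f (dl s).
  move=> s0; have := Dl s s0; apply: der_near.
  near=> t; rewrite fl//; near: t; exact: lt_nbhsr.
exists (fun s => if s < d then 0 else dl s).
  exists dl; split => // s; last by move=> ->.
  move=> s0; case: ifPn => // sd.
  by have [_ <-] := dlow s sd; have [_ <-] := dpos s s0.
move=> s; case: ifPn => [|sd]; first exact: dlow.
apply: dpos; apply: lt_le_trans d0 _; by rewrite leNgt.
Unshelve. all: by end_near. Qed.

End smooth_extension.

(** * Smooth approximations of the profile *)

Section height_approximation.
Variable R : realType.
Variable g : R.
Implicit Types (r s d : R) (f : R -> R).
Local Notation K := (radial_bound g).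
Hypothesis u1 : traj 1 g 1 = 0.

Lemma lipschitz_der (F dF : R -> R) (a b C : R) : a <= b ->
  (forall s, a <= s <= b -> is_derive s 1 F (dF s)) ->
  (forall s, a <= s <= b -> `|dF s| <= C) -> `|F b - F a| <= C * (b - a).
Proof.
move=> ab d bd; have [c cab ->] := der_mvt ab d.
by rewrite normrM (@ger0_norm _ (b - a)) ?subr_ge0// ler_wpM2r ?subr_ge0// bd.
Qed.

(** The derivative of the profile with respect to s is multiplied by a cut-off that
    vanishes for s <= 1/(n+1) and s >= 1 - 1/(n+1), and equals 1 at twice these
    distances; [F n] is its primitive vanishing at 1.  The errors of [F n] come from
    the two cut-off layers only, of total length O(1/n), and the boundary condition
    u(1) = 0 removes the constant of integration. *)
Lemma height_approx : exists F h : nat -> R -> R,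
  [/\ forall n, test_function (fun x => F n (sqnorm x)),
      forall n (s : R), is_derive s 1 (F n) (h n s),
      forall n s, `|h n s| <= K,
      forall s, 0 < s < 1 -> \forall n \near \oo, h n s = radial_slope g (Num.sqrt s) / 2 &
      forall n s, 0 < s < 1 -> `|F n s - height g (Num.sqrt s)| <= 16 * K / n.+1%:R].
Proof.
have [S [c [dS S0 S1 S01]]] := smooth_step_exists R.
have K0 := radial_bound_ge0 g.
(* q is the derivative of the profile with respect to s; A n and B n are the
   cut-offs near 0 and near 1 *)
pose q s := radial_slope g (Num.sqrt s) / 2.
pose A n s := S (n.+1%:R * s + (-1)); pose B n s := S (- n.+1%:R * s + n%:R).
pose h n s := A n s * (B n s * q s).
have np n : 0 < n.+1%:R :> R by rewrite ltr0n.
have nS n : n.+1%:R = n%:R + 1 :> R by rewrite -natr1.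
have qK s : `|q s| <= K.
  rewrite /q normrM (@ger0_norm _ 2^-1) ?invr_ge0// ler_pdivrMr// mulrC.
  exact: slope_bound (sqrtr_ge0 s).
have A1 n s : 2 <= n.+1%:R * s -> A n s = 1 by move=> H; apply: S1; lra.
have B1 n s : n.+1%:R * s <= n.+1%:R - 2 -> B n s = 1.
  by move=> H; apply: S1; have e := nS n; lra.
have A0 n s : n.+1%:R * s <= 1 -> A n s = 0 by move=> H; apply: S0; lra.
have B0 n s : n.+1%:R - 1 <= n.+1%:R * s -> B n s = 0.
  by move=> H; apply: S0; have e := nS n; lra.
have hK n s : `|h n s| <= K.
  have /andP[a0 a1] : 0 <= A n s <= 1 := S01 _.
  have /andP[b0 b1] : 0 <= B n s <= 1 := S01 _.
  have ab : A n s * B n s <= 1 by rewrite mulr_ile1.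
  have ab0 : 0 <= A n s * B n s by rewrite mulr_ge0.
  rewrite /h mulrA normrM (ger0_norm ab0).
  exact: le_trans (ler_piMl (normr_ge0 (q s)) ab) (qK s).
have sh n : smooth1 (h n).
  apply: (@smooth1_vanishing R g S c dS n.+1%:R^-1); first by rewrite invr_gt0.
  pose l s := A n s * (B n s * (2^-1 * ((Num.sqrt s * vel 1 g (Num.sqrt s) +
     (-1) * traj 1 g (Num.sqrt s)) *
     ((Num.sqrt s)^-1 * ((Num.sqrt s)^-1 * (Num.sqrt s)^-1))))).
  exists l; split.
  - by rewrite /l /A /B; smooth_pos_tac.
  - move=> s s0; rewrite /h /l /q /radial_slope; congr (_ * (_ * _)).
    by field; rewrite gt_eqF// sqrtr_gt0.
  - move=> s sn; rewrite /h A0 ?mul0r//.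
    by rewrite -(@ler_pM2l _ n.+1%:R^-1) ?invr_gt0// mulKf ?gt_eqF// mulr1 ltW.
have prim n : exists F : R -> R, F 1 = 0 /\ forall s : R, is_derive s 1 F (h n s).
  have ch : continuous (h n).
    move=> s; have [P [Ph HP]] := sh n; have [df _ d] := HP _ Ph; exact: der_cont (d s).
  have [F [_ dF]] := primitive_exists ch.
  by exists (fun s => F s - F 1); split; [rewrite subrr|move=> s; derive; ring].
have [F HF] := choice prim.
have F1 n : F n 1 = 0 := (HF n).1.
have dF n s : is_derive s 1 (F n) (h n s) := (HF n).2 s.
exists F, h; split => //.
- move=> n; apply: (@radial_test R (F n) (1 - n.+1%:R^-1)).
  + exact: (smooth1_primitive (sh n) (dF n)).
  + by rewrite ltrBlDr ltrDl invr_gt0 ltr0n.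
  + move=> s hs; rewrite -(F1 n).
    have z t : s <= t <= Num.max s 1 -> is_derive t 1 (F n) 0.
      move=> /andP[st _]; apply: derE (dF n t) _.
      rewrite /h B0 ?mul0r ?mulr0//.
      have h1 : n.+1%:R * (1 - n.+1%:R^-1) <= n.+1%:R * t.
        by rewrite ler_pM2l//; apply: le_trans st.
      by move: h1; rewrite mulrBr mulr1 divff ?gt_eqF.
    case: (lerP s 1) => s1.
      apply: (der0_eq s1) => t ht; apply: z.
      by rewrite max_r.
    apply/esym/(der0_eq (ltW s1)) => t /andP[t1 ts].
    apply: derE (dF n t) _; rewrite /h B0 ?mul0r ?mulr0//.
    by have := ler_wpM2l (ltW (np n)) t1; rewrite mulr1; apply: le_trans; rewrite lerBlDr lerDl.
- move=> s /andP[s0 s1].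
  have m0 : 0 < Num.min s (1 - s) by rewrite lt_min s0 subr_gt0.
  pose M := 2 / Num.min s (1 - s).
  near=> n.
  have hn : M <= n.+1%:R.
    by rewrite -nat1r -lerBlDl; near: n; exact: nbhs_infty_ger.
  have e : 2 <= n.+1%:R * Num.min s (1 - s) by rewrite -ler_pdivrMr.
  have e1 : n.+1%:R * Num.min s (1 - s) <= n.+1%:R * s by rewrite ler_pM2l// ge_min lexx.
  have e2 : n.+1%:R * Num.min s (1 - s) <= n.+1%:R * (1 - s) by rewrite ler_pM2l// ge_min lexx orbT.
  rewrite /h A1 ?B1 ?mul1r//; last exact: le_trans e1.
  by rewrite mulrBr mulr1 in e2; have := le_trans e e2; rewrite !lerBrDr addrC.
move=> n s /andP[s0 s1].
pose D s := F n s - height g (Num.sqrt s).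
have D1 : D 1 = 0.
  by rewrite /D F1 sqrtr1 /height oner_eq0 u1 mul0r subrr.
have dD s' : 0 < s' -> is_derive s' 1 D (h n s' - q s').
  move=> s'0; have d1 := dF n s'; have d2 := der_height_sqrt g s'0.
  exact: derD d1 (derN d2).
have DL a b : 0 < a -> a <= b -> `|D b - D a| <= 2 * K * (b - a).
  move=> a0 ab; apply: (lipschitz_der (dF := fun s => h n s - q s)) => // t /andP[ta tb].
    by apply: dD; exact: lt_le_trans ta.
  apply: le_trans (ler_normB _ _) _; have := hK n t; have := qK t; lra.
have Dc a b : 2 <= n.+1%:R * a -> a <= b -> n.+1%:R * b <= n.+1%:R - 2 -> D a = D b.
  move=> a2 ab b2; apply: (der0_eq ab) => t /andP[ta tb].
  have nt1 : n.+1%:R * a <= n.+1%:R * t by rewrite ler_pM2l.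
  have nt2 : n.+1%:R * t <= n.+1%:R * b by rewrite ler_pM2l.
  have t0 : 0 < t.
    by rewrite -(@pmulr_rgt0 _ n.+1%:R)//; apply: lt_le_trans (le_trans a2 nt1).
  apply: derE (dD t t0) _; rewrite /h A1 ?B1 ?mul1r ?subrr//.
    exact: le_trans b2.
  exact: le_trans nt1.
(* D is constant on [d, 1 - d] and 2 K-Lipschitz everywhere *)
pose d : R := 2 / n.+1%:R.
have d0 : 0 < d by rewrite divr_gt0.
have nd : n.+1%:R * d = 2 by rewrite /d mulrCA divff ?mulr1 ?gt_eqF.
have goal_eq : 16 * K / n.+1%:R = 8 * K * d by rewrite /d; field; rewrite gt_eqF.
clearbody d.
have near1 t : 0 < t -> t <= 1 -> `|D t| <= 2 * K * (1 - t).
  by move=> t0 t1; have := DL t 1 t0 t1; rewrite D1 sub0r normrN.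
have mid t : d <= t -> t <= 1 -> `|D t| <= 2 * K * d.
  move=> dt t1; have t0 : 0 < t by exact: lt_le_trans dt.
  case: (lerP (1 - d) t) => td.
    by apply: le_trans (near1 t t0 t1) _; rewrite ler_wpM2l ?mulr_ge0//; lra.
  rewrite (@Dc t (1 - d)); [|idtac|exact: ltW|idtac].
  + have E : 1 - (1 - d) = d by ring.
    by have := near1 (1 - d); rewrite E; apply; lra.
  + by rewrite -nd ler_pM2l.
  + by rewrite mulrBr nd mulr1.
rewrite -/(D s).
rewrite goal_eq.
have Kd : 0 <= K * d by rewrite mulr_ge0// ltW.
case: (lerP d s) => ds.
  have := mid s ds (ltW s1); rewrite -!mulrA; lra.
(* for s < d compare with s = d; if d > 1 the whole interval is shorter than d *)
case: (lerP d 1) => d1.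
  have := mid d (lexx _) d1; have := DL s d s0 (ltW ds).
  have := ler_normB (D d) (D d - D s); rewrite opprB addrC subrK.
  have : K * (d - s) <= K * d by rewrite ler_wpM2l//; lra.
  rewrite -!mulrA; lra.
have := near1 s s0 (ltW s1).
have : K * (1 - s) <= K * d by rewrite ler_wpM2l//; lra.
rewrite -!mulrA; lra.
Unshelve. all: by end_near. Qed.

End height_approximation.

(** * Square integrable functions on the ball *)

Section L2.
Variable R : realType.
Local Notation mu := (lebesgue3 R).
Local Notation B1 := (@B1 R).
Implicit Types f : R3 R -> R.

Lemma B1_integrable f (C : R) : measurable_fun setT f -> (forall x, B1 x -> `|f x| <= C) ->
  mu.-integrable B1 (EFin \o f).
Proof.
move=> mf fC; apply: measurable_bounded_integrable.
- exact: measurable_B1.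
- exact: mu_B1.
- exact: measurable_funS mf.
- by exists C; split; [exact: num_real|move=> M CM x Bx; exact: le_trans (fC x Bx) (ltW CM)].
Qed.

Lemma L2norm_sqrt f (C : R) : measurable_fun setT f -> (forall x, B1 x -> `|f x| <= C) ->
  L2norm f = (Num.sqrt (\int[mu]_(x in B1) (f x ^+ 2)))%:E.
Proof.
move=> mf fC; rewrite /L2norm unlock.
have -> : (\int[mu]_x (`|(EFin \o (f \_ B1)) x| `^ 2) = \int[mu]_(x in B1) (f x ^+ 2)%:E)%E.
  rewrite [RHS]integral_mkcond; apply: eq_integral => x _ /=.
  rewrite !patchE; case: ifP => _; rewrite /= ?normr0 ?powR0//.
  by rewrite powR_mulrn// real_normK// num_real.
have i2 : mu.-integrable B1 (EFin \o (fun x => f x ^+ 2)).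
  apply: (@B1_integrable _ (C ^+ 2)); first exact: measurable_funX.
  move=> x Bx; rewrite normrX; apply: lerXn2r; rewrite ?nnegrE//; last exact: fC.
  exact: le_trans (fC x Bx).
have i0 : (0 <= \int[mu]_(x in B1) (f x ^+ 2)%:E)%E.
  by apply: integral_ge0 => x _; rewrite lee_fin sqr_ge0.
have fn : (\int[mu]_(x in B1) (f x ^+ 2)%:E)%E \is a fin_num.
  by apply: (integrable_fin_num _ i2); exact: measurable_B1.
rewrite -(fineK fn) poweR_EFin powR12_sqrt//.
exact: fine_ge0.
Qed.

Lemma inL2_bounded f (C : R) : measurable_fun setT f -> (forall x, B1 x -> `|f x| <= C) -> inL2 f.
Proof.
move=> mf fC; have mBf : measurable_fun B1 f by exact: measurable_funS mf.
rewrite /inL2 inE /=; apply/andP; split.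
  rewrite inE /=. exact: (measurable_restrictT f (@measurable_B1 R)).1.
have h : (L2norm f < +oo)%E by rewrite (L2norm_sqrt mf fC) ltry.
by rewrite inE; exact: h.
Qed.

(** Dominated convergence; the ball has finite measure, so bounded convergence
    suffices. *)
Lemma L2norm_cvg0 (D : nat -> R3 R -> R) (C : R) : (forall n, measurable_fun setT (D n)) ->
  (forall n x, B1 x -> `|D n x| <= C) -> (forall x, B1 x -> D ^~ x @ \oo --> (0 : R)) ->
  (fun n => L2norm (D n)) @ \oo --> 0%E.
Proof.
move=> mD DC D0.
under eq_fun do rewrite (L2norm_sqrt (mD _) (DC _)).
have mB := @measurable_B1 R.
have C2 n x : B1 x -> `|D n x ^+ 2| <= C ^+ 2.
  move=> Bx; rewrite normrX; apply: lerXn2r; rewrite ?nnegrE//; last exact: DC.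
  exact: le_trans (DC n x Bx).
have H := @dominated_cvg _ _ R mu B1 mB (fun n x => (D n x ^+ 2)%:E) (cst 0%E) (cst (C ^+ 2)%:E).
have {}H : (\int[mu]_(x in B1) (D n x ^+ 2)%:E)%E @[n --> \oo] --> (\int[mu]_(x in B1) (cst 0%E x))%E.
  apply: H => //.
  - move=> n; apply/measurable_EFinP; apply: measurable_funX; exact: measurable_funS (mD n).
  - move=> x Bx; apply: cvg_EFin; first by near=> n.
    rewrite [X in _ --> X](_ : _ = (0 : R) * 0); last by rewrite mul0r.
    by apply: cvgM; exact: D0.
  - apply: (@B1_integrable (cst (C ^+ 2)) (C ^+ 2)) => //.
    by move=> x _; rewrite ger0_norm// sqr_ge0.
rewrite integral0 in H.
have {}H := @fine_cvg _ _ _ eventually_filter _ _ H.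
apply/fine_cvgP; split; first by near=> n.
have H2 := @continuous_cvg _ R R _ _ _ (Num.sqrt : R -> R) 0 (@sqrt_continuous R 0) H.
by rewrite sqrtr0 in H2; exact: H2.
Unshelve. all: by end_near. Qed.

End L2.

(** * Derivatives of the radial solution *)

Section radial_solution.
Variable R : realType.
Variable g : R.
Local Notation mu := (lebesgue3 R).
Local Notation B1 := (@B1 R).
Local Notation K := (radial_bound g).
Local Notation N := (`|g| + 2).
Implicit Types (x : R3 R) (s : R).

Definition radial_height x := height g (enorm x).
Local Notation W := radial_height.
Definition radial_grad (i : 'I_3) x := component i x * radial_slope g (enorm x).

Lemma enorm_ge0 x : 0 <= enorm x. Proof. exact: sqrtr_ge0. Qed.

Lemma sqnorm_ge0 x : 0 <= sqnorm x. Proof. by rewrite !addr_ge0 ?sqr_ge0. Qed.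

Lemma enorm_sqr x : enorm x ^+ 2 = sqnorm x.
Proof. by rewrite sqr_sqrtr ?sqnorm_ge0. Qed.

Lemma sqnorm_gt0 x : x != 0 -> 0 < sqnorm x.
Proof.
move=> x0; rewrite lt_neqAle sqnorm_ge0 andbT; apply: contra x0 => /eqP /esym.
case: x => [[a b] c]; rewrite /sqnorm /= => H.
have a2 := sqr_ge0 a; have b2 := sqr_ge0 b; have c2 := sqr_ge0 c.
have a0 : a ^+ 2 = 0 by lra.
have b0 : b ^+ 2 = 0 by lra.
have c0 : c ^+ 2 = 0 by lra.
by move/eqP: a0; move/eqP: b0; move/eqP: c0; rewrite !expf_eq0 /= => /eqP -> /eqP -> /eqP ->.
Qed.

Lemma component_le i x : `|component i x| <= enorm x.
Proof.
rewrite -(@ler_pXn2r _ 2)// ?nnegrE ?enorm_ge0//.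
by rewrite enorm_sqr real_normK ?num_real// coord_sq_le.
Qed.

Lemma component0 (i : 'I_3) : component i (0 : R3 R) = 0.
Proof. by case: i => -[|[|[|//]]] ?. Qed.

Lemma enorm0 : enorm (0 : R3 R) = 0.
Proof. by rewrite /enorm /= expr0n /= !addr0 sqrtr0. Qed.

(** The second derivative off the origin; the value at the origin is the one for
    which the divergence formula holds there too. *)
Definition radial_grad_der (i : 'I_3) x := if x == 0 then force 1 g / 3 else
  radial_slope g (enorm x) + component i x ^+ 2 *
    ((force 1 (height g (enorm x)) - 3 * radial_slope g (enorm x)) / sqnorm x).

Lemma der_slope_sqrt s : 0 < s -> is_derive s 1 (fun s => radial_slope g (Num.sqrt s))
  ((force 1 (height g (Num.sqrt s)) - 3 * radial_slope g (Num.sqrt s)) / (2 * s)).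
Proof.
move=> s0; have rp : 0 < Num.sqrt s by rewrite sqrtr_gt0.
have rn : Num.sqrt s != 0 by rewrite gt_eqF.
have ds := der_sqrt s0.
have du := der_comp (f := traj 1 g) (g := fun s : R => Num.sqrt s) (traj_der g (@i01 R) (ltW rp)) ds.
have dv := der_comp (f := vel 1 g) (g := fun s : R => Num.sqrt s) (vel_der g (@i01 R) (ltW rp)) ds.
have r3 : Num.sqrt s ^+ 3 != 0 by rewrite expf_neq0.
have d3 : is_derive s 1 (fun s : R => Num.sqrt s ^+ 3) (3 * Num.sqrt s ^+ 2 * (2^-1 * (Num.sqrt s)^-1)).
  exact: derX.
have di := derV (f := fun s : R => Num.sqrt s ^+ 3) r3 d3.
rewrite /radial_slope; derive.
have -> : height g (Num.sqrt s) = traj 1 g (Num.sqrt s) / Num.sqrt s by rewrite /height gt_eqF.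
rewrite /accel.
have e : Num.sqrt s * Num.sqrt s = s by rewrite -expr2 sqr_sqrtr// ltW.
have -> : (2 * s)^-1 = (2 * (Num.sqrt s * Num.sqrt s))^-1 by rewrite e.
move: (force _ _) => f; clear - rn; move: (Num.sqrt s) rn => r rn.
by field; rewrite rn.
Qed.

Lemma der_radial_height i x : x != 0 -> is_derive x (Defs.basis R i) W (radial_grad i x).
Proof.
move=> /sqnorm_gt0 sx; have := der_sqnorm_comp i (der_height_sqrt g sx) => H.
suff <- : 2 * component i x * (radial_slope g (Num.sqrt (sqnorm x)) / 2) = radial_grad i x by [].
by rewrite /radial_grad /enorm -/(sqnorm x); field.
Qed.

Lemma der_component i x : is_derive x (Defs.basis R i) (component i) (1 : R).
Proof. by apply: der_line; under eq_fun do rewrite coord_line; exact: der_id. Qed.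

Lemma der_radial_grad i x : x != 0 -> is_derive x (Defs.basis R i) (radial_grad i) (radial_grad_der i x).
Proof.
move=> x0; have sx := sqnorm_gt0 x0; have H := der_sqnorm_comp i (der_slope_sqrt sx).
have C := der_component i x.
have M := @is_deriveM _ _ (component i) (fun x => radial_slope g (Num.sqrt (sqnorm x))) x _ _ _ C H.
suff <- : component i x *: (2 * component i x * ((force 1 (height g (Num.sqrt (sqnorm x))) -
   3 * radial_slope g (Num.sqrt (sqnorm x))) / (2 * sqnorm x))) + radial_slope g (Num.sqrt (sqnorm x)) *: 1
   = radial_grad_der i x by [].
rewrite /radial_grad_der (negbTE x0) /enorm -/(sqnorm x) /GRing.scale /=.
by field; rewrite gt_eqF.
Qed.

Lemma cont_sqnorm_comp (f : R -> R) x : {for sqnorm x, continuous f} ->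
  {for x, continuous (fun x => f (sqnorm x))}.
Proof. by move=> cf; apply: (@continuous_comp _ _ _ (@sqnorm R) f) => //; exact: continuous_sqnorm. Qed.

Lemma cont_radial_height x : x != 0 -> {for x, continuous W}.
Proof. by move=> /sqnorm_gt0 sx; apply: (cont_sqnorm_comp (der_cont (der_height_sqrt g sx))). Qed.

Lemma cont_slope x : x != 0 -> {for x, continuous (fun x => radial_slope g (enorm x))}.
Proof. by move=> /sqnorm_gt0 sx; apply: (cont_sqnorm_comp (der_cont (der_slope_sqrt sx))). Qed.

Lemma cont_radial_grad i x : x != 0 -> {for x, continuous (radial_grad i)}.
Proof. by move=> x0; apply: cvgM; [exact: coord_cont|exact: cont_slope]. Qed.

Lemma cont_radial_grad_der i x : x != 0 -> {for x, continuous (radial_grad_der i)}.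
Proof.
move=> x0; have sx := sqnorm_gt0 x0.
pose D x := radial_slope g (enorm x) + component i x ^+ 2 *
    ((force 1 (W x) - 3 * radial_slope g (enorm x)) / sqnorm x).
have cD : {for x, continuous D}.
  have cs := cont_slope x0; have cW := cont_radial_height x0.
  apply: cvgD => //; apply: cvgM; first exact: (continuous_sqr3 (@coord_cont R i)).
  apply: cvgM; last by apply: cvgV; [rewrite gt_eqF|exact: continuous_sqnorm].
  apply: cvgB; last by apply: cvgM => //; exact: cvg_cst.
  apply: cvgB; first by apply: cvgM => //; exact: cvg_cst.
  by apply: (@continuous_comp _ _ _ W (fun y => y ^+ 3)) => //; exact: exprn_continuous.
have E : radial_grad_der i x = D x by rewrite /radial_grad_der (negbTE x0).
suff : radial_grad_der i y @[y --> x] --> D x by rewrite -E.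
have nE : \near x, D x = radial_grad_der i x.
  have : nbhs x (~` [set (0 : R3 R)]).
    apply: open_nbhs_nbhs; split; last exact/eqP.
    by apply: closed_openC; apply: accessible_closed_set1; apply: hausdorff_accessible; exact: norm_hausdorff.
  by apply: filterS => y /= /eqP y0; rewrite /radial_grad_der (negbTE y0).
exact: cvg_trans (near_eq_cvg nE) cD.
Qed.

(** The trace of the second derivatives is 3 q + (f - 3 q) = f, with q the radial
    slope. *)
Lemma radial_divergence x : \sum_(i < 3) radial_grad_der i x = W x - W x ^+ 3.
Proof.
rewrite !big_ord_recl big_ord0 addr0 /radial_grad_der; have [->|x0] := eqVneq x 0.
  by rewrite /radial_height enorm0 /height eqxx /force; field.
have sx := sqnorm_gt0 x0; rewrite /component /force /=.
have E : x.2 ^+ 2 = sqnorm x - x.1.1 ^+ 2 - x.1.2 ^+ 2 by rewrite /sqnorm; ring.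
rewrite E /radial_height.
by field; rewrite gt_eqF.
Qed.

Lemma B1_enorm x : B1 x -> enorm x < 1. Proof. by []. Qed.

Definition ibp_bound : R := N + 9 * K.

Lemma height_le_ibp_bound : N <= ibp_bound.
Proof. by rewrite lerDl mulr_ge0// radial_bound_ge0. Qed.

Lemma radial_height_bound x : `|W x| <= ibp_bound.
Proof. exact: le_trans (height_bound g (enorm_ge0 x)) height_le_ibp_bound. Qed.

Lemma radial_grad_le i x : B1 x -> `|radial_grad i x| <= 2 * K.
Proof.
move=> Bx; rewrite normrM; have h1 := component_le i x; have h2 := ltW (B1_enorm Bx).
have h3 := slope_bound g (enorm_ge0 x); apply: le_trans h3.
by rewrite ler_piMl// (le_trans h1).
Qed.

Lemma radial_grad_bound i x : B1 x -> `|radial_grad i x| <= ibp_bound.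
Proof.
move=> /(radial_grad_le i) h; apply: le_trans h _; have := radial_bound_ge0 g.
have := normr_ge0 g; rewrite /ibp_bound; lra.
Qed.

Lemma force_height_bound r : 0 <= r -> `|force 1 (height g r)| <= K.
Proof.
move=> r0; apply: force_bound (@i01 R) _ (height_bound g r0).
by rewrite addr_ge0.
Qed.

Lemma radial_grad_der_bound i x : `|radial_grad_der i x| <= ibp_bound.
Proof.
have K0 := radial_bound_ge0 g; have g0 := normr_ge0 g.
rewrite /radial_grad_der; case: ifPn => [_|x0].
  have := force_height_bound (lexx 0); rewrite /height eqxx => h.
  rewrite normrM normfV (@ger0_norm _ 3)// ler_pdivrMr//; apply: le_trans h _.
  by rewrite /ibp_bound; lra.
have sx := sqnorm_gt0 x0.
have h1 := slope_bound g (enorm_ge0 x); have h2 := force_height_bound (enorm_ge0 x).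
have q0 : 0 <= component i x ^+ 2 / sqnorm x by rewrite divr_ge0 ?sqr_ge0 ?sqnorm_ge0.
have q1 : component i x ^+ 2 / sqnorm x <= 1 by rewrite ler_pdivrMr// mul1r coord_sq_le.
have -> : component i x ^+ 2 * ((force 1 (height g (enorm x)) - 3 * radial_slope g (enorm x)) / sqnorm x)
  = component i x ^+ 2 / sqnorm x * (force 1 (height g (enorm x)) - 3 * radial_slope g (enorm x)) by ring.
move: q0 q1; move: (component i x ^+ 2 / sqnorm x) => q q0 q1.
apply: le_trans (ler_normD _ _) _; rewrite [`|q * _|]normrM (ger0_norm q0).
have h3 : `|force 1 (height g (enorm x)) - 3 * radial_slope g (enorm x)| <= 7 * K.
  apply: le_trans (ler_normB _ _) _; rewrite [`|3 * _|]normrM (@ger0_norm _ 3)//; lra.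
have h4 : q * `|force 1 (height g (enorm x)) - 3 * radial_slope g (enorm x)| <= 7 * K.
  by apply: le_trans h3; rewrite ler_piMl.
rewrite /ibp_bound; lra.
Qed.

End radial_solution.

(** * The radial profile is a weak solution *)

Section nodal.
Variable R : realType.
Variable g : R.
Local Notation mu := (lebesgue3 R).
Local Notation B1 := (@B1 R).
Local Notation K := (radial_bound g).
Local Notation N := (`|g| + 2).
Local Notation W := (radial_height g).
Local Notation M := (ibp_bound g).
Implicit Types (x : R3 R) (s : R).

Lemma radial_height_meas : measurable_fun setT W.
Proof. exact: off0_measurable (@cont_radial_height R g). Qed.

Lemma radial_grad_meas i : measurable_fun setT (radial_grad g i).
Proof. exact: off0_measurable (@cont_radial_grad R g i). Qed.

Lemma radial_height_inH1 : inH1 W (radial_grad g).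
Proof.
split; first exact: inL2_bounded radial_height_meas (fun x _ => radial_height_bound g x).
move=> i; split; first exact: inL2_bounded (radial_grad_meas i) (@radial_grad_le R g i).
move=> phi tphi.
have [_ _ ->//] := @ibp R i W (radial_grad g i) phi M tphi (@cont_radial_height R g)
  (@cont_radial_grad R g i) (@der_radial_height R g i) (fun x _ => radial_height_bound g x) (@radial_grad_bound R g i).
Qed.

Lemma test_product_integrable (f phi : R3 R -> R) (C : R) : test_function phi -> measurable_fun setT f ->
  (forall x, B1 x -> `|f x| <= C) -> mu.-integrable B1 (EFin \o (fun x => f x * phi x)).
Proof.
move=> tphi mf fC; have cphi := test_cont tphi.
have [C1 C10 b1] := cont_test_bounded cphi (fun x nx => (@test_off _ _ tphi ord0 x nx).1).
apply: (@B1_integrable _ _ (C * C1)).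
  by apply: measurable_funM => //; exact: continuous_measurable3.
by move=> x Bx; rewrite normrM; apply: ler_pM => //; exact: fC.
Qed.

(** Integration by parts in each direction, summed with [radial_divergence]. *)
Lemma radial_height_weak : weak_solution W (radial_grad g).
Proof.
move=> phi tphi; have mB := @measurable_B1 R.
have I i := @ibp R i (radial_grad g i) (radial_grad_der g i) phi M tphi
  (@cont_radial_grad R g i) (@cont_radial_grad_der R g i) (@der_radial_grad R g i) (@radial_grad_bound R g i)
  (fun x _ => radial_grad_der_bound g i x).
pose o0 : 'I_3 := ord0; pose o1 : 'I_3 := lift ord0 ord0.
pose o2 : 'I_3 := lift ord0 (lift ord0 ord0).
have [a0 b0 e0] := I o0; have [a1 b1 e1] := I o1; have [a2 b2 e2] := I o2.
have iW := test_product_integrable tphi radial_height_meas (fun x _ => radial_height_bound g x).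
pose G i x := radial_grad g i x * partial i phi x.
pose H i x := radial_grad_der g i x * phi x.
have E1 : \int[mu]_(x in B1) ((\sum_(i < 3) radial_grad g i x * partial i phi x) + W x * phi x) =
  \int[mu]_(x in B1) (G o0 x + (G o1 x + (G o2 x + W x * phi x))).
  apply: eq_Rintegral => x _; rewrite !big_ord_recl big_ord0 /G.
  by rewrite addr0 -!addrA.
have E2 : \int[mu]_(x in B1) (W x * phi x) =
  \int[mu]_(x in B1) (H o0 x + (H o1 x + (H o2 x + W x ^+ 3 * phi x))).
  apply: eq_Rintegral => x _; rewrite /H.
  have := radial_divergence g x; rewrite !big_ord_recl big_ord0 addr0 => E.
  have E' : W x = radial_grad_der g o0 x + (radial_grad_der g o1 x + radial_grad_der g o2 x) + W x ^+ 3.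
    by rewrite E subrK.
  by rewrite {1}E'; ring.
have iW3 : mu.-integrable B1 (EFin \o (fun x => W x ^+ 3 * phi x)).
  apply: (@test_product_integrable (fun x => W x ^+ 3) phi (M ^+ 3)) => //.
    by apply: measurable_funX; exact: radial_height_meas.
  move=> x _; rewrite normrX; have h := radial_height_bound g x; apply: lerXn2r; rewrite ?nnegrE//.
  exact: le_trans h.
have add3 (A B C D : R3 R -> R) : mu.-integrable B1 (EFin \o A) -> mu.-integrable B1 (EFin \o B) ->
   mu.-integrable B1 (EFin \o C) -> mu.-integrable B1 (EFin \o D) ->
   \int[mu]_(x in B1) (A x + (B x + (C x + D x))) = \int[mu]_(x in B1) A x +
     (\int[mu]_(x in B1) B x + (\int[mu]_(x in B1) C x + \int[mu]_(x in B1) D x)).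
  move=> iA iB iC iD.
  have iCD : mu.-integrable B1 (EFin \o (fun x => C x + D x)) := @integrableD _ _ R mu B1 mB (EFin \o C) (EFin \o D) iC iD.
  have iBCD : mu.-integrable B1 (EFin \o (fun x => B x + (C x + D x))) := @integrableD _ _ R mu B1 mB (EFin \o B) (EFin \o (fun x => C x + D x)) iB iCD.
  by rewrite RintegralD// RintegralD// RintegralD.
rewrite E1 (add3 (G o0) (G o1) (G o2) (fun x => W x * phi x) a0 a1 a2 iW).
rewrite E2 (add3 (H o0) (H o1) (H o2) (fun x => W x ^+ 3 * phi x) b0 b1 b2 iW3).
have {}e0 : \int[mu]_(x in B1) G o0 x = - \int[mu]_(x in B1) H o0 x := e0.
have {}e1 : \int[mu]_(x in B1) G o1 x = - \int[mu]_(x in B1) H o1 x := e1.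
have {}e2 : \int[mu]_(x in B1) G o2 x = - \int[mu]_(x in B1) H o2 x := e2.
have cancel (a b c d a' b' c' : R) : a' = - a -> b' = - b -> c' = - c ->
    a' + (b' + (c' + (a + (b + (c + d))))) = d by move=> -> -> ->; ring.
exact: (cancel _ _ _ _ _ _ _ e0 e1 e2).
Qed.

(** The estimates for the approximations hold off the origin and extend by
    continuity. *)
Lemma bound_at0 (D : R3 R -> R) (C : R) : {for 0, continuous D} ->
  (forall x, B1 x -> x != 0 -> `|D x| <= C) -> `|D 0| <= C.
Proof.
move=> cD DC; rewrite leNgt; apply/negP => CD.
have e0 : 0 < `|D 0| - C by rewrite subr_gt0.
move/cvgrPdist_lt: cD => /(_ _ e0) /nbhs_ballP[d /= d0 Hd].
pose t := Num.min (d / 2) 2^-1.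
have t0 : 0 < t by rewrite lt_min divr_gt0//= invr_gt0.
have td : t < d.
  by apply: le_lt_trans (_ : d / 2 < d); rewrite ?ge_min ?lexx// ltr_pdivrMr// mulr_natr mulr2n ltrDl.
have t1 : t < 1 by apply: le_lt_trans (_ : 2^-1 < 1); rewrite ?ge_min ?lexx ?orbT// invf_lt1// ltr1n.
pose p : R3 R := (t, 0, 0).
have pd : ball (0 : R3 R) d p.
  by apply/ball3E; split; rewrite /= ?sub0r ?normrN ?subrr ?normr0// gtr0_norm.
have pB : B1 p.
  by apply/B1E; rewrite /sqnorm /= expr0n /= !addr0 expr_lt1// ltW.
have p0 : p != 0 by apply/eqP => -[] /eqP; rewrite gt_eqF.
have h1 := Hd p pd; have h2 := DC p pB p0.
have h3 := ler_normD (D 0 - D p) (D p); rewrite subrK in h3; lra.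
Qed.

Lemma radial_height_cont0 : {for 0, continuous W}.
Proof.
apply/cvgrPdist_le => e e0; have K0 := radial_bound_ge0 g.
have : \forall x \near (0 : R3 R), sqnorm x < e / (K + 1).
  have e1 : 0 < e / (K + 1) by rewrite divr_gt0// ltr_pwDr.
  have s0 : sqnorm (0 : R3 R) = 0 by rewrite /sqnorm /= expr0n /= !addr0.
  have /cvgrPdist_lt/(_ _ e1) := @continuous_sqnorm R 0.
  by apply: filterS => x; rewrite s0 sub0r normrN ger0_norm ?sqnorm_ge0.
apply: filterS => x hx; rewrite distrC /radial_height enorm0 {2}/height eqxx.
apply: le_trans (height_near g (enorm_ge0 x)) _; rewrite enorm_sqr.
have K1 : 0 < K + 1 by rewrite ltr_pwDr.
rewrite ltr_pdivlMr// in hx; have s0 := sqnorm_ge0 x.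
have := mulr_ge0 K0 s0; nra.
Qed.

Lemma radial_height_cont x : {for x, continuous W}.
Proof. by have [->|x0] := eqVneq x 0; [exact: radial_height_cont0|exact: cont_radial_height]. Qed.

Lemma radial_height_inH10 : traj 1 g 1 = 0 -> inH10 W (radial_grad g).
Proof.
move=> u1; split; first exact: radial_height_inH1.
have [F [h [tF dF hK hlim FW]]] := height_approx u1.
have K0 := radial_bound_ge0 g.
have mF n := continuous_measurable3 (test_cont (tF n)).
have FW' n x : B1 x -> `|F n (sqnorm x) - W x| <= 16 * K / n.+1%:R.
  have off y : B1 y -> y != 0 -> `|F n (sqnorm y) - W y| <= 16 * K / n.+1%:R.
    by move=> /B1E y1 y0; apply: FW; rewrite sqnorm_gt0.
  have [->|x0] := eqVneq x 0; last by move=> Bx; exact: off.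
  move=> _; apply: (@bound_at0 (fun x => F n (sqnorm x) - W x)) => //.
  by apply: cvgB; [exact: test_cont (tF n) _|exact: radial_height_cont].
have pE n i x : partial i (fun x => F n (sqnorm x)) x = 2 * component i x * h n (sqnorm x).
  by have [_] := der_sqnorm_comp i (dF n (sqnorm x)).
exists (fun n x => F n (sqnorm x)); split => //.
- apply: (@L2norm_cvg0 R _ (16 * K)).
  + by move=> n; apply: measurable_funB => //; exact: radial_height_meas.
  + move=> n x Bx; apply: le_trans (FW' n x Bx) _.
    by rewrite ler_pdivrMr// ler_peMr ?mulr_ge0// ler1n.
  + move=> x Bx; apply/cvgrPdist_le => e e0; near=> n; rewrite sub0r normrN.
    have hn : 16 * K / e <= n.+1%:R.
      by rewrite -[n.+1%:R]nat1r -lerBlDl; near: n; exact: nbhs_infty_ger.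
    apply: le_trans (FW' n x Bx) _.
    by rewrite ler_pdivrMr// [e * _]mulrC -ler_pdivrMr.
- move=> i; apply: (@L2norm_cvg0 R _ (4 * K)).
  + move=> n; apply: measurable_funB; last exact: radial_grad_meas.
    exact: continuous_measurable3 (@test_partial_cont _ _ (tF n) i).
  + move=> n x Bx; apply: le_trans (ler_normB _ _) _; rewrite pE.
    have h1 := radial_grad_le g i Bx; have h2 := hK n (sqnorm x).
    have h3 := le_trans (component_le i x) (ltW (B1_enorm Bx)).
    rewrite -mulrA normrM (@ger0_norm _ 2)// normrM.
    have : `|component i x| * `|h n (sqnorm x)| <= K.
      by apply: le_trans h2; rewrite ler_piMl.
    lra.
  + move=> x Bx; have [->|x0] := eqVneq x 0.
      rewrite (_ : (fun n => _) = (fun n => 0 : R)); first exact: cvg_cst.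
      by apply/funext => n; rewrite /= pE /radial_grad component0 mulr0 !mul0r subrr.
    have s01 : 0 < sqnorm x < 1 by rewrite sqnorm_gt0//=; exact/B1E.
    apply: cvg_near_cst; apply: filterS (hlim _ s01) => n hn /=.
    by rewrite pE hn /radial_grad /enorm -/(sqnorm x); field.
Unshelve. all: by end_near. Qed.

End nodal.

(** * Nodal numbers *)

Section nodal_numbers.
Variable R : realType.
Implicit Types (a b g : R).

Lemma chain_bounds (x : nat -> R) m : 0 < x 0%N -> (forall j, (j < m)%N -> x j < x j.+1) ->
  x m < 1 -> forall j, (j <= m)%N -> 0 < x j < 1.
Proof.
move=> x0 xS x1 j jm; rewrite (lt_le_trans x0 (chain_le xS _))//=.
by apply: le_lt_trans x1; apply: chain_le xS _; rewrite jm leqnn.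
Qed.

Lemma enorm_axis (r : R) : 0 <= r -> enorm (r, 0, 0) = r.
Proof. by move=> r0; rewrite /enorm /= expr0n /= !addr0 sqrtr_sqr ger0_norm. Qed.

Lemma radial_sign_changes (U : R3 R -> R) (F : R -> R) m :
  (forall x, 0 < enorm x < 1 -> U x = F (enorm x) / enorm x) ->
  has_sign_changes U m <-> sign_changes F m.
Proof.
move=> UF.
have prodE p q : 0 < enorm p < 1 -> 0 < enorm q < 1 ->
    (U p * U q < 0) = (F (enorm p) * F (enorm q) < 0).
  move=> hp hq; have /andP[p0 _] := hp; have /andP[q0 _] := hq.
  rewrite !UF// mulrACA -invfM pmulr_llt0// invr_gt0.
  exact: mulr_gt0.
split=> -[x [x0 xS x1 H]]; exists x; split => // j jm;
    have h1 := chain_bounds x0 xS x1 (ltnW jm); have h2 := chain_bounds x0 xS x1 jm.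
  have /andP[p0 _] := h1; have /andP[q0 _] := h2.
  have e1 := enorm_axis (ltW p0); have e2 := enorm_axis (ltW q0).
  by have := H j jm _ _ e1 e2; rewrite prodE ?e1 ?e2.
by move=> p q ep eq; rewrite prodE ?ep ?eq//; exact: H.
Qed.

(** Sign changes of U are those of the difference of the two trajectories, since
    U times |x| is this difference. *)
Lemma theta_nodal_number (U : R3 R -> R) a b k : b < a -> (0 < k)%N -> theta a b = k%:R * pi ->
  (forall x, 0 < enorm x < 1 ->
     U x = (traj 1 a (enorm x) - traj 1 b (enorm x)) / enorm x) ->
  nodal_number_is U (k - 1).
Proof.
move=> ba k0 th UE.
have E m : has_sign_changes U m <-> (m <= k - 1)%N.
  rewrite (@radial_sign_changes U (fun r => traj 1 a r - traj 1 b r) m UE).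
  rewrite (theta_sign_changes ba) th ltr_pM2r ?pi_gt0// ltr_nat.
  by rewrite -[(m <= _)%N]ltnS subn1 prednK.
by split; [apply/E|move=> m /E].
Qed.

Lemma height_nodal_solution g k : 0 < g -> (0 < k)%N -> theta g 0 = k%:R * pi ->
  nodal_solution k (radial_height g).
Proof.
move=> g0 k0 th.
have zero (r : R) : 0 <= r -> traj 1 0 r = 0 by move=> r0; have [] := flow_zero (@i01 R) r0.
have u1 : traj 1 g 1 = 0.
  have [rho rho0 [+ _]] := theta_polar g0.
  rewrite th zero// subr0 => ->.
  by have := sin_npi k (0 : R); rewrite add0r sin0 mulr0 => ->; rewrite mulr0.
split.
- by move=> x _; exact: radial_height_cont.
- by move=> x y _ _ E; rewrite /radial_height E.
- by exists (radial_grad g); split; [exact: radial_height_inH10|exact: radial_height_weak].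
- by rewrite /radial_height enorm0 /height eqxx.
- apply: (theta_nodal_number g0 k0 th) => x /andP[x0 _].
  by rewrite zero ?ltW// subr0 /radial_height /height gt_eqF.
Qed.

End nodal_numbers.

Theorem theorem1p4 (R : realType) (w : nat -> R3 R -> R)
    (hw : forall k : nat, (0 < k)%N -> unique_nodal_solution k (w k)) :
  forall k i : nat, (0 < k)%N -> (0 < i)%N -> (i < k)%N ->
    nodal_number_is (w k \- w i) (k - 1) /\
    nodal_number_is (w k \+ w i) (k - 1).
Proof.
(* uniqueness enters here: every profile of angle n pi is w n *)
have wE g n : 0 < g -> (0 < n)%N -> theta g 0 = n%:R * pi ->
    forall x, B1 x -> w n x = radial_height g x.
  move=> g0 n0 th x Bx; have [_ u] := hw n n0.
  by rewrite (u _ (height_nodal_solution g0 n0 th)).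
(* the value at the origin of such a profile is its parameter *)
have T_inj n (g g' : R) : (0 < n)%N -> 0 < g -> 0 < g' ->
    theta g 0 = n%:R * pi -> theta g' 0 = n%:R * pi -> g = g'.
  move=> n0 g0 g'0 th th'.
  have B0 : B1 (0 : R3 R) by rewrite /B1 /= enorm0 ltr01.
  have := wE _ _ g0 n0 th 0 B0; rewrite (wE _ _ g'0 n0 th' 0 B0).
  by rewrite /radial_height enorm0 /height eqxx.
have [gam Hgam] : exists gam : nat -> R, forall n, (0 < n)%N ->
    0 < gam n /\ theta (gam n) 0 = n%:R * pi.
  have H n : exists g : R, (0 < n)%N -> 0 < g /\ theta g 0 = n%:R * pi.
    case: n => [|n]; first by exists 0.
    by have [g g0 th] := @T_level R n.+1 isT; exists g.
  by have [f Hf] := choice H; exists f.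
have gam0 n (n0 : (0 < n)%N) := (Hgam n n0).1.
have gamT n (n0 : (0 < n)%N) := (Hgam n n0).2.
move=> k i k0 i0 ik.
have [th1 th2] := theta_levels T_inj gam0 gamT i0 ik.
have lt_gam := gam_mono T_inj gam0 gamT i0 ik.
have wk x : 0 < enorm x < 1 -> w k x = traj 1 (gam k) (enorm x) / enorm x.
  move=> /andP[x0 x1]; rewrite (wE _ _ (gam0 k k0) k0 (gamT k k0))//.
  by rewrite /radial_height /height gt_eqF.
have wi x : 0 < enorm x < 1 -> w i x = traj 1 (gam i) (enorm x) / enorm x.
  move=> /andP[x0 x1]; rewrite (wE _ _ (gam0 i i0) i0 (gamT i i0))//.
  by rewrite /radial_height /height gt_eqF.
split.
  apply: (theta_nodal_number lt_gam k0 th1) => x hx.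
  by rewrite /= wk// wi// -mulrBl.
have lt_gam' : - gam i < gam k by apply: lt_trans (gam0 k k0); rewrite oppr_lt0 gam0.
apply: (theta_nodal_number lt_gam' k0 th2) => x hx.
have /andP[x0 _] := hx; have [-> _] := flowN (gam i) (@i01 R) (ltW x0).
by rewrite /= wk// wi// opprK -mulrDl.
Qed.
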